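(* Let $0<\gamma<n$, $1\leq p<n/\gamma$ and let $q$ satisfy $1/q=1/p-\gamma/n$. Let $u,v$ be weights on $\mathbb{R}^n$ such that either (i) $u\in A_1$ and $v^{q/p}\in A_1$, or (ii) $uv^{-q/p'}\in A_1$ and $v^q\in A_\infty(uv^{-q/p'})$. Then there exists a positive constant $C$ such that for every $t>0$ and every bounded function $f$ with compact support, \[ \left(uv^{q/p}\left(\left\{x\in\mathbb{R}^n:\frac{M_\gamma(fv)(x)}{v(x)}>t\right\}\right)\right)^{1/q}\leq\frac{C}{t}\left(\int_{\mathbb{R}^n}|f(x)|^p\,u(x)^{p/q}\,v(x)\,dx\right)^{1/p}. \]
   Context: A weight $w$ is a locally integrable function on $\mathbb{R}^n$ with $0<w(x)<\infty$ for a.e. $x$. For a nonnegative function $w$ and a measurable set $E$, $w(E)=\int_E w(x)\,dx$; thus $uv^{q/p}(E)=\int_E u(x)v(x)^{q/p}\,dx$. $p'$ is the conjugate exponent $p/(p-1)$ of $p$, with $p'=\infty$ if $p=1$ (so that $q/p'=0$ when $p=1$). Cubes $Q\subset\mathbb{R}^n$ have sides parallel to the coordinate axes; infima of weights over cubes are essential infima. The fractional maximal operator is $M_\gamma f(x)=\sup_{Q\ni x}\frac{1}{|Q|^{1-\gamma/n}}\int_Q|f(y)|\,dy$, the supremum being over all cubes containing $x$. $w\in A_1$ means there is $C>0$ with $\frac{1}{|Q|}\int_Q w\leq C\inf_Q w$ for every cube $Q$. For a weight $\mu$: $w\in A_r(\mu)$, $1<r<\infty$, means there is $C>0$ such that $\left(\frac{1}{\mu(Q)}\int_Q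 w\,\mu\,dx\right)\left(\frac{1}{\mu(Q)}\int_Q w^{-\frac{1}{r-1}}\mu\,dx\right)^{r-1}\leq C$ for every cube $Q$; $w\in A_1(\mu)$ means $\frac{1}{\mu(Q)}\int_Q w\,\mu\,dx\leq C\inf_Q w$ for every cube $Q$; and $A_\infty(\mu)=\bigcup_{1\le r<\infty}A_r(\mu)$. *)

(* Defs.v *)
From HB Require Import structures.
From mathcomp Require Import all_boot all_order all_algebra.
From mathcomp Require Import all_classical all_reals all_analysis.
From mathcomp Require Import measurable_realfun ess_sup_inf.

Set Implicit Arguments.
Unset Strict Implicit.
Unset Printing Implicit Defensive.
Import Order.TTheory GRing.Theory Num.Theory.
Import numFieldNormedType.Exports.

Local Open Scope classical_set_scope.
Local Open Scope ring_scope.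
Local Open Scope ereal_scope.

Section lebesgue_outer.
Context (R : realType) (n : nat).
Local Notation Rn := 'rV[R]_n.
Implicit Types (a b : Rn) (A : set Rn).

Definition box a b : set Rn :=
  [set x | forall i, (a ord0 i <= x ord0 i <= b ord0 i)%R].

Definition box_volume a b : R := (\prod_i (b ord0 i - a ord0 i))%R.

(* Countable families of closed boxes, given by their extreme corners. *)
Definition box_cover A : set (set (Rn * Rn)) :=
  [set S : set (Rn * Rn) | [/\ countable S,
     forall s : Rn * Rn, S s -> forall i, (s.1 ord0 i <= s.2 ord0 i)%R &
     A `<=` \bigcup_(s in S) box s.1 s.2]].

Definition lebesgue_outer A : \bar R :=
  ereal_inf [set \esum_(s in S) (box_volume s.1 s.2)%:E
  | S in box_cover A].

Lemma box_cover_sum_ge0 A (S : set (Rn * Rn)) : box_cover A S ->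
  0 <= \esum_(s in S) (box_volume s.1 s.2)%:E.
Proof.
case=> _ Sle _; apply: esum_ge0 => s Ss; rewrite lee_fin.
by apply: prodr_ge0 => i _; rewrite subr_ge0 Sle.
Qed.

Lemma lebesgue_outer_ge0 A : 0 <= lebesgue_outer A.
Proof.
apply: le_ereal_inf_tmp => x [S AS <-]; exact: (box_cover_sum_ge0 AS).
Qed.

Lemma lebesgue_outer0 : lebesgue_outer set0 = 0.
Proof.
apply/eqP; rewrite eq_le lebesgue_outer_ge0 andbT.
apply: ereal_inf_lbound; exists set0; last by rewrite esum_set0.
by split => //; exact: countable0.
Qed.

Lemma le_lebesgue_outer : {homo lebesgue_outer : A B / A `<=` B >-> A <= B}.
Proof.
move=> A B AB; apply/ereal_inf_le_tmp => x [S [cS Sle BS] <-].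
by exists S => //; split => //; exact: subset_trans AB BS.
Qed.

Lemma lebesgue_outer_sigma_subadditive : sigma_subadditive lebesgue_outer.
Proof.
move=> A; have [[i Aioo]|] := pselect (exists i, lebesgue_outer (A i) = +oo).
  rewrite (eseries_pinfty _ _ Aioo) ?leey// => k _.
  by rewrite -ltNye (lt_le_trans _ (lebesgue_outer_ge0 _)).
rewrite -forallNE => Aoo; apply/lee_addgt0Pr => e e0.
apply: le_trans (epsilon_trick _ _ (ltW e0)); last first.
  by move=> k; exact: lebesgue_outer_ge0.
have /choice[S AS] k : exists S, box_cover (A k) S /\
    \esum_(s in S) (box_volume s.1 s.2)%:E <=
    lebesgue_outer (A k) + (e / (2 ^ k.+1)%:R)%:E.
  have ek0 : (0 < e / (2 ^ k.+1)%:R)%R by rewrite divr_gt0// ltr0n expn_gt0.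
  have Akfin : lebesgue_outer (A k) \is a fin_num.
    by rewrite ge0_fin_numE ?lebesgue_outer_ge0// ltey; apply/eqP/Aoo.
  have [_ [S AS <-] /ltW Sle] := lb_ereal_inf_adherent ek0 Akfin.
  by exists S.
pose T := \bigcup_k S k.
have coverT : box_cover (\bigcup_k A k) T.
  split.
  - by apply: bigcup_countable => // k _; have [[]] := AS k.
  - by move=> s [k _ Sks]; have [[_ + _] _] := AS k; exact.
  - move=> x [k _ Akx]; have [[_ _ /(_ x Akx)[s Sks sx]] _] := AS k.
    by exists s => //; exists k.
apply: (@le_trans _ _ (\esum_(s in T) (box_volume s.1 s.2)%:E)).
  by apply: ereal_inf_lbound; exists T.
have ge0 s : T s -> 0 <= (box_volume s.1 s.2)%:E.
  have [_ Tle _] := coverT => Ts; rewrite lee_fin.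
  by apply: prodr_ge0 => i _; rewrite subr_ge0 Tle.
rewrite /T seqDU_bigcup_eq esum_bigcup; last 2 first.
- exact: (sub_trivIset (subsetT _) (trivIset_seqDU S)).
- by move=> s; rewrite -seqDU_bigcup_eq; exact: ge0.
rewrite nneseries_esumT; last first.
  move=> k; have [/box_cover_sum_ge0 + Sk] := AS k.
  by move=> /le_trans; apply.
apply: le_esum => k _; have [_ /(le_trans _)] := AS k; apply.
rewrite esum_mkcond [leRHS]esum_mkcond; apply: le_esum => s _.
case: ifPn => [|_]; first by rewrite inE => -[Sks _]; rewrite mem_set.
by case: ifPn => //; rewrite inE => Sks; apply: ge0; exists k.
Qed.

HB.instance Definition _ := isOuterMeasure.Build R Rn lebesgue_outer
  lebesgue_outer0 lebesgue_outer_ge0 le_lebesgue_outer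
  lebesgue_outer_sigma_subadditive.

End lebesgue_outer.

(* 'rV[R]_n with its sigma-algebra of Lebesgue measurable sets. *)
Notation lebesgue_type R n := (caratheodory_type (@lebesgue_outer R n)).

Section lebesgue_Rn.
Context (R : realType) (n : nat).

Definition lebesgue_Rn : set (lebesgue_type R n) -> \bar R := @lebesgue_outer R n.

HB.instance Definition _ := isMeasure.Build _ _ _ lebesgue_Rn
  (@caratheodory_measure0 _ _ (@lebesgue_outer R n))
  (@caratheodory_measure_ge0 _ _ (@lebesgue_outer R n))
  (@caratheodory_measure_sigma_additive _ _ (@lebesgue_outer R n)).

End lebesgue_Rn.

Section weights.
Context (R : realType) (n : nat).
Local Notation Rn := 'rV[R]_n.
Local Notation leb := (@lebesgue_Rn R n).
Implicit Types (w mu : Rn -> \bar R) (Q E : set Rn).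

(* The last clause also makes immaterial the conventions of [poweR] and [inve]
   at [0] and [+oo] in the powers and quotients of weights used below. *)
Definition weight w : Prop :=
  [/\ measurable_fun [set: lebesgue_type R n] w,
      forall K : set Rn, compact K -> \int[leb]_(x in K) `|w x| < +oo &
      {ae leb, forall x, 0 < w x < +oo}].

Definition wmeasure w E : \bar R := \int[leb]_(x in E) w x.

(* Closed, nondegenerate, axis-parallel cubes. *)
Definition cube Q : Prop :=
  exists a : Rn, exists2 l : R, (0 < l)%R &
    Q = [set x | forall i, (a ord0 i <= x ord0 i <= a ord0 i + l)%R].

(* Setting [w] to [+oo] off [Q] leaves only its values on [Q] to matter. *)
Definition ess_inf_on Q w : \bar R := ess_inf leb (patch (cst +oo) Q w).

Definition A1 w : Prop := exists2 C : R, (0 < C)%R &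
  forall Q, cube Q -> (leb Q)^-1 * \int[leb]_(x in Q) w x
    <= C%:E * ess_inf_on Q w.

Definition A1_weighted mu w : Prop := exists2 C : R, (0 < C)%R &
  forall Q, cube Q -> (wmeasure mu Q)^-1 * \int[leb]_(x in Q) (w x * mu x)
    <= C%:E * ess_inf_on Q w.

Definition Ar_weighted mu (r : R) w : Prop := exists2 C : R, (0 < C)%R &
  forall Q, cube Q ->
    ((wmeasure mu Q)^-1 * \int[leb]_(x in Q) (w x * mu x)) *
    ((wmeasure mu Q)^-1 *
       \int[leb]_(x in Q) (w x `^ (- (r - 1)^-1) * mu x)) `^ (r - 1)
    <= C%:E.

Definition Ainfty_weighted mu w : Prop :=
  A1_weighted mu w \/ exists2 r : R, (1 < r)%R & Ar_weighted mu r w.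

Definition frac_maximal (gamma : R) (f : Rn -> \bar R) (x : Rn) : \bar R :=
  ereal_sup [set (leb Q `^ (1 - gamma / n%:R))^-1 * \int[leb]_(y in Q) `|f y|
            | Q in [set Q | cube Q /\ Q x]].

(* The number q / p', which is 0 when p = 1 since then p' = +oo. *)
Definition conj_ratio (q p : R) : R :=
  fine (q%:E / hoelder_conjugate p%:E).

End weights.

(* Main.v *)
Require Import Defs.
From mathcomp Require Import all_boot all_order all_algebra.
From mathcomp Require Import all_classical all_reals all_analysis.
From mathcomp Require Import measurable_realfun ess_sup_inf ring lra.
Import Order.TTheory GRing.Theory Num.Theory.
Import numFieldNormedType.Exports.
Set Implicit Arguments.
Unset Strict Implicit.
Unset Printing Implicit Defensive.
Local Open Scope classical_set_scope.
Local Open Scope ring_scope.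
Local Open Scope ereal_scope.

(** Write [Q] for cubes, [|Q|] for their volume, [a = 1 / q], [c = gamma / n] and
    [e = 1 / p'], so that [a + c + e = 1].

    Reduction to a mixed inequality. Put [F = |f| ^ p u ^ (p / q) v]. In case (i)
    let [U = u], [V = v ^ (q / p)], [h = v], [b = 1]; in case (ii) let
    [U = b = u v ^ (- q / p')], [V = v ^ q], [h = 1]. In both cases
    [V U = u v ^ (q / p)], [V ^ a h ^ e = v], and [g = F / U] satisfies
    [|f| v = g ^ a F ^ c h ^ e] ([weak_type_factor]). The functions [h] and [b]
    are in [A1]. So if the fractional average of [|f| v] over a cube containing [x] exceeds
    [t v x], Hoelder's inequality, in the weak form [mass_holder], forces the
    average of [g] with respect to [b] over that cube to exceed [lam * V x], with
    [lam] a multiple of [(t / K ^ c) ^ q] and [K] the integral of [F]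
    ([average_gt]). It thus suffices to prove, for the maximal function [M g] of
    these averages, that the integral of [V U] over [{M g > V}] is at most a
    multiple of the integral of [g U]: applied to [g / lam], it bounds the
    measure of the level set by a multiple of [K / lam], whose power [1 / q] is
    [K ^ (1 / p) / t]. As every cube sits in a comparable cell of one of [2 ^ n]
    shifted dyadic grids ([one_third]), the averages may be restricted to the
    cells of one grid ([fractional_level_set]).

    The mixed inequality on a grid ([mixed_weak_type]). Here [U = u b], where
    [b = 1] in case (i) and [u = 1] in case (ii). On a cell [P], let [G] and [W]
    be the integrals of [g b] and [V b], and let [A] be the [b]-average of [g]. The
    points of the level set with [V > 2 A] lie in the maximal subcells where the
    average exceeds [2 A]. These carry at most half of the [b]-mass of [P], hence
    at most a fraction [eps] of [W]. The points where [V] is comparable to [A]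
    cost at most [A] times the [u b]-mass of [P], times
    [s ^ delta / (1 + s ^ delta) ^ 2] with [s = W / G]. This is at most a
    multiple of the decrease of [beta s = s ^ delta / (1 + s ^ delta)] when [s] is
    replaced by [eps * s]. So the concave quantity [G * beta (W / G)] pays for these points
    when passing from [P] to the subcells, and an induction over the generations
    proves the bound. The [A1] property of [u] converts [A] times the mass of
    [u b] into a multiple of an integral of [g u b].

    The two facts about the weights. Both [A1] and [A_r] bound the part of a cell
    where [V] is small compared to its mean ([small_values]), which gives the
    fraction [eps]. The cost of the points where [V] is comparable to [A] uses in
    addition that the [u b]-mass of a subset is at most a power of its relative
    [b]-mass. In case (ii) this is trivial. In case (i) it is [A1_decay]: with [M]
    the running maximum of the averages of [u], divided by the [A1] constant, the
    integrals of [M ^ eps (2 u - M)] do not increase with the generation, so that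
    [M ^ eps] is integrable against [u], and [u] is dominated by the supremum of
    [M] by differentiation ([dyadic_differentiation]).

    Lebesgue measure enters through the measurability of half-spaces and through
    [|Q| = l ^ n * unit_volume] for a cube of side [l], a consequence of scaling;
    when [unit_volume] is zero, all integrals vanish. *)

(** * Integrals of nonnegative densities *)

Section Mass.
Context d (T : measurableType d) (R : realType).
Variable m : {measure set T -> \bar R}.
Implicit Types (f g : T -> R) (A B : set T).

Definition density f := measurable_fun [set: T] f /\ forall x, (0 <= f x)%R.

Definition mass f A := \int[m]_(x in A) (f x)%:E.

Lemma density_measE f A : density f -> measurable_fun A (fun x => (f x)%:E).
Proof.
by move=> [mf _]; apply/measurable_EFinP; apply: measurable_funS mf.
Qed.

Lemma densityM f g : density f -> density g -> density (fun x => f x * g x)%R.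
Proof.
move=> [mf f0] [mg g0]; split; first exact: measurable_funM.
by move=> x; rewrite mulr_ge0.
Qed.

Lemma densityD f g : density f -> density g -> density (fun x => f x + g x)%R.
Proof.
move=> [mf f0] [mg g0]; split; first exact: measurable_funD.
by move=> x; rewrite addr_ge0.
Qed.

Lemma density_cst (r : R) : (0 <= r)%R -> density (fun=> r).
Proof. by move=> r0; split => //; exact: measurable_cst. Qed.

Lemma densityZ f (r : R) : (0 <= r)%R -> density f ->
  density (fun x => r * f x)%R.
Proof. by move=> r0; apply: densityM; exact: density_cst. Qed.

Lemma density_indic A : measurable A -> density (\1_A : T -> R).
Proof.
by move=> mA; split; [exact: measurable_indic|move=> x; rewrite indicE].
Qed.

Lemma density_powR f (r : R) : density f -> density (fun x => f x `^ r)%R.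
Proof.
move=> df; split => [|x]; last exact: powR_ge0.
by apply: (measurableT_comp (measurable_powR r)); exact: df.1.
Qed.

Lemma mass_ge0 f A : density f -> 0 <= mass f A.
Proof. by move=> [_ f0]; apply: integral_ge0 => x _; rewrite lee_fin. Qed.

Lemma le_mass f g A : measurable A -> density f -> density g ->
  (forall x, A x -> (f x <= g x)%R) -> mass f A <= mass g A.
Proof.
move=> mA df dg fg; apply: ge0_le_integral => //.
- by move=> x _; rewrite lee_fin df.2.
- exact: density_measE.
- exact: density_measE.
Qed.

Lemma ae_le_mass f g A : measurable A -> density f -> density g ->
  {ae m, forall x, A x -> (f x <= g x)%R} -> mass f A <= mass g A.
Proof.
move=> mA df dg fg; apply: ae_ge0_le_integral => //.
- by move=> x _; rewrite lee_fin df.2.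
- exact: density_measE.
- by move=> x _; rewrite lee_fin dg.2.
- exact: density_measE.
Qed.

Lemma le_mass_set f A B : measurable A -> measurable B -> density f ->
  A `<=` B -> mass f A <= mass f B.
Proof.
move=> mA mB df AB; apply: ge0_subset_integral => //; first exact: density_measE.
by move=> x _; rewrite lee_fin df.2.
Qed.

Lemma massD f g A : measurable A -> density f -> density g ->
  mass (fun x => f x + g x)%R A = mass f A + mass g A.
Proof.
move=> mA df dg; rewrite /mass -ge0_integralD//.
- by move=> x _; rewrite lee_fin df.2.
- exact: density_measE.
- by move=> x _; rewrite lee_fin dg.2.
- exact: density_measE.
Qed.

Lemma massZ f (r : R) A : measurable A -> (0 <= r)%R -> density f ->
  mass (fun x => r * f x)%R A = r%:E * mass f A.
Proof.
move=> mA r0 df; rewrite /mass -ge0_integralZl_EFin//.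
- by move=> x _; rewrite lee_fin df.2.
- exact: density_measE.
Qed.

Lemma mass_setU f A B : measurable A -> measurable B -> density f ->
  [disjoint A & B] -> mass f (A `|` B) = mass f A + mass f B.
Proof.
move=> mA mB df AB; rewrite /mass ge0_integral_setU//.
- exact: density_measE.
- by move=> x _; rewrite lee_fin df.2.
Qed.

Lemma mass_setID f A B : measurable A -> measurable B -> density f ->
  mass f A = mass f (A `&` B) + mass f (A `\` B).
Proof.
move=> mA mB df; rewrite -mass_setU//.
- by rewrite setUIDK.
- exact: measurableI.
- exact: measurableD.
- by rewrite disj_set2E; apply/eqP/seteqP; split => // x [[_ ?] []].
Qed.

Lemma le_mass_setU f A B C : measurable A -> measurable B -> measurable C ->
  density f -> C `<=` A `|` B -> mass f C <= mass f A + mass f B.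
Proof.
move=> mA mB mC df CAB; rewrite (mass_setID mC mA df).
apply: leeD; apply: le_mass_set => //.
- exact: measurableI.
- exact: measurableD.
- by move=> x [/CAB[]].
Qed.

Lemma mass_indic f A B : measurable A -> measurable B -> density f ->
  mass (fun x => \1_B x * f x)%R A = mass f (A `&` B).
Proof.
move=> mA mB df; rewrite /mass integral_mkcondr; apply: eq_integral => x _.
by rewrite indicE /patch; case: ifP; rewrite (mul1r, mul0r).
Qed.

Lemma mass_cst (r : R) A : measurable A -> (0 <= r)%R ->
  mass (fun=> r) A = r%:E * m A.
Proof. by move=> mA r0; rewrite /mass integral_cst. Qed.

Lemma mass_fin f A B : measurable A -> measurable B -> density f ->
  A `<=` B -> mass f B < +oo -> mass f A \is a fin_num.
Proof.
move=> mA mB df AB fB; rewrite ge0_fin_numE; last exact: mass_ge0.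
exact: le_lt_trans (le_mass_set mA mB df AB) fB.
Qed.

Lemma mass_bigcup f (F : nat -> set T) : (forall k, measurable (F k)) ->
  density f -> trivIset [set: nat] F ->
  mass f (\bigcup_k F k) = \sum_(0 <= i <oo) mass f (F i).
Proof.
move=> mF df tF; rewrite /mass ge0_integral_bigcup//.
- exact: density_measE.
- by move=> x _; rewrite lee_fin df.2.
Qed.

Lemma mass_bigcup_le f (F : nat -> set T) (C : \bar R) :
  (forall k, measurable (F k)) -> density f ->
  {homo F : i j / (i <= j)%N >-> (i <= j)%O} ->
  (forall k, mass f (F k) <= C) -> mass f (\bigcup_k F k) <= C.
Proof.
move=> mF df ndF FC.
have f0 i x : F i x -> 0 <= (f x)%:E by rewrite lee_fin df.2.
have cvgF := @ge0_nondecreasing_set_cvg_integral _ _ _ F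
  (fun x => (f x)%:E) m ndF mF (fun i => density_measE df) f0.
rewrite /mass -(cvg_lim _ cvgF)//; apply: lime_le; last exact: nearW FC.
by apply/cvg_ex; eexists; exact: cvgF.
Qed.

End Mass.

(** * Grids of nested countable partitions *)

Section Grid.
Context d (T : measurableType d) (R : realType) (I : countType).
Variable key : nat -> T -> I.
Implicit Types (k : nat) (x y : T).

(** The cells of generation [k] are the fibres of [key k]. Because the labels
    form a countable type, unions of cells are automatically measurable and
    almost everywhere statements can be checked cell by cell. *)
Definition cell k x : set T := [set y | key k y = key k x].

Definition grid := (forall k x, measurable (cell k x)) /\
  forall k x y, key k.+1 x = key k.+1 y -> key k x = key k y.

Hypothesis hgrid : grid.

Let mcell k x : measurable (cell k x).
Proof. exact: hgrid.1. Qed.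

Lemma cell_refl k x : cell k x x.
Proof. by []. Qed.

Lemma cell_eq k x y : cell k x y -> cell k y = cell k x.
Proof. by rewrite /cell => /= ->. Qed.

Lemma key_nested j k x y : (j <= k)%N -> key k x = key k y -> key j x = key j y.
Proof.
move=> /subnK <-; elim: (k - j)%N => // i IH; rewrite addSn => /hgrid.2.
exact: IH.
Qed.

Lemma cell_nested j k x : (j <= k)%N -> cell k x `<=` cell j x.
Proof. by move=> jk y; exact: key_nested. Qed.

Definition adapted d' (T' : measurableType d') k (f : T -> T') :=
  forall x y, key k x = key k y -> f x = f y.

(** A union of cells of one generation is a countable union, indexed by the
    labels. *)
Lemma adapted_cell_sets k (A : set T) :
  (forall x, A x -> cell k x `<=` A) -> measurable A.
Proof.
move=> Acell.
pose F j : set T := [set x | A x /\ pickle (key k x) = j].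
have -> : A = \bigcup_j F j.
  apply/seteqP; split => [x Ax|x [j _ []]//]; exists (pickle (key k x)) => //.
apply: bigcup_measurable => j _.
have [[x [Ax xj]]|Fj0] := pselect (exists x, F j x).
  rewrite (_ : F j = cell k x)//; apply/seteqP; split => y.
    by move=> [_ yj]; apply: (pcan_inj (@pickleK I)); rewrite yj xj.
  move=> yx; split; first exact: Acell yx.
  by rewrite yx.
by rewrite (_ : F j = set0)//; apply/seteqP; split => // x Fjx; apply: Fj0; exists x.
Qed.

Lemma adapted_measurable d' (T' : measurableType d') k (f : T -> T') :
  adapted k f -> measurable_fun [set: T] f.
Proof.
move=> fk _ Y mY; rewrite setTI; apply: (@adapted_cell_sets k) => x Yfx y yx.
by rewrite /preimage /= (fk _ _ yx).
Qed.

Variable m : {measure set T -> \bar R}.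

Lemma ae_cells k (P : T -> Prop) :
  (forall x, {ae m, forall y, cell k x y -> P y}) -> {ae m, forall y, P y}.
Proof.
move=> cellP.
have H j : {ae m, forall y, pickle (key k y) = j -> P y}.
  have [[x xj]|nj] := pselect (exists x, pickle (key k x) = j); last first.
    by apply: aeW => y yj; exfalso; apply: nj; exists y.
  apply: filterS (cellP x) => y Py yj; apply: Py.
  by apply: (pcan_inj (@pickleK I)); rewrite yj.
by apply: filterS (ae_foralln H) => y; apply.
Qed.

(** The condition on [tau] says that whole cells are stopped together; hence
    the stopped cells are pairwise disjoint and there are countably many. *)
Lemma stopping_measurable (O : set T) (tau : T -> nat) :
  (forall x, O x -> cell (tau x) x `<=` [set y | O y /\ tau y = tau x]) ->
  measurable O.
Proof.
move=> Otau; rewrite (_ : O = \bigcup_j [set y | O y /\ tau y = j]); last first.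
  by apply/seteqP; split => [x Ox|x [j _ []]//]; exists (tau x).
apply: bigcup_measurable => j _; apply: (@adapted_cell_sets j) => x [Ox <-].
exact: Otau.
Qed.

(** The stopped cells partition [O] into countably many pieces, labelled by
    their generation and their key, and the inequality is summed over them. *)
Lemma le_mass_stopping (O : set T) (tau : T -> nat) (f g : T -> R) :
  density f -> density g ->
  (forall x, O x -> cell (tau x) x `<=` [set y | O y /\ tau y = tau x]) ->
  (forall x, O x -> mass m f (cell (tau x) x) <= mass m g (cell (tau x) x)) ->
  mass m f O <= mass m g O.
Proof.
move=> df dg Otau fg.
pose F j : set T := [set x | O x /\ pickle (tau x, key (tau x) x) = j].
have FE j : F j = set0 \/ exists x, O x /\ F j = cell (tau x) x.
  have [[x [Ox xj]]|Fj0] := pselect (exists x, F j x); last first.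
    by left; apply/seteqP; split => // x Fjx; apply: Fj0; exists x.
  right; exists x; split => //; apply/seteqP; split => y.
    move=> [_]; rewrite -xj => /(pcan_inj (@pickleK _)) [ty].
    by rewrite ty.
  move=> yx; have [Oy ty] := Otau x Ox y yx; split => //.
  by rewrite ty -xj yx.
have OF : O = \bigcup_j F j.
  apply/seteqP; split => [x Ox|x [j _ []]//].
  by exists (pickle (tau x, key (tau x) x)).
have mF j : measurable (F j).
  by case: (FE j) => [->//|[x [_ ->]]].
have tF : trivIset [set: nat] F.
  by move=> i j _ _ [x [[_ <-] [_ <-]]].
rewrite OF !mass_bigcup//; apply: lee_nneseries => [i _ _|i _].
  exact: mass_ge0.
case: (FE i) => [->|[x [Ox ->]]]; last exact: fg.
by rewrite /mass !integral_set0.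
Qed.

End Grid.

(** * A concave function of two integrals *)

Section Saturation.
Context {R : realType}.
Implicit Types (s t z delta eps G W : R).
Local Open Scope ring_scope.

(** Bernoulli's inequality, which is Young's inequality for the exponents
    [1 / delta] and [1 / (1 - delta)] with one factor equal to 1. *)
Lemma powR_bernoulli delta z : 0 < delta <= 1 -> 0 <= z ->
  z `^ delta <= 1 + delta * (z - 1).
Proof.
move=> /andP[d0]; rewrite le_eqVlt => /predU1P[->|d1] z0.
  by rewrite powRr1//; lra.
have d1' : 0 < 1 - delta by lra.
have := @conjugate_powR R (z `^ delta) 1 delta^-1 (1 - delta)^-1.
rewrite !invr_gt0 !invrK d0 d1' => /(_ (powR_ge0 _ _) ler01 isT isT).
rewrite powR1 mulr1 -powRrM divff ?gt_eqF// powRr1// => H.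
by have := H ltac:(lra); lra.
Qed.

(** For the integrals [G] of [g] and [W] of [V] over a cell, [bellman] is the
    perspective [G * beta (W / G)] of the concave function
    [beta s = s ^ delta / (1 + s ^ delta)]. The quantity [saturation_drop]
    measures how much [beta] decreases when its argument shrinks by a fixed
    factor. *)
Definition saturation delta s : R := s `^ delta / (1 + s `^ delta).

Definition saturation_drop delta s : R := s `^ delta / (1 + s `^ delta) ^+ 2.

Definition bellman delta G W : R := G * saturation delta (W / G).

Lemma saturation_itv delta s : 0 <= saturation delta s <= 1.
Proof.
have s0 := powR_ge0 s delta; rewrite /saturation divr_ge0 ?addr_ge0//=.
by rewrite ler_pdivrMr; lra.
Qed.

Lemma bellman_ge0 delta G W : 0 <= G -> 0 <= bellman delta G W.
Proof. by move=> G0; rewrite mulr_ge0//; case/andP: (saturation_itv delta (W / G)). Qed.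

Lemma bellman_le delta G W : 0 <= G -> bellman delta G W <= G.
Proof.
by move=> G0; rewrite /bellman ler_piMr//; case/andP: (saturation_itv delta (W / G)).
Qed.

(** The plane is tangent to the graph of the concave function [bellman] at
    [(G, eps * W)]. Being linear, it can be summed over disjoint subcells; its
    value at [(G, eps * W)] is smaller than [bellman delta G W] because the
    second argument has shrunk. *)
Lemma bellman_tangent delta eps G W :
  0 < delta <= 1 -> 0 < eps < 1 -> 0 < G -> 0 < W ->
  exists a b, [/\ 0 <= a <= 1, 0 <= b,
    forall G' W', 0 <= G' -> 0 <= W' -> bellman delta G' W' <= a * G' + b * W' &
    a * G + b * (eps * W) <=
      bellman delta G W - (1 - eps `^ delta) * saturation_drop delta (W / G) * G].
Proof.
move=> /andP[d0 d1] /andP[e0 e1] G0 W0.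
set s := W / G; have s0 : 0 < s by rewrite divr_gt0.
(* [x0] is the ratio of the two integrals after the contraction. *)
pose x0 := eps * s; have x00 : 0 < x0 by rewrite mulr_gt0.
have : x0 `^ delta = eps `^ delta * s `^ delta by rewrite powRM// ltW.
have := powR_gt0 delta x00; set w := x0 `^ delta => w0.
have := powR_gt0 delta s0; rewrite /bellman /saturation_drop /saturation -/s.
set S := s `^ delta => S0 wE.
have : eps `^ delta < 1.
  have <- : 1 `^ delta = 1 :> R by rewrite powR1.
  by rewrite gt0_ltr_powR ?nnegrE ?ltW.
set e := eps `^ delta in wE * => e1'.
have ee0 : 0 < e by exact: powR_gt0.
have w1 : 0 < 1 + w by lra.
have b0 : 0 <= delta * w / (1 + w) ^+ 2 / x0.
  by rewrite divr_ge0 ?(ltW x00)// divr_ge0 ?sqr_ge0// mulr_ge0// ltW.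
exists (w / (1 + w) - delta * w / (1 + w) ^+ 2), (delta * w / (1 + w) ^+ 2 / x0).
split.
- have -> : w / (1 + w) - delta * w / (1 + w) ^+ 2 =
     w * (1 + w - delta) / (1 + w) ^+ 2 by field; rewrite gt_eqF.
  apply/andP; split; last by rewrite ler_pdivrMr ?exprn_gt0//; nra.
  by apply: divr_ge0; [apply: mulr_ge0; lra|exact: sqr_ge0].
- by [].
- move=> G' W'; rewrite le_eqVlt => /predU1P[<- W'0|G'0 W'0].
    by rewrite mul0r mulr0 add0r mulr_ge0.
  set y := W' / G'; have y0 : 0 <= y by rewrite divr_ge0// ltW.
  have -> : W' = y * G' by rewrite /y divfK ?gt_eqF.
  rewrite [_ / x0 * (y * G')]mulrA -mulrDl mulrC ler_pM2r//.
  have := powR_ge0 y delta; set Y := y `^ delta => Y0.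
  have YE : Y <= w * (1 + delta * (y / x0 - 1)).
    have -> : Y = w * (y / x0) `^ delta.
      rewrite -powRM ?(ltW x00)//; first by rewrite mulrCA divff ?mulr1 ?gt_eqF.
      by rewrite divr_ge0// ltW.
    by rewrite ler_pM2l// powR_bernoulli ?d0 ?d1 ?divr_ge0// ltW.
  apply: (@le_trans _ _ (w / (1 + w) + (Y - w) / (1 + w) ^+ 2)).
    rewrite -subr_ge0.
    have -> : w / (1 + w) + (Y - w) / (1 + w) ^+ 2 - Y / (1 + Y) =
      (Y - w) ^+ 2 / ((1 + w) ^+ 2 * (1 + Y)).
      by field; rewrite !gt_eqF//; lra.
    apply: divr_ge0; first exact: sqr_ge0.
    by apply: mulr_ge0; [exact: sqr_ge0|lra].
  rewrite -addrA lerD2l -subr_ge0.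
  have -> : - (delta * w / (1 + w) ^+ 2) + delta * w / (1 + w) ^+ 2 / x0 * y -
    (Y - w) / (1 + w) ^+ 2 =
    (w * (1 + delta * (y / x0 - 1)) - Y) / (1 + w) ^+ 2.
    by field; rewrite !gt_eqF.
  by apply: divr_ge0; [rewrite subr_ge0|exact: sqr_ge0].
- have -> : eps * W = x0 * G by rewrite /x0 /s -mulrA divfK ?gt_eqF.
  rewrite [_ / x0 * (x0 * G)]mulrA -mulrDl divfK ?gt_eqF// subrK.
  rewrite [G * _]mulrC -mulrBl ler_pM2r// wE.
  rewrite -subr_ge0.
  have -> : S / (1 + S) - (1 - e) * (S / (1 + S) ^+ 2) - e * S / (1 + e * S) =
    (1 - e) ^+ 2 * S ^+ 2 / ((1 + S) ^+ 2 * (1 + e * S)).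
    by field; rewrite -wE !gt_eqF//; lra.
  apply: divr_ge0; first by apply: mulr_ge0; exact: sqr_ge0.
  by apply: mulr_ge0; [exact: sqr_ge0|nra].
Qed.

End Saturation.

(** * The mixed inequality on a grid *)

Section MixedWeakType.
Context d (T : measurableType d) (R : realType) (I : countType).
Variables (key : nat -> T -> I) (m : {measure set T -> \bar R}).
Hypothesis hgrid : grid key.
Local Notation cell := (cell key).

Definition cell_mass (f : T -> R) k x : R := fine (mass m f (cell k x)).

Lemma cell_mass_adapted f k : adapted key k (cell_mass f k).
Proof. by move=> x y xy; congr (fine (mass _ _ _)); exact: cell_eq. Qed.

Lemma cell_massE f k x : density f -> mass m f (cell k x) < +oo ->
  mass m f (cell k x) = (cell_mass f k x)%:E.
Proof.
by move=> df fx; rewrite fineK// ge0_fin_numE//; exact: mass_ge0.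
Qed.

Lemma cell_mass_ge0 f k x : density f -> (0 <= cell_mass f k x)%R.
Proof. by move=> df; apply: fine_ge0; exact: mass_ge0. Qed.

Variables b g u V : T -> R.
Hypotheses (hb : density b) (hg : density g) (hu : density u) (hV : density V).
Hypothesis V_gt0 : forall x, (0 < V x)%R.

Let ub x := (u x * b x)%R.
Let vb x := (V x * b x)%R.
Let gb x := (g x * b x)%R.
Let gub x := (g x * ub x)%R.
Let uvb x := (V x * ub x)%R.

Let hub : density ub. Proof. exact: densityM. Qed.
Let hvb : density vb. Proof. exact: densityM. Qed.
Let hgb : density gb. Proof. exact: densityM. Qed.
Let hgub : density gub. Proof. exact: densityM. Qed.
Let huvb : density uvb. Proof. exact: densityM. Qed.

Local Notation mu := (cell_mass b).
Local Notation G := (cell_mass gb).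
Local Notation W := (cell_mass vb).
Local Notation U := (cell_mass ub).

Variables D K1 K2 eps delta : R.
Hypotheses (D_gt0 : (0 < D)%R) (K1_gt0 : (0 < K1)%R) (K2_gt0 : (0 < K2)%R).
Hypotheses (eps01 : (0 < eps < 1)%R) (delta01 : (0 < delta <= 1)%R).

Hypothesis b_cell : forall k x, 0 < mass m b (cell k x) < +oo.
Hypothesis vb_cell : forall k x, 0 < mass m vb (cell k x) < +oo.
Hypothesis ub_cell : forall k x, mass m ub (cell k x) < +oo.
Hypothesis gb_cell : forall k x, mass m gb (cell k x) < +oo.
Hypothesis doubling : forall k x, (mu k x <= D * mu k.+1 x)%R.
Hypothesis u_A1 : {ae m, forall x, forall k, (U k x <= K1 * u x * mu k x)%R}.
(** The contraction of [V] makes the second argument of the Bellman function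
    shrink on the selected subcells; the decay of [u] on the sets where [V] is
    comparable to [t] makes the remaining points cost no more than the
    resulting drop. *)
Hypothesis V_contract : forall k x A, measurable A -> A `<=` cell k x ->
  mass m b A <= 2^-1%:E * mass m b (cell k x) ->
  mass m vb A <= eps%:E * mass m vb (cell k x).
Hypothesis u_decay : forall k x (t : R), (0 < t)%R ->
  mass m ub (cell k x `&` [set y | (t <= D * V y)%R /\ (V y <= 2 * t)%R]) <=
  (K2 * saturation_drop delta (W k x / (t * mu k x)))%:E * mass m ub (cell k x).

Definition average k x : R := (G k x / mu k x)%R.

Definition exceeds i N : set T :=
  [set y | exists2 k, (i <= k <= N)%N & (V y < average k y)%R].

(** The factor for which the drop of the Bellman function, caused by the
    contraction, absorbs the points counted by [u_decay]. *)
Let kappa : R := (2 * K1 * K2 / (1 - eps `^ delta))%R.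

Let mcell k x : measurable (cell k x). Proof. exact: hgrid.1. Qed.

Let b_fin k x : mass m b (cell k x) < +oo.
Proof. by case/andP: (b_cell k x). Qed.

Let vb_fin k x : mass m vb (cell k x) < +oo.
Proof. by case/andP: (vb_cell k x). Qed.

Let mu_gt0 k x : (0 < mu k x)%R.
Proof. by apply: fine_gt0; rewrite b_cell. Qed.

Let W_gt0 k x : (0 < W k x)%R.
Proof. by apply: fine_gt0; rewrite vb_cell. Qed.

Let G_ge0 k x : (0 <= G k x)%R. Proof. exact: cell_mass_ge0. Qed.

Let eps_powR : (eps `^ delta < 1)%R.
Proof.
have /andP[e0 e1] := eps01; have /andP[d0 d1] := delta01.
have <- : (1 `^ delta = 1 :> R)%R by rewrite powR1.
by rewrite gt0_ltr_powR ?nnegrE ?ltW.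
Qed.

Let kappa_gt0 : (0 < kappa)%R.
Proof. by rewrite divr_gt0 ?subr_gt0// !mulr_gt0. Qed.

Let average_adapted k : adapted key k (average k).
Proof.
by move=> x y xy; rewrite /average !(cell_mass_adapted _ xy).
Qed.

Let maverage k : measurable_fun [set: T] (average k).
Proof. exact: (adapted_measurable hgrid (@average_adapted k)). Qed.

Let G_nested j k x : (j <= k)%N -> (G k x <= G j x)%R.
Proof.
move=> jk; rewrite -lee_fin -!(cell_massE hgb (gb_cell _ _)); apply: le_mass_set => //.
exact: cell_nested.
Qed.

Let average_step k x : (average k.+1 x <= D * average k x)%R.
Proof.
rewrite {1}/average ler_pdivrMr// (le_trans (G_nested _ (leqnSn k)))//.
rewrite mulrAC -[leLHS](divfK (lt0r_neq0 (mu_gt0 k x))) -/(average k x).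
by rewrite mulrC ler_wpM2r// divr_ge0// ltW.
Qed.

Lemma measurable_lt_set (f h : T -> R) : measurable_fun [set: T] f ->
  measurable_fun [set: T] h -> measurable [set x | (f x < h x)%R].
Proof.
move=> mf mh; have := measurable_fun_ltr mf mh.
move=> /(_ measurableT [set true] Logic.I); rewrite setTI.
by congr (measurable _); apply/seteqP; split.
Qed.

Lemma measurable_le_set (f h : T -> R) : measurable_fun [set: T] f ->
  measurable_fun [set: T] h -> measurable [set x | (f x <= h x)%R].
Proof.
move=> mf mh; have := measurable_fun_ler mf mh.
move=> /(_ measurableT [set true] Logic.I); rewrite setTI.
by congr (measurable _); apply/seteqP; split.
Qed.

Lemma measurable_exceeds i N : measurable (exceeds i N).
Proof.
rewrite (_ : exceeds i N = \bigcup_(k in [set k | (i <= k <= N)%N])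
    [set y | (V y < average k y)%R]).
  apply: bigcup_measurable => k _; apply: measurable_lt_set => //.
  exact: hV.1.
by apply/seteqP; split => [y [k kN Vk]|y [k kN Vk]]; exists k.
Qed.

Let mule_finD (r y : R) (z : \bar R) :
  r%:E * (z + y%:E) = r%:E * z + (r * y)%:E.
Proof. by rewrite muleDr ?fin_num_adde_defl. Qed.

Let bound_below k x (c : R) := {ae m, forall y, cell k x y -> (c <= u y)%R}.

(** The inequality proved by induction. Only the points where [V] is at least
    [average k x / D] are counted; in a selected subcell no other point
    matters, since its average is at most [D] times twice that of the parent.
    The constant [c] is a lower bound of [u] on the cell. As [bellman] is at
    most its first argument, the inequality gets stronger when [c] grows, so
    that [c] may be raised to the lower bound given by the [A1] property. *)
Let excess_bound N k x := forall c : R, (0 <= c)%R -> bound_below k x c ->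
  mass m uvb (cell k x `&` exceeds k N `&` [set y | (average k x <= D * V y)%R])
    + (kappa * c * G k x)%:E <=
  kappa%:E * (mass m gub (cell k x) + (c * bellman delta (G k x) (W k x))%:E).

Let selected k N x : set T := [set y | cell k x y /\
  exists2 i, (k < i <= N)%N & (2 * average k x < average i y)%R].

(** The selected points stop at the first generation at which the average has
    more than doubled; averages are constant on cells, so that whole cells
    stop together. *)
Lemma selected_stopping k N x : exists tau : T -> nat,
  (forall y, selected k N x y -> cell (tau y) y `<=`
     [set z | selected k N x z /\ tau z = tau y]) /\
  (forall y, selected k N x y -> [/\ (k < tau y <= N)%N,
     (2 * average k x < average (tau y) y)%R &
     forall i, (k < i <= N)%N -> (2 * average k x < average i y)%R ->
       (tau y <= i)%N]).
Proof.
pose p y i := (k < i <= N)%N && (2 * average k x < average i y)%R.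
have pe y : selected k N x y -> exists i, p y i.
  by move=> [_ [i ik Ai]]; exists i; rewrite /p ik.
pose tau y := if pselect (exists i, p y i) is left e then ex_minn e else 0%N.
have tauP y : selected k N x y -> p y (tau y) /\
    forall i, p y i -> (tau y <= i)%N.
  by move=> /pe e; rewrite /tau; case: pselect => // e'; case: ex_minnP.
exists tau; split; last first.
  move=> y /tauP[/andP[kt At] tmin]; split => // i ik Ai.
  by apply: tmin; rewrite /p ik.
move=> y ys z zy.
have [/andP[/andP[kt tN] At] tmin] := tauP y ys.
have pE i : (i <= tau y)%N -> p z i = p y i.
  move=> it; rewrite /p (@average_adapted i z y)//.
  exact: cell_nested zy.
have zs : selected k N x z.
  split; last first.
    exists (tau y); rewrite ?kt//.
    by rewrite (@average_adapted (tau y) z y).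
  rewrite -(cell_eq ys.1); exact: (cell_nested hgrid (ltnW kt)) zy.
split => //; have [pz zmin] := tauP z zs.
have zt : (tau z <= tau y)%N by apply: zmin; rewrite pE// /p kt tN.
apply/eqP; rewrite eqn_leq zt /=; apply: tmin.
by rewrite -pE.
Qed.

Let average_gt0 k x : (0 < G k x)%R -> (0 < average k x)%R.
Proof. by move=> G0; rewrite divr_gt0. Qed.

Let averageE k x : (average k x * mu k x = G k x)%R.
Proof. by rewrite divfK// gt_eqF. Qed.

(** Chebyshev's inequality: on the stopped cells the average is more than
    doubled, while the integral of [g] is at most that over the whole cell. *)
Lemma selected_half k N x : (0 < G k x)%R ->
  measurable (selected k N x) /\
  mass m b (selected k N x) <= 2^-1%:E * mass m b (cell k x).
Proof.
move=> G0; have [tau [tauS tauP]] := selected_stopping k N x.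
have mS : measurable (selected k N x) by exact: stopping_measurable tauS.
split => //.
have A0 : (0 <= 2 * average k x)%R by rewrite mulr_ge0// ltW// average_gt0.
have : mass m (fun y => 2 * average k x * b y)%R (selected k N x) <=
       mass m gb (selected k N x).
  apply: (le_mass_stopping hgrid _ _ tauS) => //; first exact: densityZ.
  move=> y /tauP[_ At _]; rewrite massZ//.
  rewrite (cell_massE hgb (gb_cell _ _)) (cell_massE hb (b_fin _ _)).
  by rewrite -EFinM lee_fin -[leRHS]averageE ler_wpM2r// ltW.
rewrite massZ// => /le_trans/(_ (le_mass_set m mS (mcell k x) hgb _)) => H.
have {H} := H (fun y sy => sy.1).
have bS : mass m b (selected k N x) \is a fin_num.
  by apply: mass_fin (b_fin k x) => // y [].
rewrite (cell_massE hgb (gb_cell _ _)) (cell_massE hb (b_fin _ _)) -(fineK bS) -!EFinM !lee_fin -averageE.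
rewrite [(2 * _)%R]mulrC -mulrA ler_pM2l ?average_gt0//; lra.
Qed.

(** A point at which some average exceeds [V > 2 * average k x] is selected. On
    the stopped cells the induction hypothesis holds, and replacing the
    Bellman function by its tangent plane allows to sum it. Outside of them
    [c <= u] suffices. *)
Lemma selected_bound k N x c : (0 < G k x)%R -> (0 <= c)%R ->
  bound_below k x c ->
  (forall y i, (k < i <= N)%N -> cell k x y -> excess_bound N i y) ->
  mass m uvb (cell k x `&` exceeds k N `&` [set y | (2 * average k x < V y)%R])
    + (kappa * c * G k x)%:E <=
  kappa%:E * (mass m gub (cell k x) +
    (c * (bellman delta (G k x) (W k x) -
      (1 - eps `^ delta) * saturation_drop delta (W k x / G k x) * G k x))%:E).
Proof.
move=> G0 c0 uc IH; have [tau [tauS tauP]] := selected_stopping k N x.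
have [mS Shalf] := selected_half N G0.
have [a [bb [/andP[a0 a1] bb0 tangent tangentE]]] :=
  bellman_tangent delta01 eps01 G0 (W_gt0 k x).
set S := selected k N x in mS Shalf tauS tauP *.
pose X := exceeds k N `&` [set y | (2 * average k x < V y)%R].
have mX : measurable X.
  apply: measurableI; first exact: measurable_exceeds.
  by apply: measurable_lt_set; [exact: measurable_cst|exact: hV.1].
have SX : cell k x `&` X `<=` S.
  move=> y [yx [[i /andP[ki iN] Vi] AV]]; split=> //; exists i; last first.
    exact: lt_trans Vi.
  rewrite iN andbT ltn_neqAle ki andbT; apply: contraTN (lt_trans AV Vi).
  move=> /eqP <-; rewrite -leNgt (@average_adapted k y x)//.
  by rewrite ler_peMl ?ltW ?average_gt0//; lra.
(* The two sides of the linearized induction hypothesis, as densities. *)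
pose f1 y := (\1_X y * uvb y + kappa * c * gb y)%R.
pose f2 y := (kappa * (gub y + c * (a * gb y + bb * vb y)))%R.
have kc0 : (0 <= kappa * c)%R by rewrite mulr_ge0// ltW.
have df1 : density f1.
  apply: densityD; first by apply: densityM => //; exact: density_indic.
  exact: densityZ.
have dab : density (fun y => a * gb y + bb * vb y)%R.
  by apply: densityD; exact: densityZ.
have dcab : density (fun y => c * (a * gb y + bb * vb y))%R by exact: densityZ.
have df2 : density f2 by apply: densityZ (ltW kappa_gt0) _; exact: densityD.
have mf1 A : measurable A ->
    mass m f1 A = mass m uvb (A `&` X) + (kappa * c)%:E * mass m gb A.
  move=> mA; rewrite /f1 massD//; last first.
  - exact: densityZ.
  - by apply: densityM => //; exact: density_indic.
  by rewrite mass_indic// massZ.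
have mf2 A : measurable A -> mass m f2 A = kappa%:E * (mass m gub A +
    c%:E * (a%:E * mass m gb A + bb%:E * mass m vb A)).
  move=> mA; rewrite /f2 massZ//; last first.
  - exact: densityD.
  - exact: ltW.
  rewrite massD// massZ// massD//; [|exact: densityZ|exact: densityZ].
  by rewrite !massZ.
have S12 : mass m f1 S <= mass m f2 S.
  apply: (le_mass_stopping hgrid _ _ tauS) => // y Sy.
  have [/andP[kt tN] At tmin] := tauP y Sy.
  have tk : cell (tau y) y `<=` cell k x.
    by rewrite -(cell_eq Sy.1); exact: cell_nested (ltnW kt).
  have ut : bound_below (tau y) y c by apply: filterS uc => z uz /tk.
  have := IH y (tau y) _ Sy.1; rewrite kt tN => /(_ isT c c0 ut).
  rewrite mf1// mf2// (cell_massE hgb (gb_cell _ _)).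
  rewrite (cell_massE hvb (vb_fin _ _)).
  rewrite -!EFinM => IHt.
  apply: (@le_trans _ _ (mass m uvb (cell (tau y) y `&` exceeds (tau y) N `&`
      [set z | (average (tau y) y <= D * V z)%R]) +
      (kappa * c * G (tau y) y)%:E)).
    rewrite leeD2r//; apply: le_mass_set => //.
    - exact: measurableI.
    - apply: measurableI; first by apply: measurableI => //; exact: measurable_exceeds.
      apply: measurable_le_set; first exact: measurable_cst.
      by apply: measurable_funM => //; exact: hV.1.
    move=> z [zt [[i /andP[ki iN] Vi] AV]]; have [Sz tz] := tauS y Sy z zt.
    have Sz' := SX z (conj (tk _ zt) (conj (ex_intro2 _ _ i _ Vi) AV)).
    have {}ki : (k < i)%N.
      rewrite ltn_neqAle ki andbT; apply: contraTN (lt_trans AV Vi).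
      move=> /eqP <-; rewrite -leNgt (@average_adapted k z x)//; last exact: tk.
      by rewrite ler_peMl ?ltW ?average_gt0//; lra.
    split.
      split => //; exists i => //; rewrite iN andbT -tz.
      have [_ _ +] := tauP z Sz; apply; first by rewrite ki iN.
      exact: lt_trans Vi.
    rewrite /=; apply: (@le_trans _ _ (D * (2 * average k x)))%R; last first.
      by rewrite ler_pM2l// ltW.
    have tE : tau y = (tau y).-1.+1 by rewrite prednK// (leq_ltn_trans _ kt).
    rewrite tE (le_trans (average_step _ _))// ler_pM2l//.
    have : (k <= (tau y).-1)%N by rewrite -ltnS -tE.
    rewrite leq_eqVlt => /predU1P[<-|kt1].
      rewrite (@average_adapted k y x); last exact: Sy.1.
      by rewrite ler_peMl ?ltW ?average_gt0//; lra.
    rewrite leNgt; apply/negP => At1.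
    have := tmin _ _ At1; rewrite kt1 /= (leq_trans (leq_pred _) tN) => /(_ isT).
    by rewrite {1}tE ltnn.
  apply: (le_trans IHt); rewrite lee_pmul2l// leeD2l// lee_fin.
  by rewrite ler_wpM2l// tangent// ltW.
have SP : S `<=` cell k x by move=> y [].
have mPS : measurable (cell k x `\` S) by exact: measurableD.
have PS : (kappa * c)%:E * mass m gb (cell k x `\` S) <=
    kappa%:E * mass m gub (cell k x `\` S).
  rewrite EFinM -muleA lee_pmul2l// -massZ//; apply: ae_le_mass => //.
    exact: densityZ.
  apply: filterS uc => y uy [/uy cy _]; rewrite mulrA [leRHS]mulrA.
  rewrite ler_wpM2r//; first exact: hb.2.
  by rewrite mulrC ler_wpM2l//; exact: hg.2.
have gE := mass_setID m (mcell k x) mS hgb.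
have guE := mass_setID m (mcell k x) mS hgub.
rewrite (setIidr SP) in gE guE.
rewrite -setIA (_ : cell k x `&` X = S `&` X); last first.
  apply/seteqP; split => y [h1 h2]; split => //; last exact: SP.
  by apply: SX.
have WS : mass m vb S <= (eps * W k x)%:E.
  rewrite EFinM -(cell_massE hvb (vb_fin _ _)).
  exact: V_contract.
have gS : mass m gb S <= (G k x)%:E.
  by rewrite -(cell_massE hgb (gb_cell _ _)); exact: le_mass_set.
rewrite EFinM -(cell_massE hgb (gb_cell _ _)) gE guE ge0_muleDr; [|exact: mass_ge0..].
rewrite addeA -mf1//; apply: le_trans (leeD S12 PS) _.
rewrite mf2// -ge0_muleDr; last 2 first.
- by rewrite adde_ge0 ?mass_ge0// mule_ge0// adde_ge0// mule_ge0// mass_ge0.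
- exact: mass_ge0.
rewrite lee_pmul2l// [leLHS]addeAC leeD2l//.
apply: (@le_trans _ _ (c%:E * (a * G k x + bb * (eps * W k x))%:E)); last first.
  by rewrite -EFinM lee_fin ler_wpM2l.
rewrite lee_wpmul2l ?lee_fin// EFinD; apply: leeD; rewrite EFinM.
  by rewrite lee_wpmul2l// lee_fin.
by rewrite lee_wpmul2l// lee_fin.
Qed.

(** This is where the constant [kappa] comes from: the points with [V] comparable
    to the average cost at most the drop of the Bellman function. *)
Lemma level_bound k x c : (0 < G k x)%R -> bound_below k x c ->
  (U k x <= K1 * c * mu k x)%R ->
  mass m uvb (cell k x `&` [set y | (average k x <= D * V y)%R /\
    (V y <= 2 * average k x)%R]) <=
  (kappa * c * ((1 - eps `^ delta) * saturation_drop delta (W k x / G k x)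
    * G k x))%:E.
Proof.
move=> G0 uc Uc; have A0 := average_gt0 G0.
have mE : measurable (cell k x `&` [set y | (average k x <= D * V y)%R /\
    (V y <= 2 * average k x)%R]).
  apply: measurableI => //.
  apply: (@measurableI _ _ [set y | average k x <= D * V y]%R
                           [set y | V y <= 2 * average k x]%R).
    apply: measurable_le_set; first exact: measurable_cst.
    by apply: measurable_funM => //; exact: hV.1.
  by apply: measurable_le_set; [exact: hV.1|exact: measurable_cst].
have A20 : (0 <= 2 * average k x)%R by lra.
apply: (@le_trans _ _ (mass m (fun y => 2 * average k x * ub y)%R
    (cell k x `&` [set y | (average k x <= D * V y)%R /\
    (V y <= 2 * average k x)%R]))).
  apply: le_mass => //; first exact: densityZ.
  by move=> y [_ [_ Vy]]; rewrite /uvb ler_wpM2r//; exact: hub.2.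
rewrite massZ//.
apply: (@le_trans _ _ ((2 * average k x)%:E * ((K2 * saturation_drop delta
    (W k x / (average k x * mu k x)))%:E * mass m ub (cell k x)))).
  by rewrite lee_wpmul2l ?lee_fin// u_decay.
rewrite averageE (cell_massE hub (ub_cell _ _)) -!EFinM lee_fin.
have psi0 : (0 <= saturation_drop delta (W k x / G k x))%R.
  by rewrite /saturation_drop divr_ge0 ?powR_ge0// sqr_ge0.
set psi := saturation_drop _ _ in psi0 *.
have -> : (kappa * c * ((1 - eps `^ delta) * psi * G k x) =
    2 * average k x * (K2 * psi * (K1 * c * mu k x)))%R.
  rewrite -(averageE k x) /kappa; field.
  by rewrite subr_eq0 eq_sym lt_eqF.
by rewrite ler_wpM2l// ler_wpM2l// mulr_ge0// ltW.
Qed.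

Lemma cell_exceeds0 k N x : (G k x <= 0)%R -> cell k x `&` exceeds k N = set0.
Proof.
move=> G0; apply/seteqP; split=> // y [yx [i /andP[ki _]]] /=.
rewrite /average ltNge; apply/negP; rewrite negbK.
apply: (@le_trans _ _ 0%R); last exact: ltW.
apply: mulr_le0_ge0; last by rewrite invr_ge0 ltW.
by apply: le_trans G0; rewrite -(cell_mass_adapted gb yx); exact: G_nested.
Qed.

(** Induction on the number of generations below the cell. Points with
    [V <= 2 * average k x] are paid by [level_bound] and the other ones by
    [selected_bound]; the two drop terms cancel. *)
Lemma excess_boundP N k x : excess_bound N k x.
Proof.
have [j] := ubnP (N - k)%N; elim: j k x => // j IHj k x jk c c0 uc.
(* The lower bound [c] is raised to the one given by [u_A1]. *)
have bnd : bound_below k x (U k x / (K1 * mu k x)).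
  apply: filterS u_A1 => y uy yx; rewrite ler_pdivrMr ?mulr_gt0//.
  have := uy k; rewrite (@cell_mass_adapted ub k y x)//.
  by rewrite (@cell_mass_adapted b k y x)// mulrAC mulrC.
pose c1 := Num.max c (U k x / (K1 * mu k x))%R.
have uc1 : bound_below k x c1.
  by apply: filterS2 uc bnd => y uy1 uy2 yx; rewrite ge_max uy1// uy2.
have c10 : (0 <= c1)%R by rewrite le_max c0.
have Uc1 : (U k x <= K1 * c1 * mu k x)%R.
  by rewrite mulrAC -ler_pdivrMl ?mulr_gt0// mulrC le_max lexx orbT.
have cc1 : (c <= c1)%R by rewrite le_max lexx.
have B0 := bellman_ge0 delta (W k x) (G_ge0 k x).
have BG := bellman_le delta (W k x) (G_ge0 k x).
have [G0|G0] := leP (G k x) 0%R.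
  have {G0}G0 : G k x = 0%R by apply/eqP; rewrite eq_le G0 G_ge0.
  rewrite cell_exceeds0 ?G0// set0I [X in X + _ <= _]integral_set0 add0e mulr0.
  apply: mule_ge0; first by rewrite lee_fin ltW.
  apply: adde_ge0; first exact: mass_ge0.
  by rewrite lee_fin mulr_ge0// bellman_ge0.
suff H : mass m uvb
    (cell k x `&` exceeds k N `&` [set y | (average k x <= D * V y)%R]) +
    (kappa * c1 * G k x)%:E <=
  kappa%:E * (mass m gub (cell k x) + (c1 * bellman delta (G k x) (W k x))%:E).
  have e1 : (kappa * c1 * G k x = kappa * c * G k x + kappa * (c1 - c) * G k x)%R.
    by ring.
  rewrite -(@leeD2rE _ (kappa * (c1 - c) * G k x)%:E)// -addeA -EFinD -e1.
  apply: (le_trans H); rewrite !mule_finD.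
  rewrite -addeA leeD2l// -EFinD lee_fin.
  rewrite -subr_ge0.
  rewrite (_ : _ - _ = kappa * (c1 - c) * (G k x - bellman delta (G k x) (W k x)))%R; last by ring.
  by rewrite mulr_ge0 ?subr_ge0// mulr_ge0 ?subr_ge0// ltW.
have := @selected_bound k N x c1 G0 c10 uc1.
set rhs := (_ - _)%R => /(_ _)/wrap[].
  move=> y i /andP[ki iN] yx; apply: IHj.
  exact: leq_trans (ltn_sub2l (leq_trans ki iN) ki) jk.
move=> S1; have S2 := level_bound G0 uc1 Uc1.
set E := cell k x `&` [set y | _ /\ _] in S2.
set E' := _ `&` [set y | (2 * _ < _)%R] in S1.
have mX := measurable_exceeds k N.
have mE : measurable E.
  apply: measurableI => //.
  apply: (@measurableI _ _ [set y | average k x <= D * V y]%R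
                           [set y | V y <= 2 * average k x]%R).
    apply: measurable_le_set; first exact: measurable_cst.
    by apply: measurable_funM => //; exact: hV.1.
  by apply: measurable_le_set; [exact: hV.1|exact: measurable_cst].
have mE' : measurable E'.
  apply: measurableI; first exact: measurableI.
  by apply: measurable_lt_set; [exact: measurable_cst|exact: hV.1].
apply: (@le_trans _ _ (mass m uvb E + mass m uvb E' + (kappa * c1 * G k x)%:E)).
  rewrite leeD2r//; apply: le_mass_setU => //.
    apply: measurableI; first exact: measurableI.
    apply: measurable_le_set; first exact: measurable_cst.
    by apply: measurable_funM => //; exact: hV.1.
  move=> y [[yx yX] yA]; have [yV|yV] := leP (V y) (2 * average k x)%R.
    by left.
  by right.
rewrite -addeA; apply: (le_trans (leeD S2 S1)).
rewrite !mule_finD addeCA leeD2l// -EFinD lee_fin.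
by rewrite /rhs le_eqVlt; apply/orP; left; apply/eqP; ring.
Qed.

(** At the top of the grid nothing bounds [V] from below. Points with
    [V <= 2 * average k x] are controlled directly by the [A1] property of [u],
    the other ones by [selected_bound] with [c = 0]. *)
Lemma exceeds_bound N k x : mass m uvb (cell k x `&` exceeds k N) <=
  (kappa + 2 * K1)%:E * mass m gub (cell k x).
Proof.
have mX := measurable_exceeds k N.
have [G0|G0] := leP (G k x) 0%R.
  rewrite cell_exceeds0// /mass integral_set0 mule_ge0 ?mass_ge0// lee_fin.
  by rewrite addr_ge0 ?(ltW kappa_gt0)// mulr_ge0// ltW.
have A0 := average_gt0 G0.
pose E := cell k x `&` [set y | (V y <= 2 * average k x)%R].
pose E' := cell k x `&` exceeds k N `&` [set y | (2 * average k x < V y)%R].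
have mE : measurable E.
  by apply: measurableI => //; apply: measurable_le_set => //; exact: hV.1.
have mE' : measurable E'.
  apply: measurableI; first exact: measurableI.
  by apply: measurable_lt_set => //; exact: hV.1.
apply: (@le_trans _ _ (mass m uvb E' + mass m uvb E)).
  apply: le_mass_setU => //; first exact: measurableI.
  move=> y [yx yX]; have [yV|yV] := leP (V y) (2 * average k x)%R.
    by right.
  by left.
rewrite EFinD ge0_muleDl ?lee_fin ?(ltW kappa_gt0)//; last first.
  by rewrite mulr_ge0// ltW.
apply: leeD.
  have ae0 : bound_below k x 0%R by apply: aeW => y _; exact: hu.2.
  have := @selected_bound k N x 0%R G0 (lexx 0%R) ae0.
  rewrite !(mul0r, mulr0) !adde0; apply.
  by move=> y i _ _; exact: excess_boundP.
have A20 : (0 <= 2 * average k x)%R by lra.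
apply: (@le_trans _ _ (mass m (fun y => 2 * average k x * ub y)%R (cell k x))).
  apply: (@le_trans _ _ (mass m (fun y => 2 * average k x * ub y)%R E)).
    apply: le_mass => //; first exact: densityZ.
    by move=> y [_ Vy]; rewrite /uvb ler_wpM2r//; exact: hub.2.
  apply: le_mass_set => //; first exact: densityZ.
  by move=> y [].
rewrite massZ// (cell_massE hub (ub_cell _ _)).
apply: (@le_trans _ _ (mass m (fun y => (2 * U k x / mu k x) * gb y)%R (cell k x))).
  rewrite massZ//; last by rewrite divr_ge0 ?mulr_ge0 ?cell_mass_ge0.
  rewrite (cell_massE hgb (gb_cell _ _)) -!EFinM lee_fin /average.
  by rewrite le_eqVlt; apply/orP; left; apply/eqP; ring.
rewrite -massZ//; last by rewrite mulr_ge0// ltW.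
apply: ae_le_mass => //.
- by apply: densityZ => //; rewrite divr_ge0 ?mulr_ge0 ?cell_mass_ge0.
- by apply: densityZ => //; rewrite mulr_ge0// ltW.
apply: filterS u_A1 => y uy yx; have := uy k.
rewrite (@cell_mass_adapted ub k y x)// (@cell_mass_adapted b k y x)// => Ux.
rewrite mulrAC ler_pdivrMr// /gub /ub /gb.
rewrite (_ : 2 * U k x * (g y * b y) = (2 * g y * b y) * U k x)%R; last by ring.
rewrite (_ : 2 * K1 * (g y * (u y * b y)) * mu k x =
  (2 * g y * b y) * (K1 * u y * mu k x))%R; last by ring.
by rewrite ler_wpM2l// mulr_ge0 ?hb.2// mulr_ge0 ?hg.2.
Qed.

Theorem mixed_weak_type :
  mass m uvb [set y | exists k, (V y < average k y)%R] <=
  (kappa + 2 * K1)%:E * mass m gub [set: T].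
Proof.
have C0 : (0 <= kappa + 2 * K1)%R.
  by rewrite addr_ge0 ?(ltW kappa_gt0)// mulr_ge0// ltW.
have H N : mass m uvb (exceeds 0 N) <= (kappa + 2 * K1)%:E * mass m gub [set: T].
  have mX := measurable_exceeds 0 N.
  rewrite -[X in mass _ _ X]setTI -mass_indic// -massZ//.
  apply: (@le_mass_stopping _ _ _ _ _ hgrid _ _ (fun=> 0%N)) => //.
  - by apply: densityM => //; exact: density_indic.
  - exact: densityZ.
  by move=> x _; rewrite mass_indic// massZ//; exact: exceeds_bound.
rewrite (_ : [set y | _] = \bigcup_N exceeds 0 N); last first.
  apply/seteqP; split => [y [k Vk]|y [N _ [k _ Vk]]]; last by exists k.
  by exists k => //; exists k => //=; rewrite leqnn.
apply: mass_bigcup_le => //; first exact: measurable_exceeds.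
move=> i j ij; apply/subsetPset => y [k /andP[k0 ki] Vk].
by exists k => //; rewrite k0 (leq_trans ki).
Qed.

End MixedWeakType.

(** * Power decay of A1 densities *)

Section ReverseHolder.
Context {R : realType}.
Local Open Scope ring_scope.

(** The function [x ^ eps * (2 * a - x)] is nonincreasing for
    [2 * eps * a <= x], since its derivative has the sign of
    [eps * (2 * a - x) - x]. *)
Lemma powR_potential (eps M0 M1 a : R) : 0 < eps <= 1 -> 0 < M0 -> M0 <= M1 ->
  M1 <= 2 * a -> 2 * eps * a <= M0 ->
  M1 `^ eps * (2 * a - M1) <= M0 `^ eps * (2 * a - M0).
Proof.
move=> e01 M00 M01 M1a eM0; have /andP[e0 e1] := e01.
have M10 : 0 < M1 by exact: lt_le_trans M01.
pose rho := M1 / M0; have rho1 : 1 <= rho by rewrite ler_pdivlMr// mul1r.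
have M1E : M1 = rho * M0 by rewrite /rho divfK ?gt_eqF.
have rho0 : 0 <= rho by lra.
rewrite {1 2}M1E powRM// ?(ltW M00)// [rho `^ _ * _]mulrC -mulrA ler_pM2l ?powR_gt0//.
have := powR_bernoulli e01 rho0; set p := rho `^ eps => pE.
apply: (@le_trans _ _ ((1 + eps * (rho - 1)) * (2 * a - rho * M0))).
  by rewrite ler_wpM2r// subr_ge0 -M1E.
rewrite -subr_ge0.
rewrite (_ : _ - _ = (rho - 1) * (M0 - 2 * eps * a + eps * rho * M0)); last by ring.
rewrite mulr_ge0 ?subr_ge0// addr_ge0 ?subr_ge0//.
by apply: mulr_ge0 (ltW M00); exact: mulr_ge0 (ltW e0) rho0.
Qed.

End ReverseHolder.

(** The power [(2 * D * K)^-1] of the running maximum is integrable against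
    [u]; half of it is lost when the threshold is optimized in [A1_decay]. *)
Definition decay_exponent (R : realType) (D K : R) : R := ((2 * D * K)^-1 / 2)%R.

Definition decay_constant (R : realType) (D K : R) : R :=
  (1 + 2 * (2 * K) `^ (2 * D * K)^-1)%R.

Section A1Decay.
Context d (T : measurableType d) (R : realType) (I : countType).
Variables (key : nat -> T -> I) (m : {measure set T -> \bar R}).
Hypothesis hgrid : grid key.
Local Notation cell := (cell key).
Variables b u : T -> R.
Hypotheses (hb : density b) (hu : density u).
Let ub x := (u x * b x)%R.
Let hub : density ub. Proof. exact: densityM. Qed.
Local Notation mu := (cell_mass key m b).
Local Notation U := (cell_mass key m ub).
Variables D K : R.
Hypotheses (D_ge1 : (1 <= D)%R) (K_ge1 : (1 <= K)%R).
Hypothesis b_cell : forall k x, 0 < mass m b (cell k x) < +oo.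
Hypothesis ub_cell : forall k x, 0 < mass m ub (cell k x) < +oo.
Hypothesis doubling : forall k x, (mu k x <= D * mu k.+1 x)%R.
Hypothesis u_A1 : {ae m, forall x, forall k, (U k x <= K * u x * mu k x)%R}.
Hypothesis u_diff : {ae m, forall x, exists k, (u x * mu k x <= 2 * U k x)%R}.

Let mcell k x : measurable (cell k x). Proof. exact: hgrid.1. Qed.

Let b_fin k x : mass m b (cell k x) < +oo.
Proof. by case/andP: (b_cell k x). Qed.

Let ub_fin k x : mass m ub (cell k x) < +oo.
Proof. by case/andP: (ub_cell k x). Qed.

Let mu_gt0 k x : (0 < mu k x)%R.
Proof. by apply: fine_gt0; rewrite b_cell. Qed.

Let U_gt0 k x : (0 < U k x)%R.
Proof. by apply: fine_gt0; rewrite ub_cell. Qed.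

Let r k x := (U k x / (K * mu k x))%R.

Let K_gt0 : (0 < K)%R. Proof. exact: lt_le_trans K_ge1. Qed.
Let D_gt0 : (0 < D)%R. Proof. exact: lt_le_trans D_ge1. Qed.

Let r_gt0 k x : (0 < r k x)%R.
Proof. by rewrite divr_gt0 ?mulr_gt0. Qed.

(** The [A1] condition says that averages divided by [K] are lower bounds of [u],
    hence so is their running maximum. *)
Fixpoint running_max k x : R :=
  if k is j.+1 then Num.max (running_max j x) (r k x) else r 0 x.

Local Notation M := running_max.

Let r_le_M k x : (r k x <= M k x)%R.
Proof. by case: k => [|k] /=; rewrite ?le_max lexx ?orbT. Qed.

Let M_gt0 k x : (0 < M k x)%R.
Proof. exact: lt_le_trans (r_le_M k x). Qed.

Let M_nd x : {homo M ^~ x : i j / (i <= j)%N >-> (i <= j)%R}.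
Proof.
by apply: homo_leq => [//|i j k|k /=]; [exact: le_trans|rewrite le_max lexx].
Qed.

Let M_adapted k : adapted key k (M k).
Proof.
have rA j : adapted key j (r j).
  by move=> x y xy; rewrite /r !(cell_mass_adapted _ _ xy).
elim: k => [|k IHk] x y xy /=; first by rewrite (rA 0%N x y).
by rewrite (rA k.+1 x y)// (IHk x y)//; exact: hgrid.2.
Qed.

Let mM k : measurable_fun [set: T] (M k).
Proof. exact: (adapted_measurable hgrid (@M_adapted k)). Qed.

Let M_le_u : {ae m, forall x, forall k, (M k x <= u x)%R}.
Proof.
apply: filterS u_A1 => x ux; have rx k : (r k x <= u x)%R.
  by rewrite ler_pdivrMr ?mulr_gt0// mulrCA mulrA.
by elim=> [|k IHk] //=; rewrite ge_max IHk rx.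
Qed.

Let eps : R := (2 * D * K)^-1%R.

Let eps01 : (0 < eps <= 1)%R.
Proof.
have DK : (1 <= D * K)%R by rewrite mulr_ege1.
rewrite invr_gt0 !mulr_gt0//= invf_le1 ?mulr_gt0// -mulrA; lra.
Qed.

(** The potential [M ^ eps * (2 * u - M)]. As [M <= u] almost everywhere, the
    positive part only makes it nonnegative at every point. *)
Let phi k x := (M k x `^ eps * (Num.max 0 (2 * u x - M k x) * b x))%R.

Let hpos c : density (fun x => Num.max 0 (2 * u x - c) * b x)%R.
Proof.
split=> [|x]; last by rewrite mulr_ge0 ?hb.2// le_max lexx.
apply: measurable_funM hb.1; apply: measurable_maxr => //.
by apply: measurable_funB => //; apply: measurable_funM => //; exact: hu.1.
Qed.

Let hphi k : density (phi k).
Proof.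
split=> [|x]; last first.
  by rewrite mulr_ge0 ?powR_ge0// mulr_ge0 ?hb.2// le_max lexx.
apply: measurable_funM.
  exact: (measurableT_comp (measurable_powR _) (mM k)).
apply: measurable_funM hb.1; apply: measurable_maxr => //.
by apply: measurable_funB => //; apply: measurable_funM => //; exact: hu.1.
Qed.

Let phi_cell k l x : (k <= l)%N -> mass m (phi k) (cell l x) =
  (M k x `^ eps * (2 * U l x - M k x * mu l x))%:E.
Proof.
move=> kl; pose c := M k x; have c0 : (0 <= c)%R := ltW (M_gt0 k x).
have -> : mass m (phi k) (cell l x) = mass m
    (fun y => c `^ eps * (Num.max 0 (2 * u y - c) * b y))%R (cell l x).
  apply: eq_integral => y; rewrite inE => yx; congr (_%:E).
  by rewrite /phi (@M_adapted k y x)//; exact: key_nested yx.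
rewrite massZ ?powR_ge0// EFinM; congr (_ * _).
have H : mass m (fun y => Num.max 0 (2 * u y - c) * b y + c * b y)%R (cell l x)
    = mass m (fun y => 2 * ub y)%R (cell l x).
  have ae_c : {ae m, forall y, cell l x y ->
      (Num.max 0 (2 * u y - c) * b y + c * b y = 2 * ub y)%R}.
    apply: filterS M_le_u => y /(_ k) My yx.
    rewrite max_r; first by rewrite /ub; ring.
    move: My; rewrite (@M_adapted k y x); last exact: key_nested yx.
    rewrite -/c => cu; lra.
  have d1 : density (fun y => Num.max 0 (2 * u y - c) * b y + c * b y)%R.
    by apply: densityD => //; exact: densityZ.
  have d2 : density (fun y => 2 * ub y)%R by exact: densityZ.
  apply/eqP; rewrite eq_le; apply/andP; split; apply: ae_le_mass => //.
    by apply: filterS ae_c => y /[apply] ->.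
  by apply: filterS ae_c => y /[apply] ->.
move: H; rewrite massD//; last exact: densityZ.
rewrite !massZ// (cell_massE hub (ub_fin _ _)) (cell_massE hb (b_fin _ _)).
rewrite -!EFinM => H; rewrite [RHS](_ : _ = (2 * U l x)%:E - (c * mu l x)%:E)//.
by rewrite -H addeK.
Qed.

Lemma running_max_le k x : (M k x * mu k x <= U k x)%R.
Proof.
rewrite -lee_fin EFinM -(cell_massE hb (b_fin _ _)) -(cell_massE hub (ub_fin _ _)).
rewrite -massZ//; last exact: ltW.
apply: ae_le_mass => //; first by apply: densityZ => //; exact: ltW.
apply: filterS M_le_u => y /(_ k) My yx; rewrite ler_wpM2r ?hb.2//.
by rewrite (@M_adapted k x y).
Qed.

(** Averages grow by at most the factor [D] from one generation to the next, so
    that [2 * eps] times the new average is below the old running maximum: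
    this is the range where the potential decreases. *)
Lemma phi_step k x : mass m (phi k.+1) (cell k.+1 x) <= mass m (phi k) (cell k.+1 x).
Proof.
rewrite !phi_cell// lee_fin.
pose a := (U k.+1 x / mu k.+1 x)%R.
have UE : U k.+1 x = (a * mu k.+1 x)%R by rewrite divfK// gt_eqF.
have aE : (a = K * r k.+1 x)%R.
  by rewrite /a /r; field; rewrite !gt_eqF.
have a0 : (0 <= a)%R by rewrite divr_ge0// ltW.
clearbody a; rewrite UE !mulrA -!mulrBl !mulrA ler_pM2r//.
have M1E : M k.+1 x = Num.max (M k x) (r k.+1 x) by [].
have MM : (M k x <= M k.+1 x)%R by exact: M_nd.
have [r1|r1] := leP (r k.+1 x) (M k x).
  by rewrite M1E max_l.
apply: powR_potential => //.
  rewrite M1E (max_r (ltW r1)); apply: (@le_trans _ _ a); last first.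
    by have := r_gt0 k.+1 x; rewrite aE => r0; have := mulr_gt0 K_gt0 r0; lra.
  by rewrite aE ler_peMl// ltW.
apply: le_trans (r_le_M k x); rewrite /eps /r ler_pdivlMr ?mulr_gt0//.
rewrite (_ : 2 * (2 * D * K)^-1 * a * (K * mu k x) = (a * mu k x) / D)%R; last first.
  by field; rewrite !gt_eqF.
rewrite ler_pdivrMr//; apply: (@le_trans _ _ (a * (D * mu k.+1 x)))%R.
  by rewrite ler_wpM2l.
rewrite mulrCA -UE [leRHS]mulrC ler_pM2l//.
rewrite -lee_fin -!(cell_massE hub (ub_fin _ _)); apply: le_mass_set => //.
exact: cell_nested.
Qed.

(** Since [u <= 2 * u - M], the integral is at most that of the potential, which
    does not increase after generation [k]. *)
Lemma running_max_mass k l x : (k <= l)%N ->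
  mass m (fun y => M l y `^ eps * ub y)%R (cell k x) <=
  (2 * (U k x / mu k x) `^ eps * U k x)%:E.
Proof.
move=> kl; have duM : density (fun y => M l y `^ eps * ub y)%R.
  apply: densityM => //; split => [|y]; last exact: powR_ge0.
  exact: (measurableT_comp (measurable_powR _) (mM l)).
apply: (@le_trans _ _ (mass m (phi l) (cell k x))).
  apply: ae_le_mass => //; apply: filterS M_le_u => y /(_ l) My _.
  rewrite /phi ler_wpM2l ?powR_ge0// /ub ler_wpM2r ?hb.2// le_max.
  by apply/orP; right; lra.
apply: (@le_trans _ _ (mass m (phi k) (cell k x))).
  move: kl => /subnK <-; elim: (l - k)%N => [//|j IHj].
  rewrite addSn; apply: le_trans IHj.
  apply: (@le_mass_stopping _ _ _ _ _ hgrid _ _ (fun=> (j + k).+1)) => //.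
  - move=> y yx z zy; split => //; rewrite /=.
    by apply: etrans yx; apply: (cell_nested hgrid _ zy); rewrite ltnW// ltnS leq_addl.
  - by move=> y _; exact: phi_step.
rewrite phi_cell// lee_fin -mulrA mulrCA ler_pM//.
- exact: powR_ge0.
- by rewrite subr_ge0; have := running_max_le k x; have := U_gt0 k x; lra.
- rewrite ge0_ler_powR ?nnegrE ?(ltW (M_gt0 _ _))//.
  + by case/andP: eps01 => /ltW.
  + by rewrite divr_ge0// ltW.
  + by rewrite ler_pdivlMr// running_max_le.
- by rewrite mulrC lerBlDr lerDl mulr_ge0// ltW.
Qed.

(** A substitute for the reverse Hoelder inequality. Where [u <= t], the mass of
    [u] is at most [t] times that of [A]. Where [u > t], differentiation makes
    the running maximum exceed [t / (2 * K)], and [running_max_mass] bounds the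
    mass of that set. The threshold [t] is [z ^ (- 1 / 2)] times the average of
    [u] over the cell. *)
Theorem A1_decay k x (z : R) A : measurable A -> A `<=` cell k x -> (0 < z)%R ->
  mass m b A <= (z * mu k x)%:E ->
  mass m ub A <=
    (decay_constant D K * z `^ (decay_exponent D K))%:E * mass m ub (cell k x).
Proof.
have /andP[e0 e1] := eps01.
move=> mA Ax z0 Az; rewrite (cell_massE hub (ub_fin _ _)) -EFinM.
rewrite /decay_constant /decay_exponent -/eps.
have UA : mass m ub A <= (U k x)%:E.
  by rewrite -(cell_massE hub (ub_fin _ _)); exact: le_mass_set.
have [z1|z1] := leP 1%R z.
  apply: (le_trans UA); rewrite lee_fin ler_peMl ?(ltW (U_gt0 _ _))//.
  have zp : (1 <= z `^ (eps / 2))%R.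
    by rewrite -[leLHS](powRr0 z) ler_powR//; lra.
  have := powR_ge0 (2 * K) eps => Kp; nra.
pose a := (U k x / mu k x)%R; have a0 : (0 < a)%R by rewrite divr_gt0.
pose t := (a * z `^ (- 2^-1))%R; have t0 : (0 < t)%R by rewrite mulr_gt0// powR_gt0.
pose S := \bigcup_l [set y | cell k x y /\ (t / (2 * K) < M (l + k) y)%R].
have mF l : measurable [set y | cell k x y /\ (t / (2 * K) < M (l + k) y)%R].
  by apply: measurableI => //; exact: measurable_lt_set.
have mS : measurable S by exact: bigcupT_measurable.
have K20 : (0 < 2 * K)%R by rewrite mulr_gt0.
have tK0 : (0 < t / (2 * K))%R by rewrite divr_gt0.
pose c := ((t / (2 * K)) `^ eps)%R; have c0 : (0 < c)%R by exact: powR_gt0.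
(* Chebyshev's inequality for the power [eps] of the running maximum. *)
have large : mass m ub S <= (c^-1 * (2 * a `^ eps * U k x))%:E.
  apply: mass_bigcup_le => //.
    move=> i j ij; apply/subsetPset => y [yx tM]; split => //.
    by apply: lt_le_trans tM _; apply: M_nd; rewrite leq_add2r.
  move=> l; have duM : density (fun y => M (l + k) y `^ eps * ub y)%R.
    apply: densityM => //; split => [|y]; last exact: powR_ge0.
    exact: (measurableT_comp (measurable_powR _) (mM _)).
  rewrite EFinM; apply: (@le_trans _ _ (c^-1%:E *
      mass m (fun y => M (l + k) y `^ eps * ub y)%R (cell k x))); last first.
    rewrite lee_pmul2l ?lte_fin ?invr_gt0//; apply: running_max_mass.
    exact: leq_addl.
  rewrite -massZ// ?invr_ge0 ?(ltW c0)//.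
  apply: (@le_trans _ _ (mass m (fun y => c^-1 * (M (l + k) y `^ eps * ub y))%R
    [set y | cell k x y /\ (t / (2 * K) < M (l + k) y)%R])); last first.
    apply: le_mass_set => //; last by move=> y [].
    by apply: densityZ => //; rewrite invr_ge0 ltW.
  apply: le_mass => //; first by apply: densityZ => //; rewrite invr_ge0 ltW.
  move=> y [_ tM]; rewrite mulrA ler_peMl ?hub.2//.
  rewrite mulrC ler_pdivlMr// mul1r ge0_ler_powR ?nnegrE ?(ltW e0) ?(ltW tK0)//.
    exact: ltW (M_gt0 _ _).
  exact: ltW.
have small : mass m ub (A `&` [set y | (u y <= t)%R]) <= (t * (z * mu k x))%:E.
  have mAt : measurable (A `&` [set y | (u y <= t)%R]).
    by apply: measurableI => //; apply: measurable_le_set => //; exact: hu.1.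
  apply: (@le_trans _ _ (mass m (fun y => t * b y)%R (A `&` [set y | (u y <= t)%R]))).
    apply: le_mass => //; first exact: densityZ (ltW t0) hb.
    by move=> y [_ ut]; rewrite /ub ler_wpM2r ?hb.2.
  rewrite massZ ?(ltW t0)// (EFinM t) lee_pmul2l//.
  by apply: le_trans Az; apply: le_mass_set => // y [].
have mAt : measurable (A `\` [set y | (u y <= t)%R]).
  by apply: measurableD => //; apply: measurable_le_set => //; exact: hu.1.
have rest : mass m ub (A `\` [set y | (u y <= t)%R]) <= mass m ub S.
  rewrite -[X in mass _ _ X <= _]setTI -[X in _ <= mass _ _ X]setTI.
  rewrite -!mass_indic//.
  apply: ae_le_mass => //; try by apply: densityM => //; exact: density_indic.
  apply: filterS u_diff => y [l uy] _; rewrite ler_wpM2r ?hub.2// !indicE ler_nat.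
  case: (boolP (y \in A `\` _)) => // /set_mem[Ay /negP].
  rewrite -ltNge => ty.
  rewrite mem_set//; exists l => //; split; first exact: Ax.
  apply: (@lt_le_trans _ _ (r l y)); last first.
    by apply: le_trans (r_le_M l y) _; apply: M_nd; exact: leq_addr.
  rewrite ltr_pdivrMr// /r.
  rewrite (_ : U l y / (K * mu l y) * (2 * K) = 2 * U l y / mu l y)%R; last first.
    by field; rewrite !gt_eqF.
  by apply: lt_le_trans ty _; rewrite ler_pdivlMr.
have mu_t : measurable [set y | (u y <= t)%R].
  by apply: measurable_le_set => //; exact: hu.1.
rewrite (mass_setID m mA mu_t hub).
apply: le_trans (leeD small (le_trans rest large)) _.
rewrite -EFinD lee_fin.
have aU : (a * mu k x = U k x)%R by rewrite divfK// gt_eqF.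
have zE : (z `^ (- 2^-1) * z = z `^ (2^-1))%R.
  rewrite [RHS](_ : _ = z `^ (- 2^-1 + 1))%R; last by congr (powR _ _); lra.
  by rewrite powRD ?powRr1 ?(ltW z0)// (gt_eqF z0) implybT.
have -> : (t * (z * mu k x) = z `^ (2^-1) * U k x)%R.
  by rewrite -zE -aU /t; ring.
have cE : (c^-1 * (2 * a `^ eps * U k x) =
    2 * (2 * K) `^ eps * z `^ (eps / 2) * U k x)%R.
  have -> : c = (a `^ eps * (z `^ (eps / 2))^-1 * ((2 * K) `^ eps)^-1)%R.
    rewrite /c /t powRM ?invr_ge0 ?(ltW K20)//; last exact: ltW.
    rewrite powRM ?powR_ge0 ?(ltW a0)// -!powRN -powRrM; congr (_ * powR _ _ * _)%R.
      by field.
    by rewrite -(powR_inv1 (ltW K20)) -powRrM; congr (powR _ _); ring.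
  by field; rewrite !gt_eqF ?powR_gt0.
rewrite cE; set P := ((2 * K) `^ eps)%R; set Z := (z `^ (eps / 2))%R.
have -> : ((1 + 2 * P) * Z * U k x = Z * U k x + 2 * P * Z * U k x)%R by ring.
rewrite lerD2r ler_pM2r// ger_powR ?z0 ?(ltW z1)//; lra.
Qed.

End A1Decay.

(** * Densities that are rarely small *)

Definition contraction (R : realType) (s K : R) : R :=
  (1 - Num.min ((4 * K)^-1 `^ s^-1 / 4) 2^-1)%R.

Definition level_exponent (R : realType) (s delta : R) : R :=
  Num.min delta (s * delta)%R.

Definition level_constant (R : realType) (D s K delta C : R) : R :=
  (4 * (C * (D `^ delta + (K * 2 `^ s) `^ delta)))%R.

Definition weak_constant (R : realType) (D K1 s K delta C : R) : R :=
  (2 * K1 * level_constant D s K delta C /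
     (1 - contraction s K `^ level_exponent s delta) + 2 * K1)%R.

Section SmallValues.
Context d (T : measurableType d) (R : realType) (I : countType).
Variables (key : nat -> T -> I) (m : {measure set T -> \bar R}).
Hypothesis hgrid : grid key.
Local Notation cell := (cell key).
Variables b V : T -> R.
Hypotheses (hb : density b) (hV : density V).
Hypothesis V_gt0 : forall x, (0 < V x)%R.
Let vb x := (V x * b x)%R.
Let hvb : density vb. Proof. exact: densityM. Qed.
Local Notation mu := (cell_mass key m b).
Local Notation W := (cell_mass key m vb).
Hypothesis b_cell : forall k x, 0 < mass m b (cell k x) < +oo.
Hypothesis vb_cell : forall k x, 0 < mass m vb (cell k x) < +oo.

Let mcell k x : measurable (cell k x). Proof. exact: hgrid.1. Qed.

Let b_fin k x : mass m b (cell k x) < +oo.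
Proof. by case/andP: (b_cell k x). Qed.

Let vb_fin k x : mass m vb (cell k x) < +oo.
Proof. by case/andP: (vb_cell k x). Qed.

Let mu_gt0 k x : (0 < mu k x)%R.
Proof. by apply: fine_gt0; rewrite b_cell. Qed.

Let W_gt0 k x : (0 < W k x)%R.
Proof. by apply: fine_gt0; rewrite vb_cell. Qed.

Let mVle t : measurable [set y | (V y <= t)%R].
Proof. by apply: measurable_le_set => //; exact: hV.1. Qed.

(** The only consequence of the [A_r] conditions on [V], [r >= 1], that enters
    the mixed inequality. *)
Definition small_values (s K : R) := forall k x (t : R), (0 < t)%R ->
  mass m b (cell k x `&` [set y | (V y <= t)%R]) <=
  (K * (t * mu k x / W k x) `^ s * mu k x)%:E.

(** Almost every point of the set satisfies [W <= K * t * mu], which makes the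
    right-hand side at least the mass of the cell as soon as the set is not
    null. *)
Lemma small_values_A1 (K : R) : (0 < K)%R ->
  {ae m, forall x, forall k, (W k x <= K * V x * mu k x)%R} ->
  small_values 1 K.
Proof.
move=> K0 VA1 k x t t0; pose q := (K * (t * mu k x / W k x))%R.
have q0 : (0 <= q)%R by rewrite mulr_ge0 ?divr_ge0 ?mulr_ge0// ltW.
rewrite powRr1; last by rewrite divr_ge0 ?mulr_ge0// ltW.
have mE : measurable (cell k x `&` [set y | (V y <= t)%R]) by exact: measurableI.
apply: (@le_trans _ _ (mass m (fun y => q * b y)%R
    (cell k x `&` [set y | (V y <= t)%R]))).
  apply: ae_le_mass => //; first exact: densityZ.
  apply: filterS VA1 => y /(_ k) Wy [yx Vt]; rewrite ler_peMl ?hb.2//.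
  rewrite /q mulrA ler_pdivlMr// mul1r -(cell_mass_adapted _ _ yx).
  rewrite -(cell_mass_adapted m b yx) (le_trans Wy)// [leRHS]mulrA.
  by rewrite ler_pM2r// ler_pM2l.
rewrite massZ// (EFinM q) lee_wpmul2l ?lee_fin// -(cell_massE hb (b_fin _ _)).
by apply: le_mass_set => // y [].
Qed.

(** Chebyshev's inequality for the dual density [V ^ (- 1 / (r - 1))]. *)
Lemma small_values_Ar (r K : R) : (1 < r)%R -> (0 < K)%R ->
  (forall k x, mass m (fun y => V y `^ (- (r - 1)^-1) * b y)%R (cell k x) <=
     (mu k x * (K * mu k x / W k x) `^ (r - 1)^-1)%:E) ->
  small_values (r - 1)^-1 (K `^ (r - 1)^-1).
Proof.
move=> r1 K0 VAr k x t t0; set s := (r - 1)^-1%R in VAr *.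
have s0 : (0 < s)%R by rewrite invr_gt0; lra.
have dV : density (fun y => V y `^ (- s) * b y)%R.
  by apply: densityM => //; exact: density_powR.
have mE : measurable (cell k x `&` [set y | (V y <= t)%R]) by exact: measurableI.
have ts : (0 < t `^ s)%R by exact: powR_gt0.
apply: (@le_trans _ _ (mass m (fun y => t `^ s * (V y `^ (- s) * b y))%R
    (cell k x `&` [set y | (V y <= t)%R]))).
  apply: le_mass => //; first by apply: densityZ => //; exact: ltW.
  move=> y [_ Vt]; rewrite mulrA ler_peMl ?hb.2// powRN.
  rewrite ler_pdivlMr ?powR_gt0// mul1r ge0_ler_powR ?nnegrE//.
  - exact: ltW.
  - exact: hV.2.
  - exact: ltW.
rewrite massZ ?(ltW ts)//.
apply: (@le_trans _ _ ((t `^ s)%:E * (mu k x * (K * mu k x / W k x) `^ s)%:E)).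
  rewrite lee_pmul2l// (le_trans _ (VAr k x))//.
  by apply: le_mass_set => // y [].
have q0 : (0 <= mu k x / W k x)%R by rewrite divr_ge0// ltW.
rewrite -EFinM lee_fin -!mulrA; move: (mu k x / W k x)%R q0 => q q0.
rewrite !powRM ?(ltW K0) ?(ltW t0)//.
by rewrite le_eqVlt; apply/orP; left; apply/eqP; ring.
Qed.

(** Outside of [A] there is half of the mass, and by [small_values] at most a
    quarter of it sits where [V] is below a multiple of its mean. The rest
    carries a fixed fraction of the integral of [V]. *)
Lemma small_values_contract (s K : R) : (0 < s)%R -> (0 < K)%R ->
  small_values s K ->
  forall k x A, measurable A -> A `<=` cell k x ->
    mass m b A <= 2^-1%:E * mass m b (cell k x) ->
    mass m vb A <= (contraction s K)%:E * mass m vb (cell k x).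
Proof.
move=> s0 K0 VsK k x A mA Ax Ahalf; pose c := ((4 * K)^-1 `^ s^-1)%R.
have K40 : (0 < (4 * K)^-1)%R by rewrite invr_gt0 mulr_gt0.
have c0 : (0 < c)%R by exact: powR_gt0.
have cK : (K * c `^ s = 4^-1)%R.
  rewrite /c -powRrM mulVf ?gt_eqF// powRr1; last exact: ltW.
  by field; rewrite gt_eqF.
rewrite /contraction -/c; set eta := Num.min (c / 4)%R 2^-1%R.
have etac : (eta <= c / 4)%R by rewrite ge_min lexx.
pose t := (c * W k x / mu k x)%R.
have t0 : (0 < t)%R by rewrite divr_gt0// mulr_gt0.
have mF : measurable (cell k x `\` A) by exact: measurableD.
have mFt : measurable (cell k x `\` A `\` [set y | (V y <= t)%R]).
  exact: measurableD.
have fb B : measurable B -> B `<=` cell k x -> mass m b B \is a fin_num.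
  by move=> mB Bx; apply: mass_fin (b_fin k x).
have fvb B : measurable B -> B `<=` cell k x -> mass m vb B \is a fin_num.
  by move=> mB Bx; apply: mass_fin (vb_fin k x).
have bE := mass_setID m (mcell k x) mA hb.
have vbE := mass_setID m (mcell k x) mA hvb.
have bFE := mass_setID m mF (mVle t) hb.
rewrite (setIidr Ax) in bE vbE.
have Vsmall : mass m b ((cell k x `\` A) `&` [set y | (V y <= t)%R]) <=
    (4^-1 * mu k x)%:E.
  apply: (@le_trans _ _ (mass m b (cell k x `&` [set y | (V y <= t)%R]))).
    apply: le_mass_set => //; [exact: measurableI|exact: measurableI|].
    by move=> y [[yx _] Vt].
  apply: (le_trans (VsK k x t t0)).
  rewrite (_ : t * mu k x / W k x = c)%R ?cK//.
  by rewrite /t; field; rewrite !gt_eqF.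
have Vlarge : (t%:E * mass m b (cell k x `\` A `\` [set y | (V y <= t)%R]))
    <= mass m vb (cell k x `\` A).
  rewrite -massZ ?(ltW t0)//.
  apply: (@le_trans _ _ (mass m vb (cell k x `\` A `\` [set y | (V y <= t)%R]))).
    apply: le_mass => //; first by apply: densityZ => //; exact: ltW.
    move=> y [_ /negP]; rewrite -ltNge => Vt.
    by rewrite /vb ler_wpM2r ?hb.2// ltW.
  by apply: le_mass_set => // y [].
have sub1 : cell k x `\` A `<=` cell k x by move=> y [].
have sub2 : (cell k x `\` A) `&` [set y | (V y <= t)%R] `<=` cell k x by move=> y [[]].
have sub3 : cell k x `\` A `\` [set y | (V y <= t)%R] `<=` cell k x by move=> y [[]].
move: Ahalf bE bFE vbE Vsmall Vlarge.
rewrite (cell_massE hb (b_fin _ _)) (cell_massE hvb (vb_fin _ _)).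
rewrite -(fineK (fb _ mA Ax)) -(fineK (fvb _ mA Ax)) -(fineK (fb _ mF sub1)).
rewrite -(fineK (fvb _ mF sub1)) -(fineK (fb _ mFt sub3)).
rewrite -(fineK (fb _ (measurableI _ _ mF (mVle t)) sub2)).
rewrite -!EFinM -!EFinD !lee_fin => h1 [h2] [h3] [h4] h5 h6.
set bFt := fine (mass m b (_ `\` _ `\` _)) in h3 h6.
have : (4^-1 * mu k x <= bFt)%R by lra.
rewrite -(ler_pM2l t0) => /le_trans/(_ h6).
rewrite (_ : t * (4^-1 * mu k x) = c / 4 * W k x)%R; last first.
  by rewrite /t; field; rewrite gt_eqF.
move=> h7; have : (eta * W k x <= c / 4 * W k x)%R by rewrite ler_pM2r.
by move: h4 h7; rewrite mulrBl mul1r; lra.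
Qed.

(** Let [q] be the mean of [V] divided by [t]. The set has relative mass at most
    [D * q] by Chebyshev's inequality, and at most a multiple of [q ^ (- s)]
    by [small_values]. The decay of [u] turns both into powers of [q], and
    [saturation_drop] is comparable to the smaller one. *)
Lemma level_decay (u : T -> R) (D s K delta C : R) :
  density u -> (0 < D)%R -> (0 < s)%R -> (0 < K)%R -> (0 < delta <= 1)%R ->
  (0 < C)%R -> small_values s K ->
  (forall k x (z : R) A, measurable A -> A `<=` cell k x -> (0 < z)%R ->
    mass m b A <= (z * mu k x)%:E ->
    mass m (fun y => u y * b y)%R A <=
      (C * z `^ delta)%:E * mass m (fun y => u y * b y)%R (cell k x)) ->
  forall k x (t : R), (0 < t)%R ->
    mass m (fun y => u y * b y)%R
      (cell k x `&` [set y | (t <= D * V y)%R /\ (V y <= 2 * t)%R]) <=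
    (level_constant D s K delta C *
     saturation_drop (level_exponent s delta) (W k x / (t * mu k x)))%:E *
      mass m (fun y => u y * b y)%R (cell k x).
Proof.
move=> hu D0 s0 K0 /andP[e0 e1] C0 VsK uC k x t t0.
rewrite /level_constant /level_exponent; set del := Num.min delta (s * delta)%R.
have del0 : (0 < del)%R by rewrite lt_min e0 mulr_gt0.
have dele : (del <= delta)%R by rewrite ge_min lexx.
have delse : (del <= s * delta)%R by rewrite ge_min lexx orbT.
set K' := (K * 2 `^ s)%R; have K'0 : (0 < K')%R by rewrite mulr_gt0 ?powR_gt0.
set E := _ `&` _.
pose q := (W k x / (t * mu k x))%R.
have q0 : (0 < q)%R by rewrite divr_gt0// mulr_gt0.
have mE : measurable E.
  apply: measurableI => //.
  apply: (@measurableI _ _ [set y | t <= D * V y]%R [set y | V y <= 2 * t]%R) => //.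
  by apply: measurable_le_set => //; apply: measurable_funM => //; exact: hV.1.
have Ex : E `<=` cell k x by move=> y [].
have E1 : mass m b E <= (D * q * mu k x)%:E.
  have Dt0 : (0 <= D / t)%R by rewrite divr_ge0// ltW.
  rewrite (_ : D * q * mu k x = D / t * W k x)%R; last first.
    by rewrite /q; field; rewrite !gt_eqF.
  rewrite EFinM -(cell_massE hvb (vb_fin _ _)) -massZ//.
  apply: (@le_trans _ _ (mass m (fun y => D / t * vb y)%R E)).
    apply: le_mass => //; first exact: densityZ.
    move=> y [_ [tV _]]; rewrite /vb mulrA ler_peMl ?hb.2//.
    by rewrite mulrAC ler_pdivlMr// mul1r.
  by apply: le_mass_set => //; exact: densityZ.
have E2 : mass m b E <= (K' * q `^ (- s) * mu k x)%:E.
  apply: (@le_trans _ _ (mass m b (cell k x `&` [set y | (V y <= 2 * t)%R]))).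
    apply: le_mass_set => //; first exact: measurableI.
    by move=> y [yx [_ Vy]].
  have t20 : (0 < 2 * t)%R by rewrite mulr_gt0.
  apply: (le_trans (VsK k x _ t20)).
  rewrite (_ : 2 * t * mu k x / W k x = 2 * q^-1)%R; last first.
    by rewrite /q; field; rewrite !gt_eqF.
  rewrite powRM ?invr_ge0 ?(ltW q0)// /K' -(powR_inv1 (ltW q0)) -powRrM mulN1r.
  by rewrite !mulrA.
have q1 : (0 < D * q)%R by rewrite mulr_gt0.
have q2 : (0 < K' * q `^ (- s))%R by rewrite mulr_gt0 ?powR_gt0.
have hub : density (fun y => u y * b y)%R by exact: densityM.
have drop_ge (z : R) : (0 <= z)%R ->
    (z <= C * (D `^ delta + K' `^ delta) * (4 * saturation_drop del q))%R ->
    z%:E * mass m (fun y => u y * b y)%R (cell k x) <=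
    (4 * (C * (D `^ delta + K' `^ delta)) * saturation_drop del q)%:E *
    mass m (fun y => u y * b y)%R (cell k x).
  move=> z0 zq; apply: lee_wpmul2r; first exact: mass_ge0.
  by rewrite lee_fin (le_trans zq)// mulrA [(4 * _)%R]mulrC.
have Dp := powR_gt0 delta D0; have Kp := powR_gt0 delta K'0.
have [q_le1|q_gt1] := leP q 1%R.
  apply: (le_trans (uC k x _ E mE Ex q1 E1)); apply: drop_ge.
    by rewrite mulr_ge0 ?powR_ge0 ?ltW.
  rewrite powRM ?(ltW D0) ?(ltW q0)// mulrA; apply: ler_pM.
  - by rewrite mulr_ge0 ?powR_ge0 ?ltW.
  - exact: powR_ge0.
  - by rewrite ler_pM2l// lerDl ltW.
  apply: (@le_trans _ _ (q `^ del)%R).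
    by rewrite ger_powR ?q0 ?q_le1.
  have : (0 < q `^ del <= 1)%R.
    rewrite powR_gt0//= -[leRHS](powRr0 q) ger_powR ?q0 ?q_le1// ltW//.
  rewrite /saturation_drop; set z := (q `^ del)%R => /andP[z0 z1].
  rewrite mulrA ler_pdivlMr; last by rewrite exprn_gt0//; lra.
  nra.
apply: (le_trans (uC k x _ E mE Ex q2 E2)); apply: drop_ge.
  by rewrite mulr_ge0 ?powR_ge0 ?ltW.
rewrite powRM ?(ltW K'0) ?powR_ge0// mulrA; apply: ler_pM.
- by rewrite mulr_ge0 ?powR_ge0 ?ltW.
- exact: powR_ge0.
- by rewrite ler_pM2l// lerDr ltW.
rewrite -powRrM.
apply: (@le_trans _ _ (q `^ (- del))%R).
  by rewrite ler_powR ?(ltW q_gt1)// mulNr lerN2.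
have : (1 <= q `^ del)%R by rewrite -[leLHS](powRr0 q) ler_powR ?(ltW q_gt1)// ltW.
rewrite powRN /saturation_drop; set z := (q `^ del)%R => z1.
have z0 : (0 < z)%R by lra.
rewrite mulrA ler_pdivlMr; last by rewrite exprn_gt0//; lra.
rewrite mulrC ler_pdivrMr//; nra.
Qed.

Lemma contraction_itv (s K : R) : (0 < K)%R -> (0 < contraction s K < 1)%R.
Proof.
move=> K0; have c0 : (0 < (4 * K)^-1 `^ s^-1)%R.
  by rewrite powR_gt0// invr_gt0 mulr_gt0.
have : (0 < Num.min ((4 * K)^-1 `^ s^-1 / 4) 2^-1)%R.
  by rewrite lt_min divr_gt0//= invr_gt0.
have : (Num.min ((4 * K)^-1 `^ s^-1 / 4) 2^-1 <= 2^-1)%R.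
  by rewrite ge_min lexx orbT.
by rewrite /contraction => h1 h2; apply/andP; split; lra.
Qed.

Theorem mixed_weak_type_small_values (u g : T -> R) (D K1 s K delta C : R) :
  density u -> (forall x, 0 < u x)%R -> density g -> (0 < D)%R -> (0 < K1)%R ->
  (0 < s)%R -> (0 < K)%R -> (0 < delta <= 1)%R -> (0 < C)%R ->
  (forall k x, 0 < mass m (fun y => u y * b y)%R (cell k x) < +oo) ->
  (forall k x, mu k x <= D * mu k.+1 x)%R ->
  {ae m, forall x, forall k,
    (cell_mass key m (fun y => u y * b y) k x <= K1 * u x * mu k x)%R} ->
  small_values s K ->
  (forall k x (z : R) A, measurable A -> A `<=` cell k x -> (0 < z)%R ->
    mass m b A <= (z * mu k x)%:E ->
    mass m (fun y => u y * b y)%R A <=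
      (C * z `^ delta)%:E * mass m (fun y => u y * b y)%R (cell k x)) ->
  mass m (fun y => V y * (u y * b y))%R
    [set y | exists k, (V y < average key m b g k y)%R] <=
  (weak_constant D K1 s K delta C)%:E *
    mass m (fun y => g y * (u y * b y))%R [set: T].
Proof.
move=> hu u0 hg D0 K10 s0 K0 delta01 C0 ub_cell dbl uA1 VsK uC.
have ub_fin k x : mass m (fun y => u y * b y)%R (cell k x) < +oo.
  by case/andP: (ub_cell k x).
have hub : density (fun y => u y * b y)%R by exact: densityM.
have hgub : density (fun y => g y * (u y * b y))%R by exact: densityM.
have hgb : density (fun y => g y * b y)%R by exact: densityM.
have /andP[delta0 delta1] := delta01.
have exp01 : (0 < level_exponent s delta <= 1)%R.
  by rewrite /level_exponent lt_min delta0 mulr_gt0//= ge_min delta1.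
have K20 : (0 < level_constant D s K delta C)%R.
  by rewrite !mulr_gt0// addr_gt0// powR_gt0// mulr_gt0// powR_gt0.
have eps01 := contraction_itv s K0.
have eps_lt1 : (contraction s K `^ level_exponent s delta < 1)%R.
  have /andP[e0 e1] := eps01; have /andP[d0 _] := exp01.
  have <- : (1 `^ level_exponent s delta = 1 :> R)%R by rewrite powR1.
  by rewrite gt0_ltr_powR ?nnegrE ?ltW.
have Cw0 : (0 < weak_constant D K1 s K delta C)%R.
  apply: addr_gt0; last exact: mulr_gt0.
  apply: divr_gt0; last by rewrite subr_gt0.
  by apply: mulr_gt0 K20; exact: mulr_gt0.
have [gfin|] := boolP (mass m (fun y => g y * (u y * b y))%R [set: T] < +oo); last first.
  by rewrite -leNgt leye_eq => /eqP ->; rewrite gt0_muley ?lte_fin// leey.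
apply: (@mixed_weak_type _ _ _ _ key m hgrid b g u V hb hg hu hV V_gt0 D K1
  (level_constant D s K delta C) (contraction s K) (level_exponent s delta)) => //.
(* On a cell the [A1] property bounds [1] by a multiple of [u], so [g * b] has
   finite mass there. *)
- move=> k x; pose c := (K1 * mu k x / cell_mass key m (fun y => u y * b y)%R k x)%R.
  have U0 : (0 < cell_mass key m (fun y => u y * b y)%R k x)%R.
    by apply: fine_gt0; rewrite ub_cell.
  have c0 : (0 < c)%R by rewrite divr_gt0// mulr_gt0.
  apply: (@le_lt_trans _ _ (mass m (fun y => c * (g y * (u y * b y)))%R (cell k x))).
    apply: ae_le_mass => //; first by apply: densityZ => //; exact: ltW.
    apply: filterS uA1 => y /(_ k) uy yx.
    rewrite mulrCA ler_wpM2l ?hg.2// mulrA ler_peMl ?hb.2//.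
    rewrite /c mulrAC ler_pdivlMr// mul1r mulrAC.
    by rewrite -(cell_mass_adapted m _ yx) -(cell_mass_adapted m b yx).
  rewrite massZ ?(ltW c0)//; apply: lte_mul_pinfty => //.
    by rewrite lee_fin ltW.
  by apply: le_lt_trans gfin; exact: le_mass_set.
- exact: small_values_contract.
- by move=> k x t t0; apply: level_decay.
Qed.

End SmallValues.

(** * Scaling and half-spaces for Lebesgue measure *)

Section LebesgueRn.
Context (R : realType) (n : nat).
Local Notation Rn := 'rV[R]_n.
Local Notation leb := (@lebesgue_Rn R n).
Implicit Types (a b z x : Rn) (A : set Rn) (l c : R).

Let vol (s : Rn * Rn) : \bar R := (box_volume s.1 s.2)%:E.

Lemma box_volume_ge0 a b : (forall i, a ord0 i <= b ord0 i)%R ->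
  (0 <= box_volume a b)%R.
Proof. by move=> ab; apply: prodr_ge0 => i _; rewrite subr_ge0. Qed.

(** Covers are sets of boxes, whereas an indexed family may repeat a box. *)
Lemma lebesgue_outer_le_family (I : choiceType) (S : set I) (s : I -> Rn * Rn) A :
  countable S -> (forall i, S i -> forall j, (s i).1 ord0 j <= (s i).2 ord0 j)%R ->
  A `<=` \bigcup_(i in S) box (s i).1 (s i).2 ->
  lebesgue_outer A <= \esum_(i in S) vol (s i).
Proof.
move=> cS Sle AS.
have vol0 i : S i -> 0 <= vol (s i).
  by move=> /Sle si; rewrite lee_fin box_volume_ge0.
have [S0|/set0P[i0 Si0]] := eqVneq S set0.
  rewrite (_ : A = set0) ?lebesgue_outer0 ?esum_ge0//.
  by apply/seteqP; split => // x /AS; rewrite S0 bigcup_set0.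
have /choice[h hP] : forall y, exists i, (s @` S) y -> S i /\ s i = y.
  move=> y; have [[i Si <-]|ny] := pselect ((s @` S) y); first by exists i.
  by exists i0 => /ny.
pose P := h @` (s @` S).
have PS : P `<=` S by move=> _ [y /hP[Sh _] <-].
have sP : s @` P = s @` S.
  apply/seteqP; split => [_ [_ [y ys <-] <-]|y ys]; first by rewrite (hP y ys).2.
  by exists (h y); [exists y|exact: (hP y ys).2].
have injP : set_inj P s.
  move=> _ _ /set_mem[y ys <-] /set_mem[y' ys' <-].
  by rewrite (hP y ys).2 (hP y' ys').2 => ->.
apply: (@le_trans _ _ (\esum_(i in P) vol (s i))); last first.
  rewrite (esumID P S) ?(setIidr PS)//; apply: leeDl.
  by apply: esum_ge0 => i [Si _]; exact: vol0.
rewrite -(@esum_image _ _ _ P s vol injP) sP.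
apply: ereal_inf_lbound; exists (s @` S) => //; split.
- exact: card_le_trans (card_image_le _ _) cS.
- by move=> _ [i Si <-]; exact: Sle.
- move=> x /AS[i Si xi]; exists (s i) => //; by exists i.
Qed.

Lemma le_esumZ (I : choiceType) (S : set I) (f : I -> \bar R) c : (0 <= c)%R ->
  (forall i, 0 <= f i) -> \esum_(i in S) (c%:E * f i) <= c%:E * \esum_(i in S) f i.
Proof.
move=> c0 f0; apply: ge_ereal_sup => _ [X XS <-].
rewrite -ge0_mule_fsumr//; apply: lee_wpmul2l; first by rewrite lee_fin.
by apply: ereal_sup_ubound; exists X.
Qed.

Lemma lebesgue_outer_box a b : (forall i, a ord0 i <= b ord0 i)%R ->
  lebesgue_outer (box a b) <= (box_volume a b)%:E.
Proof.
move=> ab; rewrite -[leRHS]/(vol (a, b)).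
rewrite -(@esum_set1 _ _ (a, b) vol) ?lee_fin ?box_volume_ge0//.
apply: ereal_inf_lbound; exists [set (a, b)] => //; split.
- exact: countable1.
- by move=> _ ->.
- by move=> x xab; exists (a, b).
Qed.

Lemma lebesgue_outer_affine_le c z A : (0 < c)%R ->
  lebesgue_outer [set (c *: x + z)%R | x in A] <= (c ^+ n)%:E * lebesgue_outer A.
Proof.
move=> c0; rewrite -ereal_inf_pZl ?exprn_gt0//; apply: le_ereal_inf_tmp.
move=> _ [_ [S [cS Sle AS] <-] <-].
have cn0 : (0 <= c ^+ n)%R by rewrite exprn_ge0// ltW.
have -> : \esum_(s in S) (box_volume s.1 s.2)%:E = \esum_(s in S) `|vol s|.
  apply: eq_esum => s Ss; rewrite gee0_abs// lee_fin box_volume_ge0//.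
  exact: Sle.
apply: le_trans (le_esumZ _ cn0 _) => //.
apply: (@le_trans _ _ (\esum_(s in S) vol (c *: s.1 + z, c *: s.2 + z)%R)).
  apply: lebesgue_outer_le_family => //.
    by move=> s Ss j /=; rewrite !mxE lerD2r ler_pM2l//; exact: Sle.
  move=> _ [x /AS[s Ss sx] <-]; exists s => // i.
  by rewrite /= !mxE !lerD2r !ler_pM2l//; exact: sx.
apply: le_esum => s Ss; rewrite gee0_abs ?lee_fin ?box_volume_ge0//; last exact: Sle.
rewrite /box_volume /=.
rewrite (eq_bigr (fun i => c * (s.2 ord0 i - s.1 ord0 i)))%R; last first.
  by move=> i _; rewrite !mxE; ring.
by rewrite big_split/= prodr_const card_ord.
Qed.

Lemma lebesgue_affine c z A : (0 < c)%R ->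
  leb [set (c *: x + z)%R | x in A] = (c ^+ n)%:E * leb A.
Proof.
move=> c0; apply/eqP; rewrite eq_le; apply/andP; split.
  exact: lebesgue_outer_affine_le.
have c'0 : (0 < c^-1)%R by rewrite invr_gt0.
have := @lebesgue_outer_affine_le c^-1 (- (c^-1 *: z))
  [set (c *: x + z)%R | x in A] c'0.
rewrite (_ : [set _ | _ in _] = A); last first.
  apply/seteqP; split => [_ [_ [x Ax <-] <-]|x Ax].
    by rewrite scalerDr scalerA mulVf ?gt_eqF// scale1r addrK.
  exists (c *: x + z)%R; first by exists x.
  by rewrite scalerDr scalerA mulVf ?gt_eqF// scale1r addrK.
rewrite -[X in _ -> X <= _]/((c ^+ n)%:E * lebesgue_outer A) => H.
apply: le_trans (_ : _ <= (c ^+ n)%:E * ((c^-1 ^+ n)%:E *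
   lebesgue_outer [set (c *: x + z)%R | x in A])) _.
  by rewrite lee_wpmul2l// lee_fin exprn_ge0// ltW.
by rewrite muleA -EFinM -exprMn mulfV ?gt_eqF// expr1n mul1e.
Qed.

Definition cube_at a l : set Rn :=
  [set x | forall i, (a ord0 i <= x ord0 i <= a ord0 i + l)%R].

Definition unit_volume : R := fine (leb (cube_at 0 1)).

Lemma lebesgue_cube a l : (0 < l)%R -> leb (cube_at a l) = (l ^+ n * unit_volume)%:E.
Proof.
move=> l0; have -> : cube_at a l = [set (l *: x + a)%R | x in cube_at 0 1].
  apply/seteqP; split => [x xa|_ [x x01 <-] i].
    exists (l^-1 *: (x - a))%R; last first.
      by rewrite scalerA divff ?gt_eqF// scale1r subrK.
    move=> i; rewrite !mxE add0r mulrC; have /andP[xa1 xa2] := xa i.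
    rewrite divr_ge0 ?subr_ge0 ?(ltW l0)//= ler_pdivrMr// mul1r.
    by rewrite lerBlDl.
  have := x01 i; rewrite !mxE add0r => /andP[x0 x1].
  rewrite addrC lerDl mulr_ge0 ?(ltW l0)//= lerD2l.
  by rewrite ler_piMr// ltW.
rewrite lebesgue_affine// EFinM fineK// ge0_fin_numE ?measure_ge0//.
have -> : cube_at 0 1 = box 0%R (const_mx 1)%R.
  by apply/seteqP; split => x xb i; have := xb i; rewrite !mxE add0r.
apply: le_lt_trans (lebesgue_outer_box _) (ltry _) => i.
by rewrite !mxE.
Qed.

Lemma unit_volume_ge0 : (0 <= unit_volume)%R.
Proof. by rewrite fine_ge0// measure_ge0. Qed.

Lemma box_volume_face a b i : a ord0 i = b ord0 i -> box_volume a b = 0%R.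
Proof. by move=> abi; rewrite /box_volume (bigD1 i)//= abi subrr mul0r. Qed.

(** A hyperplane cuts every box into two boxes whose volumes add up, which is
    Caratheodory's criterion once summed over a cover. *)
Lemma measurable_halfspace (i : 'I_n) c :
  measurable ([set x | (x ord0 i <= c)%R] : set (lebesgue_type R n)).
Proof.
apply: le_caratheodory_measurable => X.
apply: le_ereal_inf_tmp => _ [S [cS Sle XS] <-].
(* The cutting level is clamped to the box, so that both halves are boxes. *)
pose mid (s : Rn * Rn) := Num.max (s.1 ord0 i) (Num.min (s.2 ord0 i) c).
pose upd (x : Rn) r : Rn := (\row_j if j == i then r else x ord0 j)%R.
have mid_itv s : S s -> (s.1 ord0 i <= mid s <= s.2 ord0 i)%R.
  by move=> Ss; rewrite le_max lexx /= ge_max Sle// ge_min lexx.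
have ordl s : S s -> forall j, (s.1 ord0 j <= upd s.2 (mid s) ord0 j)%R.
  move=> Ss j; rewrite mxE; case: eqP => [->|_]; last exact: Sle.
  by case/andP: (mid_itv s Ss).
have ordr s : S s -> forall j, (upd s.1 (mid s) ord0 j <= s.2 ord0 j)%R.
  move=> Ss j; rewrite mxE; case: eqP => [->|_]; last exact: Sle.
  by case/andP: (mid_itv s Ss).
apply: (@le_trans _ _ (\esum_(s in S) vol (s.1, upd s.2 (mid s)) +
                       \esum_(s in S) vol (upd s.1 (mid s), s.2))).
  apply: leeD; apply: lebesgue_outer_le_family => //.
  - move=> x [/XS[s Ss sx] xc]; exists s => // j.
    rewrite /= !mxE; case: eqP => [->|_]; last exact: sx.
    have /andP[h1 h2] := sx i.
    by rewrite h1 /= le_max le_min h2 xc orbT.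
  - move=> x [/XS[s Ss sx] /negP xc]; exists s => // j.
    rewrite /= !mxE; case: eqP => [->|_]; last exact: sx.
    have /andP[h1 h2] := sx i.
    rewrite h2 andbT ge_max h1 /= ge_min; apply/orP; right.
    by move: xc; rewrite -ltNge => /ltW.
rewrite -esumD.
- apply: le_esum => s Ss; rewrite /vol -EFinD lee_fin /box_volume /=.
  rewrite (bigD1 i)//= [X in (_ + X <= _)%R](bigD1 i)//=.
  rewrite [X in (_ <= X)%R](bigD1 i)//= !mxE eqxx.
  rewrite (eq_bigr (fun j => s.2 ord0 j - s.1 ord0 j))%R; last first.
    by move=> j /negPf ji; rewrite mxE ji.
  rewrite [X in (_ + _ * X <= _)%R](eq_bigr (fun j => s.2 ord0 j - s.1 ord0 j))%R.
    by rewrite -mulrDl le_eqVlt; apply/orP; left; apply/eqP; congr (_ * _)%R; ring.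
  by move=> j /negPf ji; rewrite mxE ji.
- move=> s Ss; rewrite lee_fin; apply: box_volume_ge0 => j.
  exact: (ordl s Ss j).
- move=> s Ss; rewrite lee_fin; apply: box_volume_ge0 => j.
  exact: (ordr s Ss j).
Qed.

Lemma measurable_coordinate (i : 'I_n) :
  measurable_fun [set: lebesgue_type R n]
    (fun x : lebesgue_type R n => (x : Rn) ord0 i).
Proof.
apply: (measurability _ (RGenOInfty.measurableE R)) => //.
move=> _ [_ [r ->] <-]; rewrite setTI.
rewrite (_ : _ @^-1` _ = ~` [set x : Rn | (x ord0 i <= r)%R]).
  exact: measurableC (measurable_halfspace i r).
apply/seteqP; split => x /=; rewrite in_itv/= andbT.
  by move=> rx; apply/negP; rewrite -ltNge.
by move/negP; rewrite -ltNge.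
Qed.

Lemma measurable_box a b : measurable (box a b : set (lebesgue_type R n)).
Proof.
rewrite (_ : box a b = \bigcap_(i in [set: 'I_n])
    ((fun x : lebesgue_type R n => (x : Rn) ord0 i) @^-1` `[a ord0 i, b ord0 i])).
  apply: fin_bigcap_measurable => // i _.
  by rewrite -[X in measurable X]setTI; exact: measurable_coordinate.
apply/seteqP; split => x xb i; [move=> _|]; have := xb i; rewrite /= in_itv//=.
exact.
Qed.

Lemma measurable_cube a l : measurable (cube_at a l : set (lebesgue_type R n)).
Proof.
have E i : ((\row_j (a ord0 j + l)) ord0 i = a ord0 i + l :> R)%R by exact: mxE.
rewrite (_ : cube_at a l = box a (\row_j (a ord0 j + l))%R); first exact: measurable_box.
by apply/seteqP; split => x xb i; have := xb i; rewrite E.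
Qed.

Lemma box_face0 a b i : (forall i, a ord0 i <= b ord0 i)%R ->
  a ord0 i = b ord0 i -> leb (box a b) = 0.
Proof.
move=> ab abi; apply/eqP; rewrite eq_le measure_ge0 andbT.
by have := lebesgue_outer_box ab; rewrite (box_volume_face abi).
Qed.

End LebesgueRn.

(** * Dyadic grids and differentiation *)

Section EsumCover.
Context d (T : measurableType d) (R : realType) (m : {measure set T -> \bar R}).

Lemma mass_le_esum_cover (I : choiceType) (S : set I) (B : I -> set T)
    (c : I -> \bar R) (f : T -> R) (A : set T) :
  countable S -> density f -> measurable A -> (forall i, measurable (B i)) ->
  A `<=` \bigcup_(i in S) B i ->
  (forall i, S i -> mass m f (A `&` B i) <= c i) ->
  mass m f A <= \esum_(i in S) c i.
Proof.
move=> cS df mA mB AB fc.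
have c0 i : S i -> 0 <= c i.
  by move=> Si; apply: le_trans (fc _ Si); exact: mass_ge0.
have /countable_injP[num inj] := cS.
pose F j : set T := A `&` [set x | exists i, [/\ S i, num i = j & B i x]].
have FE j : F j = set0 \/ exists i, [/\ S i, num i = j & F j = A `&` B i].
  have [[i [Si ij]]|ni] := pselect (exists i, S i /\ num i = j); last first.
    by left; apply/seteqP; split => // x [_ [i [Si ij _]]]; apply: ni; exists i.
  right; exists i; split => //; rewrite /F; congr (_ `&` _).
  apply/seteqP; split => x; last by exists i.
  move=> [i' [Si' i'j]]; suff -> : i' = i by [].
  by apply: inj; rewrite ?inE// ij i'j.
have mF j : measurable (F j).
  by case: (FE j) => [->//|[i [_ _ ->]]]; exact: measurableI.
have AF : A = \bigcup_j F j.
  apply/seteqP; split => [x Ax|x [j _ []]//].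
  by have [i Si Bix] := AB x Ax; exists (num i) => //; split => //; exists i.
pose J j : set I := S `&` [set i | num i = j].
have JS : S = \bigcup_j J j.
  by apply/seteqP; split => [i Si|i [j _ []]//]; exists (num i).
rewrite AF seqDU_bigcup_eq mass_bigcup//; last first.
  by move=> k; apply: measurableD => //; exact: bigsetU_measurable.
rewrite JS esum_bigcup -?JS//; last first.
  by apply: (sub_trivIset (subsetT _)) => i j _ _ [k [[_ <-] [_ <-]]].
rewrite -nneseries_esumT; last first.
  by move=> j; apply: esum_ge0 => i [Si _]; exact: c0.
apply: lee_nneseries => [j _ _|j _]; first exact: mass_ge0.
apply: (@le_trans _ _ (mass m f (F j))).
  apply: le_mass_set => //; last exact: subDsetl.
  by apply: measurableD => //; exact: bigsetU_measurable.
case: (FE j) => [->|[i [Si ij ->]]].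
  by rewrite /mass integral_set0; apply: esum_ge0 => i [Si _]; exact: c0.
rewrite (_ : J j = [set i]) ?esum_set1//; [exact: fc|exact: c0|].
apply/seteqP; split => [i' [Si' i'j]|_ ->//].
by apply: inj; rewrite ?inE// i'j.
Qed.

End EsumCover.

Section DyadicGrid.
Context (R : realType) (n : nat).
Local Notation Rn := 'rV[R]_n.
Local Notation leb := (@lebesgue_Rn R n).
Variables (L : R) (a : Rn).
Hypothesis L_gt0 : (0 < L)%R.
Implicit Types (k : nat) (x y : Rn).

Definition side k : R := (L * 2^-1 ^+ k)%R.

Definition dyadic_key k (x : lebesgue_type R n) : {ffun 'I_n -> int} :=
  [ffun i => Num.floor (((x : Rn) ord0 i - a ord0 i) / side k)%R].

Definition corner k x : Rn :=
  (\row_i (a ord0 i + side k * (dyadic_key k x i)%:~R))%R.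

Lemma side_gt0 k : (0 < side k)%R.
Proof. by rewrite mulr_gt0// exprn_gt0// invr_gt0. Qed.

Lemma side_cvg0 : side k @[k --> \oo] --> (0%R : R).
Proof.
apply: (@cvg_geometric R L 2^-1%R).
by rewrite ger0_norm ?invr_ge0// invf_lt1//; lra.
Qed.

Lemma dyadic_cellE k x : cell dyadic_key k x =
  [set y | forall i, (corner k x ord0 i <= y ord0 i < corner k x ord0 i + side k)%R].
Proof.
have itvE y i : (corner k x ord0 i <= y ord0 i < corner k x ord0 i + side k)%R =
    (dyadic_key k y i == dyadic_key k x i).
  rewrite {2}/dyadic_key ffunE floor_eq mxE ler_pdivlMr ?side_gt0//.
  rewrite ltr_pdivrMr ?side_gt0// lerBrDl ltrBlDl intrD mulrDl mul1r.
  by rewrite [(side k * _)%R]mulrC addrA.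
apply/seteqP; split => y.
  by move=> /= yx i; rewrite itvE yx.
by move=> yx; apply/ffunP => i; apply/eqP; rewrite -itvE.
Qed.

Lemma dyadic_grid : @grid _ (lebesgue_type R n) _ dyadic_key.
Proof.
split=> [k x|k x y].
  rewrite dyadic_cellE [X in measurable X](_ : _ = \bigcap_(i in [set: 'I_n])
      ((fun y : lebesgue_type R n => (y : Rn) ord0 i) @^-1`
        `[corner k x ord0 i, (corner k x ord0 i + side k)%R[)).
    apply: fin_bigcap_measurable => // i _.
    by rewrite -[X in measurable X]setTI; exact: measurable_coordinate.
  apply/seteqP; split => y yx i; [move=> _|]; have := yx i; rewrite /= in_itv//=.
  exact.
have sideS : (side k = 2 * side k.+1)%R.
  by rewrite /side exprS; field.
move=> /ffunP xy; apply/ffunP => i; have := xy i; rewrite !ffunE => /eqP.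
set p := ((x ord0 i - _) / _)%R; set q := ((y ord0 i - _) / _)%R => pq.
have pE : ((x ord0 i - a ord0 i) / side k = p / 2)%R.
  by rewrite /p sideS; field; rewrite gt_eqF// side_gt0.
have qE : ((y ord0 i - a ord0 i) / side k = q / 2)%R.
  by rewrite /q sideS; field; rewrite gt_eqF// side_gt0.
rewrite pE qE; move: pq; move: p q {pE qE} => p q /eqP pq.
have le_half (z : int) (s t : R) : Num.floor s = Num.floor t ->
    (z%:~R <= s / 2)%R -> (z%:~R <= t / 2)%R.
  move=> st zs; have : ((z * 2)%:~R <= s)%R by rewrite intrM -ler_pdivlMr.
  by rewrite -floor_ge_int st floor_ge_int intrM -ler_pdivlMr.
apply/eqP; rewrite eq_le !floor_ge_int.
by rewrite (le_half _ p q)// ?floor_le// (le_half _ q p)// ?floor_le.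
Qed.

Lemma dyadic_sub_cube k x : cell dyadic_key k x `<=` cube_at (corner k x) (side k).
Proof.
rewrite dyadic_cellE => y yx i; have /andP[h1 h2] := yx i.
by rewrite h1 ltW.
Qed.

(** The difference is contained in the upper faces of the closed cube, which are
    degenerate boxes. *)
Lemma dyadic_cube_null k x : leb (cube_at (corner k x) (side k) `\`
  cell dyadic_key k x) = 0.
Proof.
have mc := dyadic_grid.1 k x.
pose upd (z : Rn) i r : Rn := (\row_j if j == i then r else z ord0 j)%R.
pose top : Rn := (\row_i (corner k x ord0 i + side k))%R.
pose face i := box (upd (corner k x) i (top ord0 i)) top.
have topE i : top ord0 i = (corner k x ord0 i + side k)%R by exact: mxE.
have cubeE : cube_at (corner k x) (side k) = box (corner k x) top.
  by apply/seteqP; split => y yx i; have := yx i; rewrite topE.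
have face_le i j : (upd (corner k x) i (top ord0 i) ord0 j <= top ord0 j)%R.
  by rewrite [leLHS]mxE; case: eqP => [->//|_]; rewrite topE lerDl ltW// side_gt0.
have face0 i : leb (face i) = 0.
  by apply: (@box_face0 _ _ _ _ i) => //; rewrite mxE eqxx.
pose N j : set (lebesgue_type R n) := [set y | exists i : 'I_n, i = j :> nat /\ face i y].
have NE j : N j = set0 \/ exists i, N j = face i.
  have [jn|jn] := ltnP j n; [right; exists (Ordinal jn)|left].
    apply/seteqP; split=> y; last by exists (Ordinal jn).
    by move=> [i [ij]]; rewrite (_ : i = Ordinal jn)//; exact: val_inj.
  apply/seteqP; split => // y [i [ij _]]; move: (ltn_ord i).
  by rewrite ij ltnNge jn.
have mN j : measurable (N j).
  by case: (NE j) => [->|[i ->]]; [exact: measurable0|exact: measurable_box].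
have N0 j : leb (N j) = 0.
  by case: (NE j) => [->|[i ->]]; [exact: measure0|exact: face0].
apply/eqP; rewrite eq_le measure_ge0 andbT.
apply: (@le_trans _ _ (\sum_(0 <= j <oo) leb (N j))); last first.
  by rewrite eseries0// => j _ _; rewrite N0.
apply: measure_sigma_subadditive => //.
  by apply: measurableD => //; rewrite cubeE; exact: measurable_box.
move=> y [yQ ycell]; have [i yi] : exists i, ~ (y ord0 i < top ord0 i)%R.
  apply/not_existsP => H; apply: ycell; rewrite dyadic_cellE => i.
  have /andP[-> _] := yQ i; have := H i; rewrite topE => /contrapT ->.
  by [].
exists i => //; exists i; split => // j.
have := yQ j; rewrite -topE => /andP[h1 ->]; rewrite andbT mxE.
by case: eqP => [->|//]; move/negP: yi; rewrite -leNgt.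
Qed.

Lemma mass_dyadic_cell (f : Rn -> R) k x : @density _ (lebesgue_type R n) R f ->
  mass leb f (cell dyadic_key k x) = mass leb f (cube_at (corner k x) (side k)).
Proof.
move=> df; have mc := dyadic_grid.1 k x.
have mq : measurable (cube_at (corner k x) (side k) : set (lebesgue_type R n)).
  exact: measurable_cube.
rewrite [RHS](mass_setID leb mq mc df) (setIidr (@dyadic_sub_cube k x)).
rewrite [X in _ + X](_ : _ = 0) ?adde0//.
rewrite /mass (ge0_negligible_integral (measurableD mq mc) (measurableD mq mc))//.
- by rewrite setDv integral_set0.
- exact: density_measE.
- by move=> y _; rewrite lee_fin df.2.
- exact: dyadic_cube_null.
Qed.

Lemma lebesgue_dyadic_cell k x :
  leb (cell dyadic_key k x) = (side k ^+ n * unit_volume R n)%:E.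
Proof.
rewrite -(lebesgue_cube (corner k x) (side_gt0 k)).
have := @mass_dyadic_cell (fun=> 1%R) k x (@density_cst _ (lebesgue_type R n) R 1%R ler01).
rewrite !mass_cst//; [by rewrite !mul1e|exact: measurable_cube|].
exact: dyadic_grid.1.
Qed.

Lemma dyadic_enlarge k x y i : cell dyadic_key k x y ->
  (x ord0 i - side k <= y ord0 i <= x ord0 i + side k)%R.
Proof.
move=> yx; have := yx; rewrite dyadic_cellE => /(_ i) /andP[y1 y2].
have := cell_refl dyadic_key k x; rewrite dyadic_cellE => /(_ i) /andP[x1 x2].
by apply/andP; split; lra.
Qed.

Let enlarged_volume (s : Rn * Rn) k : R :=
  (\prod_i (s.2 ord0 i - s.1 ord0 i + 2 * side k))%R.

Let enlarged_volume_cvg s : enlarged_volume s k @[k --> \oo] --> box_volume s.1 s.2.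
Proof.
rewrite /enlarged_volume /box_volume; elim: (index_enum _) => [|i r IHr].
  by rewrite big_nil; under eq_fun do rewrite big_nil; exact: cvg_cst.
rewrite big_cons; under eq_fun do rewrite big_cons; apply: cvgM => //.
rewrite -[X in _ --> X]addr0; apply: cvgD; first exact: cvg_cst.
by rewrite -[X in _ --> X](mulr0 2%R); apply: cvgM side_cvg0; exact: cvg_cst.
Qed.

(** The outer measure is computed by covers with boxes [s]. The cells of
    generation [k] that meet [A] inside [s] lie in [s] enlarged by their
    side, and on their union [u] has mass at most [t] times the volume. The
    side tends to zero with [k]. *)
Lemma mass_sparse_averages (u : Rn -> R) (t : R) (A : set (lebesgue_type R n)) :
  @density _ (lebesgue_type R n) R u -> (0 < t)%R -> measurable A ->
  (forall k x, A x ->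
    mass leb u (cell dyadic_key k x) <= t%:E * leb (cell dyadic_key k x)) ->
  mass leb u A <= t%:E * leb A.
Proof.
move=> du t0 mA Au; have gr := dyadic_grid.
rewrite /lebesgue_Rn -ereal_inf_pZl//; apply: le_ereal_inf_tmp.
move=> _ [_ [S [cS Sle AS] <-] <-].
have -> : \esum_(s in S) (box_volume s.1 s.2)%:E =
    \esum_(s in S) `|(box_volume s.1 s.2)%:E|.
  apply: eq_esum => s Ss; rewrite gee0_abs// lee_fin box_volume_ge0//.
  exact: Sle.
apply: le_trans (le_esumZ _ (ltW t0) _) => //.
apply: (@mass_le_esum_cover _ _ R leb _ S (fun s => box s.1 s.2)) => //.
  by move=> s; exact: measurable_box.
move=> s Ss; rewrite gee0_abs; last by rewrite lee_fin box_volume_ge0//; exact: Sle.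
have bound k : mass leb u (A `&` box s.1 s.2) <= (t * enlarged_volume s k)%:E.
  pose O : set (lebesgue_type R n) :=
    [set y | exists2 x, (A `&` box s.1 s.2) x & cell dyadic_key k x y].
  have Ocell y : O y -> cell dyadic_key k y `<=` [set z | O z /\ k = k].
    by move=> [x Ax xy] z zy; split => //; exists x => //; exact: etrans zy xy.
  have mO : measurable O := stopping_measurable gr Ocell.
  have Oe y : O y -> box (\row_i (s.1 ord0 i - side k))%R
      (\row_i (s.2 ord0 i + side k))%R y.
    move=> [x [_ xs] xy] i; rewrite !mxE; have /andP[s1 s2] := xs i.
    by have /andP[x1 x2] := dyadic_enlarge i xy; apply/andP; split; lra.
  apply: (@le_trans _ _ (mass leb u O)).
    apply: le_mass_set => //; first by apply: measurableI => //; exact: measurable_box.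
    by move=> y Ay; exists y.
  have dt : @density _ (lebesgue_type R n) R (fun=> t).
    by apply: density_cst; exact: ltW.
  apply: (@le_trans _ _ (mass leb (fun=> t) O)).
    apply: (le_mass_stopping gr du dt Ocell) => y [x [Ax xs] xy].
    rewrite (cell_eq xy) mass_cst ?(ltW t0)//; last exact: gr.1.
    exact: Au.
  rewrite mass_cst ?(ltW t0)// EFinM lee_pmul2l//.
  apply: (@le_trans _ _ (leb (box (\row_i (s.1 ord0 i - side k))%R
      (\row_i (s.2 ord0 i + side k))%R))).
    by apply: le_measure; rewrite ?inE//; exact: measurable_box.
  apply: (le_trans (lebesgue_outer_box _)).
    move=> i; rewrite !mxE; have := Sle s Ss i; have := side_gt0 k; lra.
  rewrite lee_fin /box_volume /enlarged_volume le_eqVlt; apply/orP; left.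
  by apply/eqP; apply: eq_bigr => i _; rewrite !mxE; ring.
have fin : mass leb u (A `&` box s.1 s.2) \is a fin_num.
  rewrite ge0_fin_numE ?mass_ge0//.
  exact: le_lt_trans (bound 0%N) (ltry _).
rewrite -EFinM -(fineK fin) lee_fin.
have cvgt : (t * enlarged_volume s k)%R @[k --> \oo] --> (t * box_volume s.1 s.2)%R.
  by apply: cvgM; [exact: cvg_cst|exact: enlarged_volume_cvg].
rewrite -(cvg_lim _ cvgt)//; apply: limr_ge; first by apply/cvg_ex; eexists; exact: cvgt.
by apply: nearW => k; rewrite -lee_fin (fineK fin).
Qed.

(** On a bounded set where [3 / 2 * t <= u] while all the averages are at most
    [t], [mass_sparse_averages] gives two incompatible bounds of the mass of [u],
    unless the set is null. If the conclusion fails at [x], a rational [t]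
    fits between [u x / 2] and [2 / 3 * u x]. *)
Lemma dyadic_differentiation (u : Rn -> R) :
  @density _ (lebesgue_type R n) R u -> (forall x, (0 < u x)%R) ->
  {ae leb, forall x, exists k,
    (u x)%:E * leb (cell dyadic_key k x) <= 2%:E * mass leb u (cell dyadic_key k x)}.
Proof.
move=> du u0; have gr := dyadic_grid.
pose P k (t : R) := [set x : lebesgue_type R n |
  mass leb u (cell dyadic_key k x) <= t%:E * leb (cell dyadic_key k x)].
pose A (t : R) (N : nat) : set (lebesgue_type R n) :=
  \bigcap_k P k t `&` [set x | (3 / 2 * t <= u x)%R] `&`
  cube_at (\row_i (- N%:R))%R (2 * N%:R)%R.
have mA t N : measurable (A t N).
  apply: measurableI; last exact: measurable_cube.
  apply: measurableI; last by apply: measurable_le_set => //; exact: du.1.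
  apply: bigcap_measurable => // k _.
  apply: (@adapted_cell_sets _ _ _ _ gr k) => x Px y xy.
  by rewrite /P /= (cell_eq xy).
have A0 t N : (0 < t)%R -> leb (A t N) = 0.
  move=> t0; have Afin : leb (A t N) < +oo.
    apply: (@le_lt_trans _ _ (leb (cube_at (\row_i (- N%:R))%R (2 * N%:R + 1)%R))).
      apply: le_measure; rewrite ?inE//; first exact: measurable_cube.
      by move=> x [_ xN] i; have /andP[h1 h2] := xN i; rewrite h1/= (le_trans h2)//; lra.
    rewrite lebesgue_cube; first exact: ltry.
    by apply: ltr_wpDl => //; exact: mulr_ge0.
  have uA : mass leb u (A t N) <= t%:E * leb (A t N).
    apply: mass_sparse_averages => // k x [[Px _] _]; exact: Px.
  have : (3 / 2 * t)%:E * leb (A t N) <= mass leb u (A t N).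
    rewrite -mass_cst//; last by rewrite mulr_ge0 ?ltW//; lra.
    apply: le_mass => //; last by move=> x [[_ ux] _].
    by apply: density_cst; rewrite mulr_ge0 ?ltW//; lra.
  move=> /le_trans/(_ uA).
  have Af : leb (A t N) \is a fin_num by rewrite ge0_fin_numE// measure_ge0.
  rewrite -(fineK Af) -!EFinM lee_fin => H; congr EFin.
  have f0 : (0 <= fine (leb (A t N)))%R by rewrite fine_ge0// measure_ge0.
  by apply/eqP; rewrite eq_le f0 andbT; nra.
(* An enumeration of the rational numbers. *)
pose q (j : nat) : R := ratr (odflt 0%Q (unpickle j)).
have : leb.-negligible (\bigcup_j \bigcup_N
    (if (0 < q j)%R then A (q j) N else set0)).
  apply: negligible_bigcup => j; apply: negligible_bigcup => N.
  case: ifP => [qj|_]; last exact: negligible_set0.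
  by apply/negligibleP; [exact: mA|exact: A0].
apply: negligibleS => x /= /forallNP xbad.
have bad k : (2%:E * mass leb u (cell dyadic_key k x) <
    (u x)%:E * leb (cell dyadic_key k x)).
  by rewrite ltNge; apply/negP; exact: xbad.
have [r] : exists r : rat, ratr r \in `](u x / 2), (u x * (2 / 3))[%R.
  by apply: rat_in_itvoo; have := u0 x; lra.
rewrite in_itv/= => /andP[r1 r2].
have r0 : (0 < ratr r :> R)%R by apply: lt_trans r1; rewrite divr_gt0.
have [N xN] : exists N : nat, forall i, (`|x ord0 i| <= N%:R)%R.
  exists (\max_i Num.bound `|x ord0 i|%R)%N => i.
  apply: (@le_trans _ _ (Num.bound `|x ord0 i|%R)%:R)%R.
    by apply: ltW; apply: archi_boundP.
  by rewrite ler_nat; exact: leq_bigmax.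
exists (pickle r) => //; exists N => //.
have -> : q (pickle r) = ratr r by rewrite /q pickleK.
rewrite r0; split; [split|].
- move=> k _; rewrite /P /=; have := bad k.
  have cf : leb (cell dyadic_key k x) \is a fin_num by rewrite lebesgue_dyadic_cell.
  have uf : mass leb u (cell dyadic_key k x) \is a fin_num.
    rewrite ge0_fin_numE ?mass_ge0//.
    rewrite ltNge leye_eq; apply/negP => /eqP uoo.
    by have := bad k; rewrite uoo mulry gtr0_sg// mul1e ltNge leey.
  rewrite -(fineK cf) -(fineK uf) -!EFinM lte_fin lee_fin => H.
  have c0 : (0 <= fine (leb (cell dyadic_key k x)))%R by rewrite fine_ge0.
  have : (u x / 2 * fine (leb (cell dyadic_key k x)) <=
    ratr r * fine (leb (cell dyadic_key k x)))%R by rewrite ler_wpM2r// ltW.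
  by move: H; set M := fine (leb _); set U := fine _; lra.
- by rewrite /=; lra.
- move=> i; rewrite mxE; have := xN i; rewrite ler_norml => /andP[-> ?] /=; lra.
Qed.

End DyadicGrid.

(** * The one-third trick *)

Section OneThird.
Context (R : realType) (n : nat).
Local Notation Rn := 'rV[R]_n.
Implicit Types (L l : R).

Lemma expn2_third k : exists j : nat, (2 ^ k = 3 * j + 1 \/ 2 ^ k = 3 * j + 2)%N.
Proof.
elim: k => [|k [j [jk|jk]]]; first by exists 0%N; left.
  by exists (2 * j)%N; right; rewrite expnS jk; ring.
by exists (2 * j + 1)%N; left; rewrite expnS jk; ring.
Qed.

(** The number [2 ^ k / 3] is at distance [1 / 3] from the integers, so that an
    interval shorter than [1 / 3] cannot meet both the integers and their
    translate by [2 ^ k / 3]. *)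
Lemma floor_one_third k (z h : R) : (0 < h)%R -> (3 * h < 1)%R ->
  Num.floor z = Num.floor (z + h) \/
  Num.floor (z - 2 ^+ k / 3) = Num.floor (z + h - 2 ^+ k / 3).
Proof.
move=> h0 h3; have [eq|neq] := eqVneq (Num.floor z) (Num.floor (z + h)).
  by left.
right; set N := Num.floor (z + h).
have zN : (z < N%:~R)%R.
  rewrite -floor_lt_int lt_neqAle neq /= floor_ge_int.
  by apply: le_trans (floor_le _) _; rewrite lerDl ltW.
have Nz : (N%:~R <= z + h)%R by exact: floor_le.
have [j jk] := expn2_third k.
have [r [r1 r2 rE]] : exists r : R, [/\ (3^-1 <= r)%R, (r <= 2 / 3)%R &
    (2 ^+ k / 3 = j%:R + r)%R].
  have E : (2 ^+ k = (2 ^ k)%:R :> R)%R by rewrite natrX.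
  case: jk => jk; [exists 3^-1%R|exists (2 / 3)%R]; split; rewrite ?E ?jk ?natrD ?natrM; lra.
have E : ((N - j%:Z - 1)%:~R = N%:~R - j%:R - 1 :> R)%R by rewrite !intrB.
have E2 : ((N - j%:Z - 1 + 1)%:~R = N%:~R - j%:R :> R)%R by rewrite subrK intrB.
transitivity (N - j%:Z - 1)%R.
  apply/eqP; rewrite floor_eq E E2 rE; apply/andP; split; lra.
apply/esym/eqP; rewrite floor_eq E E2 rE; apply/andP; split; lra.
Qed.

Definition third_offset L (e : {ffun 'I_n -> bool}) : Rn :=
  (\row_i if e i then L / 3 else 0)%R.

(** Take the first generation whose cells have side at most [6 * l]; their side
    is more than [3 * l]. In each coordinate one of the two offsets keeps the
    cube away from the cell boundaries. *)
Lemma one_third L (c : Rn) l : (0 < l)%R -> (3 * l < L)%R ->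
  exists e k, (forall x, cube_at c l x ->
      cube_at c l `<=` cell (dyadic_key L (third_offset L e)) k x) /\
    (side L k <= 6 * l)%R.
Proof.
move=> l0 lL; have L0 : (0 < L)%R by lra.
have exk : exists k, (side L k <= 6 * l)%R.
  have [//|k _ Hk] := @cvgr_le _ _ _ _ _ _ (@side_cvg0 R L) (6 * l)%R.
    by rewrite mulr_gt0.
  by exists k; apply: Hk => /=.
case: (ex_minnP exk) => k kl kmin.
have sk0 : (0 < side L k)%R by exact: side_gt0.
have hk : (3 * l < side L k)%R.
  case: k kl kmin sk0 => [|k] kl kmin sk0; first by rewrite /side expr0 mulr1.
  have : ~~ (side L k <= 6 * l)%R.
    by apply/negP => /kmin; rewrite ltnn.
  by rewrite -ltNge /side exprS; lra.
pose z i := (c ord0 i / side L k)%R.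
pose h := (l / side L k)%R.
have h0 : (0 < h)%R by rewrite divr_gt0.
have h3 : (3 * h < 1)%R by rewrite mulrA ltr_pdivrMr// mul1r.
pose e : {ffun 'I_n -> bool} := [ffun i => Num.floor (z i) != Num.floor (z i + h)%R].
have off i : (third_offset L e ord0 i / side L k = if e i then 2 ^+ k / 3 else 0)%R.
  rewrite mxE; case: ifP => _; last by rewrite mul0r.
  rewrite /side exprVn; field; rewrite gt_eqF ?exprn_gt0//=.
  by rewrite gt_eqF.
have fe i : Num.floor ((c ord0 i - third_offset L e ord0 i) / side L k) =
    Num.floor ((c ord0 i + l - third_offset L e ord0 i) / side L k).
  rewrite !mulrBl mulrDl off -/(z i) -/h {1 2}/e !ffunE.
  case: eqVneq => [E|ne] /=; first by rewrite !subr0.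
  by have [E|//] := floor_one_third k (z i) h0 h3; rewrite E eqxx in ne.
exists e, k; split => // x xQ y yQ; apply/ffunP => i; rewrite !ffunE.
have key_const w : cube_at c l w ->
    Num.floor ((w ord0 i - third_offset L e ord0 i) / side L k) =
    Num.floor ((c ord0 i - third_offset L e ord0 i) / side L k).
  move=> /(_ i) /andP[w1 w2]; apply/eqP; rewrite eq_le; apply/andP; split.
    by rewrite fe; apply: le_floor; rewrite ler_pM2r ?invr_gt0// lerB.
  by apply: le_floor; rewrite ler_pM2r ?invr_gt0// lerB.
by rewrite (key_const y)// (key_const x).
Qed.

End OneThird.

(** * The mixed inequality for A1 and A-infinity densities *)

Section MassPositive.
Context d (T : measurableType d) (R : realType) (m : {measure set T -> \bar R}).

Lemma mass_gt0 (f : T -> R) (A : set T) : density f -> measurable A ->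
  (forall x, 0 < f x)%R -> 0 < m A -> 0 < mass m f A.
Proof.
move=> df mA f0 A0; rewrite lt_neqAle mass_ge0// andbT eq_sym.
apply/eqP => fA0; pose F j := A `&` [set x | (j.+1%:R^-1 <= f x)%R].
have mF j : measurable (F j).
  by apply: measurableI => //; apply: measurable_le_set => //; exact: df.1.
have F0 j : m (F j) = 0.
  have : (j.+1%:R^-1)%:E * m (F j) <= 0.
    rewrite -mass_cst// -fA0; apply: (@le_trans _ _ (mass m f (F j))).
      by apply: le_mass => // x [].
    by apply: le_mass_set => // x [].
  have jp : 0 < (j.+1%:R^-1 : R)%:E by rewrite lte_fin invr_gt0.
  rewrite pmule_rle0// => mF0; apply/eqP.
  by rewrite eq_le mF0 measure_ge0.
have : m A <= \sum_(0 <= j <oo) m (F j).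
  apply: measure_sigma_subadditive => // x Ax.
  exists (Num.bound (f x)^-1) => //; split => //=.
  rewrite -[leRHS]invrK lef_pV2 ?posrE ?invr_gt0//.
  have := archi_boundP (ltW (_ : 0 < (f x)^-1)%R); rewrite invr_gt0 f0 => /(_ isT).
  by move=> /ltW/le_trans; apply; rewrite ler_nat.
by rewrite eseries0 ?leNgt ?A0// => j _ _.
Qed.

Lemma ae_point (P : T -> Prop) (A : set T) : measurable A -> 0 < m A ->
  {ae m, forall x, A x -> P x} -> exists2 x, A x & P x.
Proof.
move=> mA A0 AP; apply: contrapT => nP.
have : m.-negligible A.
  apply: negligibleS AP => x Ax /= H; apply: nP; exists x => //; exact: H.
by move=> /(negligibleP m mA) H; rewrite H ltxx in A0.
Qed.

Lemma ae_imp (P Q : T -> Prop) : {ae m, forall x, P x} ->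
  (forall x, P x -> Q x) -> {ae m, forall x, Q x}.
Proof. by move=> mP PQ; apply: filterS mP. Qed.

Lemma ae_imp2 (P Q S : T -> Prop) : {ae m, forall x, P x} -> {ae m, forall x, Q x} ->
  (forall x, P x -> Q x -> S x) -> {ae m, forall x, S x}.
Proof. by move=> mP mQ PQS; apply: filterS2 mP mQ. Qed.

End MassPositive.

Section GridWeights.
Context d (T : measurableType d) (R : realType) (I : countType).
Variables (key : nat -> T -> I) (m : {measure set T -> \bar R}).
Hypothesis hgrid : grid key.
Local Notation cell := (cell key).
Local Notation vol := (cell_mass key m (fun=> 1%R)).
Variable D : R.
Hypothesis D_ge1 : (1 <= D)%R.
Hypothesis volume_cell : forall k x, 0 < m (cell k x) < +oo.
Hypothesis volume_doubling : forall k x, m (cell k x) <= D%:E * m (cell k.+1 x).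

Definition pos_density (w : T -> R) := density w /\ forall x, (0 < w x)%R.

Lemma pos_density1 : pos_density (fun=> 1%R).
Proof. by split => //; apply: density_cst. Qed.

Lemma pos_densityM w w' : pos_density w -> pos_density w' ->
  pos_density (fun x => w x * w' x)%R.
Proof.
by move=> [dw w0] [dw' w'0]; split => [|x]; [exact: densityM|rewrite mulr_gt0].
Qed.

Lemma pos_density_powR w (r : R) : pos_density w -> pos_density (fun x => w x `^ r)%R.
Proof.
by move=> pw; split => [|x]; [exact: density_powR pw.1|apply: powR_gt0; exact: pw.2].
Qed.

Definition grid_A1 (w : T -> R) (C : R) := {ae m, forall x, forall k,
  mass m w (cell k x) <= (C * w x)%:E * m (cell k x)}.

Let mcell k x : measurable (cell k x). Proof. exact: hgrid.1. Qed.

Let D_gt0 : (0 < D)%R. Proof. exact: lt_le_trans D_ge1. Qed.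

Let mass1 k x : mass m (fun=> 1%R) (cell k x) = m (cell k x).
Proof. by rewrite mass_cst// mul1e. Qed.

Let cell1 k x : 0 < mass m (fun=> 1%R) (cell k x) < +oo.
Proof. by rewrite mass1. Qed.

Let volE k x : m (cell k x) = (vol k x)%:E.
Proof. by rewrite -mass1 (cell_massE pos_density1.1)//; case/andP: (cell1 k x). Qed.

Let vol_gt0 k x : (0 < vol k x)%R.
Proof. by rewrite -lte_fin -volE; case/andP: (volume_cell k x). Qed.

Let vol_doubling k x : (vol k x <= D * vol k.+1 x)%R.
Proof. by rewrite -lee_fin EFinM -!volE. Qed.

Lemma pos_cell w k x : pos_density w -> 0 < mass m w (cell k x).
Proof.
by move=> [dw w0]; apply: mass_gt0 => //; case/andP: (volume_cell k x).
Qed.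

Lemma grid_A1_cell w C k x : pos_density w -> grid_A1 w C ->
  0 < mass m w (cell k x) < +oo.
Proof.
move=> pw wA1; rewrite pos_cell//=.
have [y yx wy] : exists2 y, cell k x y &
    mass m w (cell k x) <= (C * w y)%:E * m (cell k x).
  apply: (@ae_point _ _ _ m) (mcell k x) _ _; first by case/andP: (volume_cell k x).
  by apply: filterS wA1 => y /(_ k) + yx; rewrite (cell_eq yx).
by apply: le_lt_trans wy _; rewrite volE -EFinM ltry.
Qed.

Lemma grid_A1_real w C : pos_density w -> grid_A1 w C ->
  {ae m, forall x, forall k, (cell_mass key m w k x <= C * w x * vol k x)%R}.
Proof.
move=> pw wA1; apply: filterS (wA1) => x wx k; have := wx k.
rewrite volE (cell_massE pw.1) ?lee_fin//.
by case/andP: (grid_A1_cell k x pw wA1).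
Qed.

(** The [A1] bound of the larger cell, averaged over the smaller one. *)
Lemma grid_A1_doubling w C k x : (0 < C)%R -> pos_density w -> grid_A1 w C ->
  (cell_mass key m w k x <= C * D * cell_mass key m w k.+1 x)%R.
Proof.
move=> C0 pw wA1; have dw := pw.1.
have cw0 : (0 <= cell_mass key m w k x)%R by exact: cell_mass_ge0.
have Cv0 : (0 <= C * vol k x)%R by rewrite mulr_ge0// ltW.
have : mass m (fun=> cell_mass key m w k x) (cell k.+1 x) <=
    mass m (fun y => C * vol k x * w y)%R (cell k.+1 x).
  apply: ae_le_mass => //; first exact: densityZ.
  apply: filterS (grid_A1_real pw wA1) => y /(_ k) wy yx.
  have yx' : cell k x y := cell_nested hgrid (leqnSn k) yx.
  rewrite -(cell_mass_adapted m w yx') mulrAC.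
  by rewrite -(cell_mass_adapted m (fun=> 1%R) yx').
rewrite mass_cst// massZ// volE (cell_massE dw); last first.
  by case/andP: (grid_A1_cell k.+1 x pw wA1).
rewrite -!EFinM lee_fin => H; rewrite -(ler_pM2r (vol_gt0 k.+1 x)).
apply: le_trans H _; rewrite [leRHS]mulrAC ler_wpM2r ?cell_mass_ge0//.
by rewrite -mulrA ler_pM2l.
Qed.

(** Both densities are taken with respect to the underlying measure: the [A1]
    property of [V] gives [small_values], that of [u] gives the decay. *)
Lemma mixed_A1_A1 u V g Cu Cv : pos_density u -> pos_density V ->
  density g -> (1 <= Cu)%R -> (0 < Cv)%R -> grid_A1 u Cu -> grid_A1 V Cv ->
  {ae m, forall x, exists k,
    (u x)%:E * m (cell k x) <= 2%:E * mass m u (cell k x)} ->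
  mass m (fun y => V y * u y)%R
    [set y | exists k, (V y < average key m (fun=> 1%R) g k y)%R] <=
  (weak_constant D Cu 1 Cv (decay_exponent D Cu) (decay_constant D Cu))%:E *
    mass m (fun y => g y * u y)%R [set: T].
Proof.
move=> pu pV dg Cu1 Cv0 uA1 VA1 udiff.
have Cu0 : (0 < Cu)%R by lra.
have r1 := pos_density1.
have w1 (w : T -> R) : (fun y => w y * 1)%R = w.
  by apply/funext => y; rewrite mulr1.
have exp01 : (0 < decay_exponent D Cu <= 1)%R.
  have D1 : (1 <= D * Cu)%R by rewrite mulr_ege1.
  rewrite /decay_exponent divr_gt0 ?invr_gt0 ?mulr_gt0//=.
  by rewrite -invfM invf_le1 ?mulr_gt0//; lra.
have Vu : (fun y => V y * u y)%R = (fun y => V y * (u y * 1))%R.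
  by apply/funext => y; rewrite mulr1.
have gu : (fun y => g y * u y)%R = (fun y => g y * (u y * 1))%R.
  by apply/funext => y; rewrite mulr1.
have d1 := r1.1.
have [dV V0] := pV; have [du u0] := pu.
have Vcell k x : 0 < mass m (fun y => V y * 1)%R (cell k x) < +oo.
  by rewrite w1; exact: grid_A1_cell VA1.
have ucell k x : 0 < mass m (fun y => u y * 1)%R (cell k x) < +oo.
  by rewrite w1; exact: grid_A1_cell uA1.
have Vreal : {ae m, forall x, forall k,
    (cell_mass key m (fun y => V y * 1) k x <= Cv * V x * vol k x)%R}.
  by rewrite w1; exact: grid_A1_real.
have ureal : {ae m, forall x, forall k,
    (cell_mass key m (fun y => u y * 1) k x <= Cu * u x * vol k x)%R}.
  by rewrite w1; exact: grid_A1_real.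
rewrite Vu gu.
apply: (@mixed_weak_type_small_values _ _ _ _ key m hgrid (fun=> 1%R) V) => //.
- by rewrite ltr_pwDl// mulr_ge0 ?powR_ge0.
- by apply: small_values_A1.
- apply: (A1_decay hgrid) => //.
  rewrite w1; apply: filterS (udiff) => x [k ux]; exists k; move: ux.
  rewrite volE (cell_massE pu.1) ?lee_fin//.
  by case/andP: (grid_A1_cell k x pu uA1).
Qed.

(** Averages are taken with respect to [b] and the other density is constant,
    so that its decay is trivial; the doubling of [b] comes from its [A1]
    property. *)
Lemma mixed_Ainfty b V g Cb s K : pos_density b -> pos_density V ->
  density g -> (0 < Cb)%R -> (0 < s)%R -> (0 < K)%R -> grid_A1 b Cb ->
  (forall k x, mass m (fun y => V y * b y)%R (cell k x) < +oo) ->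
  small_values key m b V s K ->
  mass m (fun y => V y * b y)%R
    [set y | exists k, (V y < average key m b g k y)%R] <=
  (weak_constant (Cb * D) 1 s K 1 1)%:E * mass m (fun y => g y * b y)%R [set: T].
Proof.
move=> pb pV dg Cb0 s0 K0 bA1 Vfin VsK.
have r1 := pos_density1.
have b1 : (fun y => 1 * b y)%R = b by apply/funext => y; rewrite mul1r.
have bcell k x : 0 < mass m b (cell k x) < +oo by exact: grid_A1_cell bA1.
have d1 := r1.1.
have [dV V0] := pV; have [db b0] := pb.
rewrite -{1 3}b1.
apply: (@mixed_weak_type_small_values _ _ _ _ key m hgrid b V _ _ _ _ _ (fun=> 1%R)) => //.
- by move=> k x; rewrite Vfin pos_cell//; exact: pos_densityM.
- exact: mulr_gt0.
- by rewrite ltr01 lexx.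
- by rewrite b1.
- by move=> k x; exact: grid_A1_doubling.
- by apply: aeW => x k; rewrite b1 !mul1r.
- move=> k x z A mA Ax z0; rewrite b1 mul1r powRr1 ?(ltW z0)// EFinM.
  rewrite (cell_massE pb.1)//.
  by case/andP: (bcell k x).
Qed.

End GridWeights.

(** * From extended weights to densities *)

Section Transfer.
Context d (T : measurableType d) (R : realType) (m : {measure set T -> \bar R}).

(** The set [E] need not be measurable: the integral over it is a supremum over
    simple functions, all of which lie below the density of [H] made infinite
    on a null set. *)
Lemma integral_le_mass (w : T -> \bar R) (f : T -> R) (E H : set T) :
  measurable H -> density f -> {ae m, forall x, w x = (f x)%:E} ->
  {ae m, forall x, E x -> H x} -> \int[m]_(x in E) w x <= mass m f H.
Proof.
move=> mH df wf EH.
have [N [mN N0 subN]] : m.-negligible (~` [set x | w x = (f x)%:E /\ (E x -> H x)]).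
  by apply: filterS2 wf EH => x; split.
pose F x : \bar R := if x \in N then +oo else (\1_H x * f x)%:E.
have F0 x : 0 <= F x.
  by rewrite /F; case: ifP => // _; rewrite lee_fin mulr_ge0// df.2.
have wF x : (w \_ E)^\+ x <= F x.
  rewrite /F; case: ifPn => [_|xN]; first exact: leey.
  have [wx EHx] : w x = (f x)%:E /\ (E x -> H x).
    apply: contrapT => H'; move/negP: xN; apply; rewrite inE; exact: subN.
  rewrite funeposE /patch; case: ifPn => xE; last first.
    by rewrite maxxx lee_fin mulr_ge0// df.2.
  move: xE; rewrite inE => /EHx Hx; rewrite wx ge_max indicE mem_set// mul1r lexx.
  by rewrite lee_fin df.2.
apply: (@le_trans _ _ (\int[m]_x F x)).
  rewrite integralE; apply: (@le_trans _ _ (\int[m]_(x in E) w^\+ x)).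
    by rewrite -[leRHS]adde0 leeD2l// oppe_le0 integral_ge0.
  rewrite !ge0_integralE//; apply: ge_ereal_sup => _ [h hle <-].
  apply: ereal_sup_ubound; exists h => //= x.
  by apply: le_trans (hle x) _; rewrite patch_setT -funepos_restrict; exact: wF.
have mF : measurable_fun [set: T] F.
  apply: measurable_fun_if => //.
  - apply: (measurable_fun_bool true).
    by rewrite setTI (_ : _ @^-1` _ = N)//; apply/seteqP; split => x /=; [move/set_mem|move/mem_set].
  - apply/measurable_EFinP; apply: measurable_funTS.
    by apply: measurable_funM df.1; exact: measurable_indic.
have -> : mass m f H = mass m (fun x => \1_H x * f x)%R [set: T].
  by rewrite mass_indic// setTI.
have d1 : density (fun x => \1_H x * f x)%R.
  by apply: densityM => //; exact: density_indic.
rewrite le_eqVlt; apply/orP; left; apply/eqP; apply: ae_eq_integral => //.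
  exact: density_measE.
exists N; split => // x /= Hx; apply: contrapT => xN; apply: Hx => _.
by rewrite /F memNset.
Qed.

Lemma pos_representative (w : T -> \bar R) : measurable_fun [set: T] w ->
  {ae m, forall x, 0 < w x < +oo} ->
  exists2 w0 : T -> R, pos_density w0 & {ae m, forall x, w x = (w0 x)%:E}.
Proof.
move=> mw wpos; pose b x := 0 < w x < +oo.
pose w0 x : R := if b x then fine (w x) else 1%R.
exists w0; last first.
  apply: filterS wpos => x wx; rewrite /w0 /b wx fineK//.
  by have /andP[w1 w2] := wx; rewrite ge0_fin_numE// ltW.
split; last first.
  move=> x; rewrite /w0; case: ifP => // bx; exact: fine_gt0.
split; last first.
  move=> x; rewrite /w0; case: ifP => // /andP[b1 b2].
  by rewrite fine_ge0// ltW.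
have mb : measurable_fun [set: T] b.
  apply: measurable_and; apply: measurable_fun_lte => //.
apply: measurable_fun_if => //.
apply: measurable_funTS.
exact: (measurableT_comp (fine_measurable measurableT)).
Qed.

Lemma ess_inf_average (W : T -> \bar R) (w : T -> R) (Q : set T) (C M : R) (X : \bar R) :
  (0 < M)%R -> (0 < C)%R -> {ae m, forall x, W x = (w x)%:E} ->
  M%:E^-1 * X <= C%:E * ess_inf m (patch (cst +oo) Q W) ->
  {ae m, forall x, Q x -> X <= (C * w x)%:E * M%:E}.
Proof.
move=> M0 C0 Ww H; apply: filterS2 Ww (ess_inf_le m (patch (cst +oo) Q W)) => x Wx Ix Qx.
have {}H : M%:E^-1 * X <= (C * w x)%:E.
  apply: (le_trans H); rewrite EFinM lee_pmul2l//.
  by apply: (le_trans Ix); rewrite /patch mem_set// Wx.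
rewrite muleC -lee_pdivrMl//.
by move: H; rewrite inver gt_eqF.
Qed.

Lemma Ar_split (r C M : R) (X Y : \bar R) : (1 < r)%R -> (0 < C)%R -> (0 < M)%R ->
  0 < X -> 0 < Y -> (M%:E^-1 * X) * (M%:E^-1 * Y) `^ (r - 1) <= C%:E ->
  X < +oo /\ Y <= (M * (C * M / fine X) `^ (r - 1)^-1)%:E.
Proof.
move=> r1 C0 M0 X0 Y0; rewrite inver gt_eqF// => H.
have r0 : (0 < r - 1)%R by lra.
have M'0 : 0 < (M^-1)%:E by rewrite lte_fin invr_gt0.
have Xfin : X < +oo.
  rewrite ltey; apply/eqP => Xoo; move: H.
  by rewrite Xoo gt0_muley// gt0_mulye ?poweR_gt0 ?mule_gt0.
have Yfin : Y < +oo.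
  rewrite ltey; apply/eqP => Yoo; move: H.
  by rewrite Yoo gt0_muley// poweRyr ?gt_eqF// gt0_muley ?mule_gt0.
split => //.
have XE : X = (fine X)%:E by rewrite fineK// ge0_fin_numE// ltW.
have YE : Y = (fine Y)%:E by rewrite fineK// ge0_fin_numE// ltW.
have x0 : (0 < fine X)%R by rewrite -lte_fin -XE.
have y0 : (0 < fine Y)%R by rewrite -lte_fin -YE.
move: H; rewrite YE XE /=; move: (fine X) (fine Y) x0 y0 => x y x0 y0.
rewrite -!EFinM !lee_fin => H.
have h : ((M^-1 * y) `^ (r - 1) <= C * M / x)%R.
  rewrite ler_pdivlMr//; move: H; rewrite -mulrA ler_pdivrMl// mulrC.
  by rewrite [(M * _)%R]mulrC.
rewrite -ler_pdivrMl//.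
have e : ((M^-1 * y) `^ (r - 1) `^ (r - 1)^-1 = M^-1 * y)%R.
  by rewrite -powRrM mulfV ?gt_eqF// powRr1// mulr_ge0// ?invr_ge0 ltW.
rewrite -e ge0_ler_powR ?nnegrE ?powR_ge0 ?invr_ge0 ?(ltW r0)//.
by rewrite divr_ge0 ?mulr_ge0 ?ltW.
Qed.

(** Each of the three factors is at most the same power of the sum. *)
Lemma powR_le_sum3 (a c e x y z : R) : (0 < a)%R -> (0 <= c)%R -> (0 <= e)%R ->
  (a + c + e = 1)%R -> (0 <= x)%R -> (0 <= y)%R -> (0 <= z)%R ->
  (x `^ a * y `^ c * z `^ e <= x + y + z)%R.
Proof.
move=> a0 c0 e0 ace x0 y0 z0; set t := (x + y + z)%R.
have t0 : (0 <= t)%R by rewrite !addr_ge0.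
have [t_eq0|tn0] := eqVneq t 0%R.
  have -> : x = 0%R by move: t_eq0; rewrite /t => ?; lra.
  by rewrite powR0 ?gt_eqF// !mul0r.
rewrite -[leRHS](powRr1 t0) -ace !powRD ?tn0 ?implybT//.
have xt : (x <= t)%R by rewrite /t; lra.
have yt : (y <= t)%R by rewrite /t; lra.
have zt : (z <= t)%R by rewrite /t; lra.
apply: ler_pM; [by rewrite mulr_ge0 ?powR_ge0|exact: powR_ge0| |].
  apply: ler_pM; [exact: powR_ge0|exact: powR_ge0| |].
    by rewrite ge0_ler_powR ?nnegrE// ltW.
  by rewrite ge0_ler_powR ?nnegrE.
by rewrite ge0_ler_powR ?nnegrE.
Qed.

End Transfer.

(** * Averages of a product of powers *)

Section Reduction.
Context d (T : measurableType d) (R : realType) (I : countType).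
Variables (key : nat -> T -> I) (m : {measure set T -> \bar R}).
Hypothesis hgrid : grid key.
Local Notation cell := (cell key).

(** Hoelder's inequality with three factors, up to a constant: [powR_le_sum3] is
    applied to the functions divided by the bounds of their means. *)
Lemma mass_holder (P : set T) (f g F h : T -> R) (a c e p Ch K Z L : R) :
  measurable P -> density f -> density g -> density F -> density h ->
  (0 < a)%R -> (0 <= c)%R -> (0 <= e)%R -> (a + c + e = 1)%R ->
  (forall x, f x = g x `^ a * F x `^ c * h x `^ e)%R ->
  (0 < p)%R -> (0 < K)%R -> (0 < Z)%R -> (0 < L)%R ->
  mass m g P <= (L * p)%:E -> mass m F P <= K%:E -> mass m h P <= (Ch * Z * p)%:E ->
  mass m f P <= ((2 + Ch) * L `^ a * K `^ c * Z `^ e * p `^ (1 - c))%:E.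
Proof.
move=> mP df dg dF dh a0 c0 e0 ace fE p0 K0 Z0 L0 gP FP hP.
pose k := (L `^ a * K `^ c * Z `^ e * (p `^ c)^-1)%R.
have k0 : (0 <= k)%R by rewrite !mulr_ge0 ?invr_ge0 ?powR_ge0.
have L'0 : (0 <= L^-1)%R by rewrite invr_ge0 ltW.
have pK0 : (0 <= p / K)%R by rewrite divr_ge0 ?ltW.
have Z'0 : (0 <= Z^-1)%R by rewrite invr_ge0 ltW.
have d1 : density (fun x => L^-1 * g x)%R by exact: densityZ.
have d2 : density (fun x => p / K * F x)%R by exact: densityZ.
have d3 : density (fun x => Z^-1 * h x)%R by exact: densityZ.
have d12 := densityD d1 d2; have d123 := densityD d12 d3.
apply: (@le_trans _ _ (mass m (fun x =>
    k * (L^-1 * g x + p / K * F x + Z^-1 * h x))%R P)).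
  apply: le_mass => //; first exact: densityZ.
  move=> x _; rewrite fE.
  have -> : (g x `^ a * F x `^ c * h x `^ e = k *
      ((L^-1 * g x) `^ a * (p / K * F x) `^ c * (Z^-1 * h x) `^ e))%R.
    rewrite {1}(_ : g x = L * (L^-1 * g x))%R; last by rewrite mulVKf ?gt_eqF.
    rewrite {1}(_ : F x = K / p * (p / K * F x))%R; last first.
      by field; rewrite !gt_eqF.
    rewrite {1}(_ : h x = Z * (Z^-1 * h x))%R; last by rewrite mulVKf ?gt_eqF.
    have /= := d1.2 x; have /= := d2.2 x; have /= := d3.2 x.
    move: (L^-1 * g x)%R (p / K * F x)%R (Z^-1 * h x)%R => A B C C0 B0 A0.
    have p'0 : (0 <= p^-1)%R by rewrite invr_ge0 ltW.
    rewrite (powRM a (ltW L0) A0) (powRM c (divr_ge0 (ltW K0) (ltW p0)) B0).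
    rewrite (powRM e (ltW Z0) C0) (powRM c (ltW K0) p'0).
    have -> : (p^-1 `^ c = (p `^ c)^-1)%R.
      by rewrite -powRN -(powR_inv1 (ltW p0)) -powRrM mulN1r.
    by rewrite /k; ring.
  rewrite ler_wpM2l// powR_le_sum3//.
  - exact: d1.2.
  - exact: d2.2.
  - exact: d3.2.
rewrite massZ// (massD m mP d12 d3) (massD m mP d1 d2) !massZ//.
apply: (@le_trans _ _ (k%:E * (p%:E + p%:E + (Ch * p)%:E))).
  rewrite lee_wpmul2l ?lee_fin//; apply: leeD; first apply: leeD.
  - rewrite (_ : p = L^-1 * (L * p))%R; last by rewrite mulKf ?gt_eqF.
    by rewrite EFinM lee_wpmul2l.
  - rewrite {2}(_ : p = p / K * K)%R; last by rewrite divfK ?gt_eqF.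
    by rewrite (EFinM (p / K)) lee_wpmul2l.
  - rewrite (_ : Ch * p = Z^-1 * (Ch * Z * p))%R; last by field; rewrite gt_eqF.
    by rewrite EFinM lee_wpmul2l.
rewrite -!EFinD -EFinM lee_fin /k.
have -> : (p `^ (1 - c) = p * (p `^ c)^-1)%R.
  by rewrite powRB ?powRr1 ?(ltW p0)// (gt_eqF p0) implybT.
by rewrite le_eqVlt; apply/orP; left; apply/eqP; ring.
Qed.

Hypothesis volume_cell : forall k x, 0 < m (cell k x) < +oo.

Let mcell k x : measurable (cell k x). Proof. exact: hgrid.1. Qed.

(** On the cell, the [A1] property bounds [b] from below by a multiple of its
    mean. *)
Lemma average_lower b g Cb k x (L : R) : pos_density b -> density g ->
  (0 < Cb)%R -> (0 <= L)%R -> grid_A1 key m b Cb ->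
  (average key m b g k x <= L)%R ->
  mass m (fun y => g y * b y)%R (cell k x) < +oo ->
  mass m g (cell k x) <= (Cb * L)%:E * m (cell k x).
Proof.
move=> pb dg Cb0 L0 bA1 gL gfin.
have bcell : 0 < mass m b (cell k x) < +oo.
  exact: (grid_A1_cell hgrid volume_cell k x pb bA1).
have /andP[b0 boo] := bcell; have /andP[v0 voo] := volume_cell k x.
have bE := cell_massE pb.1 boo.
have dgb : density (fun y => g y * b y)%R by exact: densityM pb.1.
have gE := cell_massE dgb gfin.
pose B := cell_mass key m b k x; pose G := cell_mass key m (fun y => g y * b y)%R k x.
pose v := fine (m (cell k x)).
have vE : m (cell k x) = v%:E by rewrite fineK// ge0_fin_numE// ltW.
have B0 : (0 < B)%R by rewrite -lte_fin -bE.
have v0' : (0 < v)%R by rewrite -lte_fin -vE.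
have GL : (G <= L * B)%R by rewrite -ler_pdivrMr.
have c0 : (0 <= Cb * v / B)%R by rewrite divr_ge0 ?mulr_ge0// ltW.
apply: (@le_trans _ _ (mass m (fun y => Cb * v / B * (g y * b y))%R (cell k x))).
  apply: ae_le_mass => //; first exact: densityZ.
  apply: filterS bA1 => y /(_ k) by_ yx; move: by_.
  rewrite (cell_eq yx) vE bE -EFinM lee_fin => by_.
  rewrite mulrCA ler_peMr ?dg.2// mulrAC ler_pdivlMr// mul1r.
  by rewrite mulrAC.
rewrite massZ// gE vE -!EFinM lee_fin.
apply: (@le_trans _ _ (Cb * v / B * (L * B)))%R; first by rewrite ler_wpM2l.
by rewrite le_eqVlt; apply/orP; left; apply/eqP; field; rewrite gt_eqF.
Qed.

Lemma average_scale b g k x (r : R) : density b -> density g -> (0 <= r)%R ->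
  mass m (fun y => g y * b y)%R (cell k x) < +oo ->
  average key m b (fun y => r * g y)%R k x = (r * average key m b g k x)%R.
Proof.
move=> db dg r0 gfin; rewrite /average mulrA; congr (_ / _)%R.
have dgb : density (fun y => g y * b y)%R by exact: densityM.
rewrite /cell_mass (_ : (fun y => r * g y * b y)%R = (fun y => r * (g y * b y))%R).
  by rewrite massZ// (cell_massE dgb gfin).
by apply/funext => y; rewrite mulrA.
Qed.

(** The pointwise bound [w y <= w x + w x ^ (1 - s) * w y ^ s], seen by comparing
    [w y] with [w x], is averaged in [y]. *)
Lemma grid_A1_root w C (s : R) : (0 < C)%R -> (1 <= s)%R -> pos_density w ->
  grid_A1 key m (fun x => w x `^ s)%R C -> grid_A1 key m w (1 + C).
Proof.
move=> C0 s1 [dw w0] wA1; apply: filterS wA1 => x wx k.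
have dws : density (fun y => w y `^ s)%R by exact: density_powR.
have c0 : (0 <= w x `^ (1 - s))%R by exact: powR_ge0.
have dc : density (fun _ : T => w x) by apply: density_cst; exact: ltW.
have dcw : density (fun y => w x `^ (1 - s) * w y `^ s)%R by exact: densityZ.
have /andP[v0 voo] := volume_cell k x.
apply: (@le_trans _ _ (mass m (fun y => w x + w x `^ (1 - s) * w y `^ s)%R (cell k x))).
  apply: le_mass => //; first exact: densityD.
  move=> y _; have [yx|xy] := leP (w y) (w x).
    by rewrite (le_trans yx)// lerDl mulr_ge0 ?powR_ge0.
  apply: (@le_trans _ _ (w y `^ (1 - s) * w y `^ s))%R.
    rewrite -powRD; first by rewrite subrK powRr1// ltW.
    by rewrite (gt_eqF (w0 y)) implybT.
  apply: (@le_trans _ _ (w x `^ (1 - s) * w y `^ s))%R; last by rewrite lerDr ltW.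
  rewrite ler_wpM2r ?powR_ge0//.
  rewrite -(opprB s 1%R) !powRN lef_pV2 ?posrE ?powR_gt0//.
  by rewrite ge0_ler_powR ?nnegrE ?subr_ge0 ?(ltW (w0 _))// ltW.
rewrite massD// massZ// mass_cst ?(ltW (w0 x))//.
rewrite mulrDl mul1r EFinD ge0_muleDl ?lee_fin ?mulr_ge0 ?(ltW (w0 x)) ?(ltW C0)//.
apply: leeD => //.
apply: (@le_trans _ _ ((w x `^ (1 - s))%:E * ((C * w x `^ s)%:E * m (cell k x)))).
  by rewrite lee_wpmul2l ?lee_fin.
rewrite muleA -EFinM.
rewrite (_ : w x `^ (1 - s) * (C * w x `^ s) = C * w x)%R// mulrCA; congr (_ * _)%R.
rewrite -powRD; first by rewrite subrK powRr1// ltW.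
by rewrite (gt_eqF (w0 x)) implybT.
Qed.

End Reduction.

(** * Muckenhoupt conditions on the cells *)

Section ClosedCells.
Context d (T : measurableType d) (R : realType) (I : countType).
Variables (key : nat -> T -> I) (m : {measure set T -> \bar R}).
Hypothesis hgrid : grid key.
Local Notation cell := (cell key).
Hypothesis volume_cell : forall k x, 0 < m (cell k x) < +oo.
Variable Q : nat -> T -> set T.
Hypothesis mQ : forall k x, measurable (Q k x).
Hypothesis cellQ : forall k x, cell k x `<=` Q k x.
Hypothesis massQ : forall f k x, density f -> mass m f (Q k x) = mass m f (cell k x).
Hypothesis volQ : forall k x, m (Q k x) = m (cell k x).

Lemma integral_ae_mass (W : T -> \bar R) (w : T -> R) A : measurable A ->
  measurable_fun [set: T] W -> density w ->
  {ae m, forall x, W x = (w x)%:E} -> \int[m]_(x in A) W x = mass m w A.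
Proof.
move=> mA mW dw Ww; apply: ae_eq_integral => //.
- exact: measurable_funS mW.
- exact: density_measE.
- by apply: filterS Ww => x ->.
Qed.

Lemma closed_grid_A1 W w C : measurable_fun [set: T] W -> pos_density w ->
  {ae m, forall x, W x = (w x)%:E} -> (0 < C)%R ->
  (forall k x, (m (Q k x))^-1 * \int[m]_(y in Q k x) W y <=
    C%:E * ess_inf m (patch (cst +oo) (Q k x) W)) ->
  grid_A1 key m w C.
Proof.
move=> mW pw Ww C0 H; apply: ae_foralln => k; apply: (@ae_cells _ _ _ _ key m k) => x.
have /andP[v0 voo] := volume_cell k x.
have vE : m (cell k x) = (fine (m (cell k x)))%:E.
  by rewrite fineK// ge0_fin_numE// ltW.
have v'0 : (0 < fine (m (cell k x)))%R by rewrite -lte_fin -vE.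
have := H k x; rewrite volQ (integral_ae_mass (mQ k x) mW pw.1 Ww) (massQ _ _ pw.1) vE.
move=> /(ess_inf_average v'0 C0 Ww); apply: filterS => y Hy yx.
by rewrite (cell_eq yx) vE; apply: Hy; exact: cellQ.
Qed.

Variables (B : T -> \bar R) (b : T -> R) (W : T -> \bar R) (V : T -> R).
Hypotheses (mB : measurable_fun [set: T] B) (mW : measurable_fun [set: T] W).
Hypotheses (pb : pos_density b) (pV : pos_density V).
Hypothesis Bb : {ae m, forall x, B x = (b x)%:E}.
Hypothesis WV : {ae m, forall x, W x = (V x)%:E}.
Hypothesis b_cell : forall k x, 0 < mass m b (cell k x) < +oo.

Let vb x := (V x * b x)%R.

Let pvb : pos_density vb. Proof. exact: pos_densityM. Qed.

Let BE k x : \int[m]_(y in Q k x) B y = (cell_mass key m b k x)%:E.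
Proof.
rewrite (integral_ae_mass (mQ k x) mB pb.1 Bb) (massQ _ _ pb.1).
by apply: cell_massE pb.1 _; case/andP: (b_cell k x).
Qed.

Let mu_gt0 k x : (0 < cell_mass key m b k x)%R.
Proof. by apply: fine_gt0; rewrite b_cell. Qed.

Let WBE k x : \int[m]_(y in Q k x) (W y * B y) = mass m vb (cell k x).
Proof.
rewrite -(massQ _ _ pvb.1); apply: integral_ae_mass => //.
- exact: emeasurable_funM.
- exact: pvb.1.
- by apply: filterS2 WV (Bb) => y -> ->.
Qed.

Lemma closed_A1_weighted C : (0 < C)%R ->
  (forall k x, (\int[m]_(y in Q k x) B y)^-1 * \int[m]_(y in Q k x) (W y * B y) <=
    C%:E * ess_inf m (patch (cst +oo) (Q k x) W)) ->
  (forall k x, mass m vb (cell k x) < +oo) /\ small_values key m b V 1 C.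
Proof.
move=> C0 H.
have A1 k x : {ae m, forall y, cell k x y -> mass m vb (cell k x) <=
    (C * V y)%:E * (cell_mass key m b k x)%:E}.
  have := H k x; rewrite BE WBE => /(ess_inf_average (mu_gt0 k x) C0 WV).
  by apply: filterS => y Hy yx; apply: Hy; exact: cellQ.
have vfin k x : mass m vb (cell k x) < +oo.
  have /andP[v0 _] := volume_cell k x.
  have [y _ wy] := ae_point (hgrid.1 k x) v0 (A1 k x).
  by apply: le_lt_trans wy _; rewrite -EFinM ltry.
split => //.
have A1' : {ae m, forall x, forall k,
    (cell_mass key m vb k x <= C * V x * cell_mass key m b k x)%R}.
  apply: ae_foralln => k; apply: (@ae_cells _ _ _ _ key m k) => x.
  apply: filterS (A1 k x) => y Hy yx.
  rewrite (cell_mass_adapted m vb yx) (cell_mass_adapted m b yx).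
  by rewrite -lee_fin EFinM -(cell_massE pvb.1)// Hy.
apply: small_values_A1 => //; [exact: pb.1|exact: pV.1|].
by move=> k x; rewrite vfin pos_cell.
Qed.

Lemma closed_Ar r C : (1 < r)%R -> (0 < C)%R ->
  (forall k x, ((\int[m]_(y in Q k x) B y)^-1 * \int[m]_(y in Q k x) (W y * B y)) *
    ((\int[m]_(y in Q k x) B y)^-1 *
       \int[m]_(y in Q k x) (W y `^ (- (r - 1)^-1) * B y)) `^ (r - 1) <= C%:E) ->
  (forall k x, mass m vb (cell k x) < +oo) /\
  small_values key m b V (r - 1)^-1 (C `^ (r - 1)^-1).
Proof.
move=> r1 C0 H; pose s := (r - 1)^-1%R.
have psb : pos_density (fun y => V y `^ (- s) * b y)%R.
  exact: (pos_densityM (pos_density_powR (- s) pV) pb).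
have SE k x : \int[m]_(y in Q k x) (W y `^ (- s) * B y) =
    mass m (fun y => V y `^ (- s) * b y)%R (cell k x).
  rewrite -(massQ _ _ psb.1); apply: integral_ae_mass => //.
  - by apply: emeasurable_funM => //; exact: (measurableT_comp (measurable_poweR _) mW).
  - exact: psb.1.
  - by apply: filterS2 WV (Bb) => y -> ->.
have split_ k x : mass m vb (cell k x) < +oo /\
    mass m (fun y => V y `^ (- s) * b y)%R (cell k x) <=
    (cell_mass key m b k x * (C * cell_mass key m b k x / cell_mass key m vb k x) `^ s)%:E.
  have := H k x; rewrite BE WBE -/s SE; apply: Ar_split => //.
  - by apply: pos_cell.
  - by apply: pos_cell.
split; first by move=> k x; have [] := split_ k x.
apply: small_values_Ar => //.
- exact: pb.1.
- exact: pV.1.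
- exact: pV.2.
- by move=> k x; have [+ _] := split_ k x; rewrite pos_cell.
- by move=> k x; have [] := split_ k x.
Qed.

End ClosedCells.

(** * Level sets of the averages *)

Section LevelSets.
Context d (T : measurableType d) (R : realType) (I : countType).
Variables (key : nat -> T -> I) (m : {measure set T -> \bar R}).
Hypothesis hgrid : grid key.
Local Notation cell := (cell key).
Hypothesis volume_cell : forall k x, 0 < m (cell k x) < +oo.

Let mcell k x : measurable (cell k x). Proof. exact: hgrid.1. Qed.

Lemma measurable_average_level (b g V : T -> R) : density V ->
  measurable [set x | exists k, (V x < average key m b g k x)%R].
Proof.
move=> dV; rewrite (_ : [set x | _] =
    \bigcup_k [set x | (V x < average key m b g k x)%R]); last first.
  by apply/seteqP; split => [x [k Vk]|x [k _ Vk]]; exists k.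
apply: bigcupT_measurable => k; apply: measurable_lt_set; first exact: dV.1.
apply: (adapted_measurable hgrid (k := k)) => x y xy.
by rewrite /average (cell_mass_adapted m _ xy) (cell_mass_adapted m b xy).
Qed.

Lemma grid_A1_mul_fin (u g : T -> R) C k x : (0 < C)%R -> pos_density u ->
  grid_A1 key m u C -> density g ->
  mass m (fun y => g y * u y)%R [set: T] < +oo -> mass m g (cell k x) < +oo.
Proof.
move=> C0 pu uA1 dg gfin.
have /andP[u0 uoo] := grid_A1_cell hgrid volume_cell k x pu uA1.
have /andP[v0 voo] := volume_cell k x.
have uE := cell_massE pu.1 uoo; set U := cell_mass key m u k x in uE.
have vE : m (cell k x) = (fine (m (cell k x)))%:E.
  by rewrite fineK// ge0_fin_numE// ltW.
set v := fine _ in vE.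
have U0 : (0 < U)%R by rewrite -lte_fin -uE.
have v0' : (0 < v)%R by rewrite -lte_fin -vE.
have c0 : (0 <= C * v / U)%R by rewrite divr_ge0 ?mulr_ge0// ltW.
have dgu : density (fun y => g y * u y)%R by exact: densityM pu.1.
apply: (@le_lt_trans _ _ (mass m (fun y => C * v / U * (g y * u y))%R (cell k x))).
  apply: ae_le_mass => //; first exact: densityZ.
  apply: filterS uA1 => y /(_ k) uy yx; move: uy.
  rewrite (cell_eq yx) vE uE -EFinM lee_fin => uy.
  rewrite mulrCA ler_peMr ?dg.2// mulrAC ler_pdivlMr// mul1r.
  by rewrite mulrAC.
rewrite massZ//; apply: lte_mul_pinfty; rewrite ?lee_fin//.
by apply: le_lt_trans gfin; exact: le_mass_set.
Qed.

(** If the average of [g] were small, [mass_holder] would bound the integral of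
    [f] over the cell. *)
Lemma average_gt (b h v V f g F : T -> R) (a c e Cb Ch K t L : R) k x :
  pos_density b -> pos_density h -> pos_density v -> (0 < V x)%R ->
  density f -> density g -> density F ->
  (0 < a)%R -> (0 <= c)%R -> (0 <= e)%R -> (a + c + e = 1)%R ->
  (forall y, f y = g y `^ a * F y `^ c * h y `^ e)%R ->
  (V x `^ a * h x `^ e = v x)%R ->
  (0 < Cb)%R -> (0 < K)%R -> (0 < L)%R ->
  ((2 + Ch) * (Cb * L) `^ a * K `^ c = t)%R ->
  grid_A1 key m b Cb ->
  mass m h (cell k x) <= (Ch * h x)%:E * m (cell k x) ->
  mass m (fun y => g y * b y)%R (cell k x) < +oo ->
  mass m F [set: T] <= K%:E ->
  (t * v x * fine (m (cell k x)) `^ (1 - c))%:E < mass m f (cell k x) ->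
  (L * V x < average key m b g k x)%R.
Proof.
move=> pb ph pv V0 df dg dF a0 c0 e0 ace fE VE Cb0 K0 L0 tE bA1 hx gfin FK ft.
rewrite ltNge; apply/negP => gL; move: ft; rewrite ltNge => /negP; apply.
have /andP[p0 poo] := volume_cell k x.
have pE : m (cell k x) = (fine (m (cell k x)))%:E.
  by rewrite fineK// ge0_fin_numE// ltW.
set p := fine _ in pE *.
have p0' : (0 < p)%R by rewrite -lte_fin -pE.
have LV0 : (0 < L * V x)%R by rewrite mulr_gt0.
have gP := average_lower hgrid volume_cell pb dg Cb0 (ltW LV0) bA1 gL gfin.
rewrite pE -EFinM in gP; rewrite pE -EFinM in hx.
have FP : mass m F (cell k x) <= K%:E by apply: le_trans FK; exact: le_mass_set.
have CLV0 : (0 < Cb * (L * V x))%R by rewrite mulr_gt0.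
apply: le_trans (mass_holder (mcell k x) df dg dF ph.1 a0 c0 e0 ace fE p0' K0
  (ph.2 x) CLV0 gP FP hx) _.
rewrite lee_fin -tE -VE mulrA (powRM a _ (ltW V0)); last by rewrite mulr_ge0 ?ltW.
by rewrite le_eqVlt; apply/orP; left; apply/eqP; ring.
Qed.

Lemma mixed_weak_scale (b U V g : T -> R) (C K L : R) :
  density b -> density V -> density U -> density g -> (0 < L)%R -> (0 < C)%R ->
  (forall g' : T -> R, density g' ->
    mass m (fun y => V y * U y)%R
      [set x | exists k, (V x < average key m b g' k x)%R] <=
    C%:E * mass m (fun y => g' y * U y)%R [set: T]) ->
  (forall k x, mass m (fun y => g y * b y)%R (cell k x) < +oo) ->
  mass m (fun y => g y * U y)%R [set: T] <= K%:E ->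
  mass m (fun y => V y * U y)%R
    [set x | exists k, (L * V x < average key m b g k x)%R] <= (C * (K / L))%:E.
Proof.
move=> db dV dU dg L0 C0 mixed gfin gK.
have L'0 : (0 <= L^-1)%R by rewrite invr_ge0 ltW.
have dLg : density (fun y => L^-1 * g y)%R by exact: densityZ.
have dgU : density (fun y => g y * U y)%R by exact: densityM.
rewrite (_ : [set x | _] =
    [set x | exists k, (V x < average key m b (fun y => L^-1 * g y) k x)%R]).
  apply: (le_trans (mixed _ dLg)); rewrite EFinM lee_pmul2l ?lte_fin//.
  rewrite (_ : (fun y => L^-1 * g y * U y)%R = (fun y => L^-1 * (g y * U y))%R).
    rewrite massZ// [(K / L)%R]mulrC EFinM; exact: lee_wpmul2l.
  by apply/funext => y; rewrite mulrA.
have E k x : (V x < average key m b (fun y => L^-1 * g y) k x)%R =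
    (L * V x < average key m b g k x)%R.
  by rewrite average_scale// mulrC ltr_pdivlMr// mulrC.
by apply/seteqP; split => x [k Vk]; exists k; rewrite ?E// -E.
Qed.

Lemma mass_bigsetU_le (J : Type) (r : seq J) (S : J -> set T) (f : T -> R) (C : R) :
  density f -> (forall j, measurable (S j)) ->
  (forall j, mass m f (S j) <= C%:E) ->
  mass m f (\big[setU/set0]_(j <- r) S j) <= ((size r)%:R * C)%:E.
Proof.
move=> df mS SC; elim: r => [|j r IHr].
  by rewrite big_nil mul0r /mass integral_set0.
rewrite big_cons /=; have mr : measurable (\big[setU/set0]_(j <- r) S j).
  exact: bigsetU_measurable.
apply: (@le_trans _ _ (mass m f (S j) + mass m f (\big[setU/set0]_(j <- r) S j))).
  by apply: le_mass_setU => //; exact: measurableU.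
by rewrite -natr1 mulrDl mul1r addrC EFinD; exact: leeD.
Qed.

End LevelSets.

(** * Fractional averages over all dyadic grids *)

Section Concrete.
Context (R : realType) (n : nat).
Local Notation Rn := 'rV[R]_n.
Local Notation LT := (lebesgue_type R n).
Local Notation leb := (@lebesgue_Rn R n).
Hypothesis volume_gt0 : (0 < unit_volume R n)%R.

Let Qc L (A : Rn) k (x : LT) : set LT := cube_at (corner L A k x) (side L k).

Section OneGrid.
Variables (L : R) (A : Rn).
Hypothesis L0 : (0 < L)%R.
Let hgrid : grid (dyadic_key L A) := dyadic_grid A L0.

Lemma dyadic_volume k x : 0 < leb (cell (dyadic_key L A) k x) < +oo.
Proof.
rewrite (lebesgue_dyadic_cell A L0) lte_fin ltry andbT mulr_gt0//.
by rewrite exprn_gt0// side_gt0.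
Qed.

Lemma dyadic_doubling k x : leb (cell (dyadic_key L A) k x) <=
  (2 ^+ n)%:E * leb (cell (dyadic_key L A) k.+1 x).
Proof.
rewrite !(lebesgue_dyadic_cell A L0) -EFinM lee_fin mulrA -exprMn.
by rewrite (_ : 2 * side L k.+1 = side L k)%R// /side exprS; field.
Qed.

Lemma cube_mass (f : LT -> R) k x : density f ->
  mass leb f (Qc L A k x) = mass leb f (cell (dyadic_key L A) k x).
Proof. by move=> df; rewrite (@mass_dyadic_cell R n L A L0 f k x df). Qed.

Lemma cube_volume k x : leb (Qc L A k x) = leb (cell (dyadic_key L A) k x).
Proof. by rewrite (lebesgue_dyadic_cell A L0) lebesgue_cube// side_gt0. Qed.

Lemma cube_cell k x : cell (dyadic_key L A) k x `<=` Qc L A k x.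
Proof. exact: dyadic_sub_cube. Qed.

Lemma cube_measurable k x : measurable (Qc L A k x).
Proof. exact: measurable_cube. Qed.

Lemma cube_cube k x : cube (Qc L A k x : set Rn).
Proof. by exists (corner L A k x), (side L k) => //; exact: side_gt0. Qed.

End OneGrid.

Definition all_grids_A1 (w : LT -> R) C :=
  forall L A, (0 < L)%R -> grid_A1 (dyadic_key L A) leb w C.

Lemma A1_all_grids (W : LT -> \bar R) w : measurable_fun [set: LT] W ->
  pos_density w -> {ae leb, forall x, W x = (w x)%:E} -> A1 W ->
  exists2 C, (1 <= C)%R & all_grids_A1 w C.
Proof.
move=> mW pw Ww [C C0 WA1]; exists (1 + C)%R; first by rewrite lerDl ltW.
move=> L A L0.
have H := @closed_grid_A1 _ _ R _ (dyadic_key L A) leb (@dyadic_volume L A L0)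
  (Qc L A) (@cube_measurable L A) (@cube_cell L A L0) (@cube_mass L A L0)
  (@cube_volume L A L0) W w C mW pw Ww C0.
have {}H := H (fun k x => WA1 _ (@cube_cube L A L0 k x)).
have gr := dyadic_grid A L0.
refine (ae_imp H _) => x wx k; apply: (le_trans (wx k)).
apply: lee_wpmul2r; first exact: measure_ge0.
by rewrite lee_fin ler_wpM2r ?(ltW (pw.2 x))// lerDr.
Qed.

Lemma Ainfty_all_grids (B W : LT -> \bar R) b V Cb : measurable_fun [set: LT] B ->
  measurable_fun [set: LT] W -> pos_density b -> pos_density V ->
  {ae leb, forall x, B x = (b x)%:E} -> {ae leb, forall x, W x = (V x)%:E} ->
  all_grids_A1 b Cb -> Ainfty_weighted B W ->
  exists s K, [/\ (0 < s)%R, (0 < K)%R & forall L A, (0 < L)%R ->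
    (forall k x, mass leb (fun y => V y * b y)%R (cell (dyadic_key L A) k x) < +oo) /\
    small_values (dyadic_key L A) leb b V s K].
Proof.
move=> mB mW pb pV Bb WV bA1 [[C C0 H]|[r r1 [C C0 H]]].
  exists 1%R, C; split=> // L A L0.
  have bc k x : 0 < mass leb b (cell (dyadic_key L A) k x) < +oo.
    exact: (grid_A1_cell (dyadic_grid A L0) (dyadic_volume A L0) k x pb (bA1 L A L0)).
  have := @closed_A1_weighted _ _ R _ (dyadic_key L A) leb (dyadic_grid A L0)
    (@dyadic_volume L A L0) (Qc L A) (@cube_measurable L A) (@cube_cell L A L0)
    (@cube_mass L A L0) B b W V mB mW pb pV Bb WV bc C C0.
  by apply=> k x; exact: (H _ (@cube_cube L A L0 k x)).
have s0 : (0 < (r - 1)^-1)%R by rewrite invr_gt0 subr_gt0.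
exists (r - 1)^-1%R, (C `^ (r - 1)^-1)%R; split; rewrite ?powR_gt0// => L A L0.
have bc k x : 0 < mass leb b (cell (dyadic_key L A) k x) < +oo.
  exact: (grid_A1_cell (dyadic_grid A L0) (dyadic_volume A L0) k x pb (bA1 L A L0)).
have := @closed_Ar _ _ R _ (dyadic_key L A) leb (dyadic_grid A L0)
  (@dyadic_volume L A L0) (Qc L A) (@cube_measurable L A)
  (@cube_mass L A L0) B b W V mB mW pb pV Bb WV bc r C r1 C0.
by apply=> k x; exact: (H _ (@cube_cube L A L0 k x)).
Qed.

Definition mixed_on_grids (b U V : LT -> R) C := forall L A g, (0 < L)%R ->
  density g -> mass leb (fun y => V y * U y)%R
    [set x | exists k, (V x < average (dyadic_key L A) leb b g k x)%R] <=
  C%:E * mass leb (fun y => g y * U y)%R [set: LT].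

Let two_n : (1 <= 2 ^+ n :> R)%R. Proof. by rewrite exprn_ege1//; lra. Qed.

Lemma mixed_on_grids_A1 u V Cu Cv : pos_density u -> pos_density V ->
  (1 <= Cu)%R -> (0 < Cv)%R -> all_grids_A1 u Cu -> all_grids_A1 V Cv ->
  mixed_on_grids (fun=> 1%R) u V (weak_constant (2 ^+ n) Cu 1 Cv
    (decay_exponent (2 ^+ n) Cu) (decay_constant (2 ^+ n) Cu)).
Proof.
move=> pu pV Cu1 Cv0 uA1 VA1 L A g L0 dg.
exact: (@mixed_A1_A1 _ _ R _ (dyadic_key L A) leb (dyadic_grid A L0) (2 ^+ n)%R
  two_n (dyadic_volume A L0) (dyadic_doubling A L0) u V g Cu Cv pu pV dg Cu1 Cv0
  (uA1 L A L0) (VA1 L A L0) (dyadic_differentiation A L0 pu.1 pu.2)).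
Qed.

Lemma mixed_on_grids_Ainfty b V Cb s K : pos_density b -> pos_density V ->
  (0 < Cb)%R -> (0 < s)%R -> (0 < K)%R -> all_grids_A1 b Cb ->
  (forall L A, (0 < L)%R ->
    (forall k x, mass leb (fun y => V y * b y)%R (cell (dyadic_key L A) k x) < +oo) /\
    small_values (dyadic_key L A) leb b V s K) ->
  mixed_on_grids b b V (weak_constant (Cb * 2 ^+ n) 1 s K 1 1).
Proof.
move=> pb pV Cb0 s0 K0 bA1 H L A g L0 dg; have [Vfin VsK] := H L A L0.
exact: (@mixed_Ainfty _ _ R _ (dyadic_key L A) leb (dyadic_grid A L0) (2 ^+ n)%R
  two_n (dyadic_volume A L0) (dyadic_doubling A L0) b V g Cb s K pb pV dg Cb0 s0 K0
  (bA1 L A L0) Vfin VsK).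
Qed.

Let grids := {ffun 'I_n -> bool}.

(** A cube of side [l] is replaced by a cell of side at most [6 * l], whose
    volume enters with the power [1 - c]. *)
Definition level_set_constant (c : R) : R := (((6 ^+ n) `^ (1 - c))^-1)%R.

(** A cube with [f]-average above [t * v x] lies in a cell of one of the
    [2 ^ n] shifted grids, provided that their top side is more than three
    times its own. In that cell the average of [g] exceeds [lam * V x] by
    [average_gt]. Hence each point of the level set belongs, for every large
    top side, to one of the finitely many sets that the mixed inequality bounds. *)
Lemma fractional_level_set (b h U V v f g F : LT -> R) (a c e Cb Ch C0 K t : R) :
  pos_density b -> pos_density h -> pos_density U -> pos_density V -> pos_density v ->
  density f -> density g -> density F ->
  (0 < a)%R -> (0 <= c)%R -> (0 <= e)%R -> (a + c + e = 1)%R ->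
  (forall y, f y = g y `^ a * F y `^ c * h y `^ e)%R ->
  (forall y, g y * U y = F y)%R ->
  (forall x, V x `^ a * h x `^ e = v x)%R ->
  (0 < Cb)%R -> (0 < Ch)%R -> (0 < C0)%R -> (0 < K)%R -> (0 < t)%R ->
  all_grids_A1 b Cb -> all_grids_A1 h Ch -> mixed_on_grids b U V C0 ->
  (forall L A k x, (0 < L)%R ->
     mass leb (fun y => g y * b y)%R (cell (dyadic_key L A) k x) < +oo) ->
  mass leb F [set: LT] <= K%:E ->
  exists (H : set LT) (r : R), [/\ measurable H, (0 <= r)%R,
    mass leb (fun y => V y * U y)%R H <= r%:E,
    (r `^ a <= (#|grids|%:R * C0 * Cb) `^ a * (2 + Ch) / level_set_constant c
       / t * K `^ (1 - e))%R &
    {ae leb, forall x, (exists z l, [/\ (0 < l)%R, cube_at z l x &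
        (t * v x * (l ^+ n * unit_volume R n) `^ (1 - c))%:E <
          mass leb f (cube_at z l)]) -> H x}].
Proof.
move=> pb ph pU pV pv df dg dF a0 c0 e0 ace fE gU VE Cb0 Ch0 C00 K0 t0 bA1 hA1
  mixed gfin FK.
pose c1 := level_set_constant c.
have c10 : (0 < c1)%R by rewrite invr_gt0 powR_gt0// exprn_gt0.
(* The level for which the constant of [average_gt] is [c1 * t]. *)
pose lam := (Cb^-1 * (c1 * t / ((2 + Ch) * K `^ c)) `^ a^-1)%R.
have Ch2 : (0 < 2 + Ch)%R by lra.
have Kc0 : (0 < K `^ c)%R by exact: powR_gt0.
have base0 : (0 < c1 * t / ((2 + Ch) * K `^ c))%R.
  by apply: divr_gt0; exact: mulr_gt0.
have lam0 : (0 < lam)%R by apply: mulr_gt0; [rewrite invr_gt0|exact: powR_gt0].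
have CblamE : ((Cb * lam) `^ a = c1 * t / ((2 + Ch) * K `^ c))%R.
  rewrite /lam mulrA divff ?gt_eqF// mul1r -powRrM mulVf ?gt_eqF// powRr1//.
  exact: ltW.
have lamE : ((2 + Ch) * (Cb * lam) `^ a * K `^ c = c1 * t)%R.
  by rewrite CblamE; field; rewrite !gt_eqF.
have gUE : (fun y => g y * U y)%R = F by apply/funext.
pose S j (eps : grids) : set LT := [set x | exists k,
  (lam * V x < average (dyadic_key j.+1%:R (third_offset j.+1%:R eps)) leb b g k x)%R].
have j0 j : (0 < j.+1%:R :> R)%R by rewrite ltr0n.
have dlV : density (fun x => lam * V x)%R by apply: densityZ (ltW lam0) pV.1.
have mS j eps : measurable (S j eps).
  have gr := dyadic_grid (third_offset j.+1%:R eps) (j0 j).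
  exact: (measurable_average_level leb gr b g dlV).
have dVU : density (fun y => V y * U y)%R by exact: densityM pV.1 pU.1.
have gUK : mass leb (fun y => g y * U y)%R [set: LT] <= K%:E by rewrite gUE.
have SC j eps : mass leb (fun y => V y * U y)%R (S j eps) <= (C0 * (K / lam))%:E.
  exact: (mixed_weak_scale (dyadic_grid (third_offset j.+1%:R eps) (j0 j))
    pb.1 pV.1 pU.1 dg lam0 C00 (fun g' dg' => mixed _ _ g' (j0 j) dg')
    (fun k x => gfin _ _ k x (j0 j)) gUK).
pose SS j := \big[setU/set0]_(eps <- enum {: grids}) S j eps.
have mSS j : measurable (SS j) by exact: bigsetU_measurable.
pose r := (#|grids|%:R * (C0 * (K / lam)))%R.
have SSC j : mass leb (fun y => V y * U y)%R (SS j) <= r%:E.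
  apply: (le_trans (mass_bigsetU_le _ dVU (mS j) (SC j))).
  by rewrite lee_fin /r -cardE.
(* The points that are covered for every large enough top side. *)
pose H := \bigcup_j \bigcap_(i in [set i | (j <= i)%N]) SS i.
have mtail j : measurable (\bigcap_(i in [set i | (j <= i)%N]) SS i).
  by apply: bigcap_measurable => //; exists j => /=.
exists H, r; split.
- exact: bigcupT_measurable.
- by rewrite mulr_ge0// mulr_ge0 ?(ltW C00)// divr_ge0// ltW.
- apply: mass_bigcup_le => //.
    move=> i j ij; apply/subsetPset => x Hx l /= jl; apply: Hx => /=.
    exact: leq_trans ij jl.
  move=> j; apply: le_trans (SSC j); apply: le_mass_set => // x; apply => /=.
  exact: leqnn.
- have -> : r = (#|grids|%:R * C0 * Cb * K / (Cb * lam))%R.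
    by rewrite /r; field; rewrite !gt_eqF.
  have N0 : (0 <= #|grids|%:R * C0 * Cb)%R by rewrite !mulr_ge0// ltW.
  have Cl0 : (0 < Cb * lam)%R by exact: mulr_gt0.
  rewrite (powRM a (mulr_ge0 N0 (ltW K0))); last by rewrite invr_ge0 ltW.
  rewrite (powRM a N0 (ltW K0)).
  have -> : ((Cb * lam)^-1 `^ a = ((Cb * lam) `^ a)^-1)%R.
    by rewrite -powRN -(powR_inv1 (ltW Cl0)) -powRrM mulN1r.
  rewrite CblamE.
  have -> : (K `^ (1 - e) = K `^ a * K `^ c)%R.
    rewrite -powRD; first by congr (powR _ _); lra.
    by rewrite (gt_eqF K0) implybT.
  rewrite -/c1 le_eqVlt; apply/orP; left; apply/eqP.
  by field; rewrite !gt_eqF.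
have good : {ae leb, forall x, forall j (eps : grids) k,
    mass leb h (cell (dyadic_key j.+1%:R (third_offset j.+1%:R eps)) k x) <=
    (Ch * h x)%:E * leb (cell (dyadic_key j.+1%:R (third_offset j.+1%:R eps)) k x)}.
  apply: ae_foralln => j.
  have Hm i : {ae leb, forall x, forall eps : grids, pickle eps = i -> forall k,
      mass leb h (cell (dyadic_key j.+1%:R (third_offset j.+1%:R eps)) k x) <=
      (Ch * h x)%:E * leb (cell (dyadic_key j.+1%:R (third_offset j.+1%:R eps)) k x)}.
    have [[eps0 e0i]|ni] := pselect (exists eps : grids, pickle eps = i); last first.
      by apply: aeW => x eps epsi; exfalso; apply: ni; exists eps.
    apply: (ae_imp (hA1 _ (third_offset j.+1%:R eps0) (j0 j))) => x hx eps epsi k.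
    rewrite (_ : eps = eps0); first exact: hx.
    by apply: (pcan_inj (@pickleK grids)); rewrite epsi.
  by apply: (ae_imp (ae_foralln Hm)) => x Hx eps k; exact: Hx.
refine (ae_imp good _) => x xgood [z [l [l0 xQ ft]]].
pose j := Num.bound (3 * l)%R.
have l3 : (0 <= 3 * l)%R by rewrite mulr_ge0// ltW.
exists j => // i /= ji.
have li : (3 * l < i.+1%:R)%R.
  apply: (lt_le_trans (archi_boundP l3)); rewrite ler_nat; exact: leq_trans ji _.
have [eps [k [Qcell kl]]] := one_third z l0 li.
pose A := third_offset i.+1%:R eps : Rn.
have cellx := Qcell x xQ.
rewrite /SS (big_rem eps) /=; last by rewrite mem_enum inE.
left; exists k.
have gr := dyadic_grid A (j0 i); have vc := dyadic_volume A (j0 i).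
apply: (average_gt gr vc pb ph pv (pV.2 x) df dg dF a0 c0 e0 ace fE (VE x) Cb0 K0
  lam0 lamE (bA1 _ _ (j0 i)) (xgood i eps k) (gfin _ _ k x (j0 i)) FK).
apply: (lt_le_trans _ (le_mass_set leb (measurable_cube z l) (gr.1 k x) df cellx)).
apply: (le_lt_trans _ ft); rewrite lee_fin.
suff bound X : X = (side i.+1%:R k ^+ n * unit_volume R n)%R ->
    (c1 * t * v x * X `^ (1 - c) <= t * v x * (l ^+ n * unit_volume R n) `^ (1 - c))%R.
  exact: (bound _ (congr1 fine (lebesgue_dyadic_cell A (j0 i) k x))).
move=> ->.
have w0 : (0 <= unit_volume R n)%R := ltW volume_gt0.
have s0 : (0 < side i.+1%:R k :> R)%R := side_gt0 (j0 i) k.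
have c1' : (0 <= 1 - c)%R by lra.
have y0 : (0 <= l ^+ n * unit_volume R n)%R by rewrite mulr_ge0 ?exprn_ge0// ltW.
have six0 : (0 <= 6 ^+ n :> R)%R by exact: exprn_ge0.
have sy : ((side i.+1%:R k ^+ n * unit_volume R n) `^ (1 - c) <=
    c1^-1 * (l ^+ n * unit_volume R n) `^ (1 - c))%R.
  rewrite /c1 /level_set_constant invrK -(powRM _ six0 y0).
  apply: ge0_ler_powR => //; rewrite ?nnegrE.
  - by rewrite mulr_ge0 ?exprn_ge0// ltW.
  - exact: mulr_ge0.
  rewrite mulrA -exprMn ler_wpM2r// lerXn2r ?nnegrE//; first exact: ltW.
  by rewrite mulr_ge0// ltW.
apply: (@le_trans _ _ (c1 * t * v x * (c1^-1 * (l ^+ n * unit_volume R n) `^ (1 - c))))%R.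
  by rewrite ler_wpM2l// !mulr_ge0 ?(ltW c10) ?(ltW t0) ?(ltW (pv.2 x)).
by rewrite le_eqVlt; apply/orP; left; apply/eqP; field; rewrite gt_eqF.
Qed.

End Concrete.

(** * Integrals of weights known almost everywhere *)

Section Weights.
Context d (T : measurableType d) (R : realType) (m : {measure set T -> \bar R}).

Lemma ae_mul_powR (u v : T -> \bar R) (u0 v0 : T -> R) (r : R) :
  {ae m, forall x, u x = (u0 x)%:E} -> {ae m, forall x, v x = (v0 x)%:E} ->
  {ae m, forall x, u x * v x `^ r = (u0 x * v0 x `^ r)%:E}.
Proof. by move=> uu vv; apply: filterS2 uu vv => x -> ->; rewrite EFinM. Qed.

Lemma integral_ae_ge0 (w : T -> \bar R) (E : set T) :
  {ae m, forall x, 0 <= w x} -> 0 <= \int[m]_(x in E) w x.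
Proof.
move=> w0; rewrite integralE.
suff -> : \int[m]_(x in E) w^\- x = 0.
  by rewrite sube0; apply: integral_ge0 => x _; exact: funepos_ge0.
apply/eqP; rewrite eq_le integral_ge0 ?andbT; last first.
  by move=> x _; exact: funeneg_ge0.
rewrite -[leRHS](_ : mass m (fun=> 0%R) [set: T] = 0); last first.
  by rewrite mass_cst// mul0e.
apply: (integral_le_mass measurableT (@density_cst _ T R 0%R (lexx _))).
  apply: filterS w0 => x wx; rewrite funenegE; apply/max_idPr.
  by rewrite oppe_le0.
exact: aeW.
Qed.

Lemma integral_ae_null (w : T -> \bar R) (E : set T) : m [set: T] = 0 ->
  \int[m]_(x in E) w x = 0.
Proof.
move=> m0; have aeP (P : T -> Prop) : {ae m, forall x, P x}.
  by exists [set: T].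
apply/eqP; rewrite eq_le integral_ae_ge0 ?andbT; last exact: aeP.
rewrite -[leRHS](_ : mass m (fun=> 0%R) [set: T] = 0); last first.
  by rewrite mass_cst// mul0e.
by apply: (integral_le_mass measurableT (@density_cst _ T R 0%R (lexx _))); exact: aeP.
Qed.

Lemma density_div (F U : T -> R) : density F -> pos_density U ->
  density (fun x => F x / U x)%R.
Proof.
move=> dF pU; rewrite (_ : (fun x => _) = (fun x => F x * U x `^ (-1))%R).
  by apply: densityM dF _; exact: density_powR pU.1.
by apply/funext => x; rewrite powR_inv1// ltW ?(pU.2 x).
Qed.

Lemma density_norm (f : T -> R) : measurable_fun [set: T] f ->
  density (fun x => `|f x|)%R.
Proof.
by move=> mf; split=> [|x]; [exact: measurableT_comp|exact: normr_ge0].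
Qed.

Lemma integral_norm_mul (f : T -> R) (v : T -> \bar R) (v0 : T -> R) (A : set T) :
  measurable A -> measurable_fun [set: T] f -> measurable_fun [set: T] v ->
  density v0 -> {ae m, forall x, v x = (v0 x)%:E} ->
  \int[m]_(x in A) `|(f x)%:E * v x| = mass m (fun x => `|f x| * v0 x)%R A.
Proof.
move=> mA mf mv dv vv; apply: integral_ae_mass => //.
- apply: (@measurableT_comp _ _ _ _ _ _ abse) => //; apply: emeasurable_funM => //.
  exact/measurable_EFinP.
- by apply: densityM dv; exact: density_norm.
- apply: filterS vv => x ->.
  by rewrite -EFinM abse_EFin normrM [X in (_ * X)%R]ger0_norm// dv.2.
Qed.

Lemma integral_weighted_power (f : T -> R) (u v : T -> \bar R) (u0 v0 : T -> R)
    (p r : R) : measurable_fun [set: T] f -> measurable_fun [set: T] u ->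
  measurable_fun [set: T] v -> density u0 -> density v0 ->
  {ae m, forall x, u x = (u0 x)%:E} -> {ae m, forall x, v x = (v0 x)%:E} ->
  \int[m]_x ((`|f x| `^ p)%:E * u x `^ r * v x) =
  mass m (fun x => `|f x| `^ p * u0 x `^ r * v0 x)%R [set: T].
Proof.
move=> mf mu mv du dv uu vv; apply: integral_ae_mass => //.
- apply: emeasurable_funM mv; apply: emeasurable_funM.
    apply/measurable_EFinP; exact: (density_powR p (density_norm mf)).1.
  exact: (measurableT_comp (measurable_poweR r) mu).
- by apply: densityM dv; apply: densityM; apply: density_powR => //; exact: density_norm.
- by apply: filterS2 uu vv => x -> ->; rewrite poweR_EFin -!EFinM.
Qed.

Lemma integral_power_le (w : T -> \bar R) (f : T -> R) (E H : set T) (r a : R) :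
  measurable H -> density f -> {ae m, forall x, w x = (f x)%:E} ->
  {ae m, forall x, E x -> H x} -> mass m f H <= r%:E -> (0 <= a)%R ->
  (\int[m]_(x in E) w x) `^ a <= (r `^ a)%:E.
Proof.
move=> mH df wf EH fr a0; have wr : \int[m]_(x in E) w x <= r%:E.
  exact: (le_trans (integral_le_mass mH df wf EH)).
have w0 : 0 <= \int[m]_(x in E) w x.
  by apply: integral_ae_ge0; apply: filterS wf => x ->; rewrite lee_fin df.2.
have r0 : 0 <= r%:E := le_trans w0 wr.
rewrite -poweR_EFin; apply: gt0_ler_poweR => //.
- by rewrite in_itv/= w0 leey.
- by rewrite in_itv/= r0 leey.
Qed.

End Weights.

(** Since [a + c = 1 / p], the product [F ^ a * F ^ c] is
    [s * u ^ a * v ^ (1 / p)], which is [s * (V * U) ^ a]. *)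
Lemma weak_type_factor (R : realType) (a c e p q s u v h U V F : R) :
  (0 < p)%R -> (a = q^-1)%R -> (a + c = p^-1)%R -> (0 <= s)%R -> (0 < a)%R ->
  (0 < u)%R -> (0 < v)%R -> (0 < h)%R -> (0 < U)%R -> (0 < V)%R ->
  (V * U = u * v `^ (q / p))%R -> (V `^ a * h `^ e = v)%R ->
  (F = s `^ p * u `^ (p / q) * v)%R ->
  (s * v = (F / U) `^ a * F `^ c * h `^ e)%R.
Proof.
move=> p0 aE acE s0 a0 u0 v0 h0 U0 V0 VU Vh FE.
have q0 : q != 0%R by apply/eqP => q0; move: a0; rewrite aE q0 invr0 ltxx.
have [s_eq0|sn0] := eqVneq s 0%R.
  have -> : F = 0%R by rewrite FE s_eq0 powR0 ?gt_eqF// !mul0r.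
  by rewrite s_eq0 !mul0r (powR0 (lt0r_neq0 a0)) !mul0r.
have s0' : (0 < s)%R by rewrite lt_neqAle eq_sym sn0.
have F0 : (0 < F)%R by rewrite FE !mulr_gt0 ?powR_gt0.
have Ua0 : (0 < U `^ a)%R by exact: powR_gt0.
have FU : ((F / U) `^ a = F `^ a / U `^ a)%R.
  rewrite powRM ?invr_ge0 ?ltW//; congr (_ * _)%R.
  by rewrite -(powR_inv1 (ltW U0)) -powRrM mulN1r powRN.
have Fac : (F `^ a * F `^ c = s * u `^ a * v `^ p^-1)%R.
  rewrite -powRD ?(gt_eqF F0) ?implybT// acE FE !powRM ?mulr_ge0 ?powR_ge0 ?ltW//.
  rewrite -!powRrM mulfV ?gt_eqF// powRr1// (_ : p / q * p^-1 = a)%R//.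
  by rewrite aE; field; rewrite q0 gt_eqF.
have VUa : (V `^ a * U `^ a = u `^ a * v `^ p^-1)%R.
  rewrite -powRM ?ltW// VU powRM ?powR_ge0 ?ltW// -powRrM (_ : q / p * a = p^-1)%R//.
  by rewrite aE; field; rewrite q0 gt_eqF.
apply: (mulIf (lt0r_neq0 Ua0)).
rewrite FU -{1}Vh.
transitivity (s * (V `^ a * U `^ a) * h `^ e)%R; first by ring.
rewrite VUa.
transitivity (F `^ a * F `^ c * h `^ e)%R; first by rewrite Fac; ring.
by field; rewrite gt_eqF.
Qed.

(** * The weak type inequality *)

Section WeakType.
Context (R : realType) (n : nat).
Local Notation Rn := 'rV[R]_n.
Local Notation LT := (lebesgue_type R n).
Local Notation leb := (@lebesgue_Rn R n).

Lemma lebesgue_trivial : unit_volume R n = 0%R -> leb [set: Rn] = 0.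
Proof.
move=> w0; pose Q k : set Rn := cube_at (const_mx (- k%:R)%R) (2 * k.+1%:R)%R.
have Q0 k : leb (Q k) = 0.
  by rewrite lebesgue_cube ?w0 ?mulr0// mulr_gt0.
apply/eqP; rewrite eq_le measure_ge0 andbT.
apply: (@le_trans _ _ (lebesgue_outer (\bigcup_k Q k))).
  apply: le_lebesgue_outer => x _; pose r := (\sum_i `|x ord0 i|)%R.
  exists (Num.bound r) => // i; rewrite mxE.
  have xr : (`|x ord0 i| <= r)%R.
    by rewrite /r (bigD1 i)//= lerDl; apply: sumr_ge0.
  have r0 : (0 <= r)%R by exact: le_trans xr.
  have := archi_boundP r0; move: xr; rewrite ler_norml => /andP[x1 x2] rb.
  rewrite -natr1; apply/andP; split; lra.
apply: (le_trans (lebesgue_outer_sigma_subadditive Q)).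
by rewrite eseries0// => i _ _; exact: Q0.
Qed.

Lemma lt_frac_maximal (gamma t v0 : R) (phi : Rn -> \bar R) (X : \bar R) x :
  (0 < unit_volume R n)%R -> (0 < v0)%R ->
  X = v0%:E -> t%:E < frac_maximal gamma phi x / X ->
  exists z l, [/\ (0 < l)%R, cube_at z l x &
    (t * v0 * (l ^+ n * unit_volume R n) `^ (1 - gamma / n%:R))%:E <
      \int[leb]_(y in cube_at z l) `|phi y|].
Proof.
move=> w0 v00 ->; rewrite inver (gt_eqF v00) lte_pdivlMr//.
move=> /ereal_sup_gt[_ [Q [[z [l l0 ->]] Qx] <-]] H.
exists z, l; split => //; move: H.
rewrite (lebesgue_cube z l0) poweR_EFin inver.
set M := powR _ _.
have M0 : (0 < M)%R by rewrite powR_gt0// mulr_gt0// exprn_gt0.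
by rewrite (gt_eqF M0) lte_pdivlMl// -!EFinM mulrC.
Qed.

(** The mixed inequality is applied to [F / U], whose [b]-averages have to be
    finite numbers. *)
Definition finite_lifts (b U : LT -> R) := forall (F : LT -> R) L A k x, (0 < L)%R ->
  density F -> mass leb F [set: LT] < +oo ->
  mass leb (fun y => F y / U y * b y)%R (cell (dyadic_key L A) k x) < +oo.

(** The level set bound is applied with [K] equal to the integral of
    [|f| ^ p * u ^ (p / q) * v], or with every [K > 0] if that integral
    vanishes. *)
Lemma fractional_weak_type (gamma p q : R) (u v : Rn -> \bar R)
    (u0 v0 b h U V : LT -> R) (Cb Ch C0 : R) :
  (0 < unit_volume R n)%R -> (0 < gamma < n%:R)%R -> (1 <= p < n%:R / gamma)%R ->
  (q^-1 = p^-1 - gamma / n%:R)%R ->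
  measurable_fun [set: LT] u -> measurable_fun [set: LT] v ->
  pos_density u0 -> pos_density v0 ->
  pos_density b -> pos_density h -> pos_density U -> pos_density V ->
  {ae leb, forall x, u x = (u0 x)%:E} -> {ae leb, forall x, v x = (v0 x)%:E} ->
  (forall x, V x * U x = u0 x * v0 x `^ (q / p))%R ->
  (forall x, V x `^ q^-1 * h x `^ (1 - p^-1) = v0 x)%R ->
  (0 < Cb)%R -> (0 < Ch)%R -> (0 < C0)%R ->
  all_grids_A1 b Cb -> all_grids_A1 h Ch -> mixed_on_grids b U V C0 ->
  finite_lifts b U ->
  exists2 C : R, (0 < C)%R & forall (t : R) (f : Rn -> R), (0 < t)%R ->
    measurable_fun [set: LT] f ->
    (wmeasure (fun x => u x * v x `^ (q / p))
       [set x | t%:E < frac_maximal gamma (fun y => (f y)%:E * v y) x / v x]) `^ q^-1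
    <= (C / t)%:E * (\int[leb]_x ((`|f x| `^ p)%:E * u x `^ (p / q) * v x)) `^ p^-1.
Proof.
move=> w0 /andP[g0 gn] /andP[p1 pn] hq mu mv pu0 pv0 pb ph pU pV uu vv VU Vh
  Cb0 Ch0 C00 bA1 hA1 mixed lifts.
have n0 : (0 < n%:R :> R)%R := lt_trans g0 gn.
have p0 : (0 < p)%R := lt_le_trans ltr01 p1.
set a := (q^-1)%R in hq Vh *; set c := (gamma / n%:R)%R in hq *.
have a0 : (0 < a)%R.
  by rewrite hq subr_gt0 /c -invf_div ltf_pV2 ?posrE// divr_gt0.
have c0 : (0 <= c)%R by rewrite divr_ge0// ltW.
have pV1 : (p^-1 <= 1)%R by rewrite invf_le1.
have e0 : (0 <= 1 - p^-1)%R by lra.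
have ac : (a + c = p^-1)%R by lra.
have ace : (a + c + (1 - p^-1) = 1)%R by lra.
pose grids := {ffun 'I_n -> bool}.
have N0 : (0 < #|grids|%:R :> R)%R.
  by rewrite ltr0n; apply/card_gt0P; exists [ffun=> false].
pose C := ((#|grids|%:R * C0 * Cb) `^ a * (2 + Ch) / level_set_constant n c)%R.
have C_gt0 : (0 < C)%R.
  apply: divr_gt0; last by rewrite invr_gt0 powR_gt0// exprn_gt0.
  by apply: mulr_gt0; [apply: powR_gt0; rewrite !mulr_gt0|lra].
exists C => // t f t0 mf.
pose s (y : LT) : R := `|f y|%R.
have ds : density s := density_norm mf.
pose F (y : LT) : R := (s y `^ p * u0 y `^ (p / q) * v0 y)%R.
have dF : density F.
  exact: (densityM (densityM (density_powR p ds) (density_powR (p / q) pu0.1)) pv0.1).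
pose g (y : LT) : R := (F y / U y)%R.
have dg : density g := density_div dF pU.
pose phi (y : LT) : R := (s y * v0 y)%R.
have dphi : density phi := densityM ds pv0.1.
rewrite (integral_weighted_power p (p / q) mf mu mv pu0.1 pv0.1 uu vv) -/F.
have dVU : density (fun x => V x * U x)%R := densityM pV.1 pU.1.
set E := [set x | _]; set w := fun x => _.
have wE : {ae leb, forall x, w x = (V x * U x)%:E}.
  refine (ae_imp (ae_mul_powR (q / p) uu vv) _) => x wx.
  by rewrite /w wx VU.
have main K : (0 < K)%R -> mass leb F [set: LT] <= K%:E ->
    wmeasure w E `^ a <= (C / t * K `^ p^-1)%:E.
  move=> K0 FK.
  have Foo : mass leb F [set: LT] < +oo := le_lt_trans FK (ltry K).
  have gU y : (g y * U y = F y)%R by rewrite /g divfK// gt_eqF ?(pU.2 y).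
  have phiE y : (phi y = g y `^ a * F y `^ c * h y `^ (1 - p^-1))%R.
    exact: (@weak_type_factor R a c (1 - p^-1) p q (s y) (u0 y) (v0 y) (h y)
      (U y) (V y) (F y) p0 erefl ac (ds.2 y) a0 (pu0.2 y) (pv0.2 y) (ph.2 y)
      (pU.2 y) (pV.2 y) (VU y) (Vh y) erefl).
  have [H [r [mH r0 rH rC HP]]] := fractional_level_set w0 pb ph pU pV pv0 dphi dg dF a0
    c0 e0 ace phiE gU Vh Cb0 Ch0 C00 K0 t0 bA1 hA1 mixed
    (fun L A k x L0 => lifts F L A k x L0 dF Foo) FK.
  have EH : {ae leb, forall x, E x -> H x}.
    refine (ae_imp2 HP vv _) => x xH vx Ex; apply: xH.
    have [z [l [l0 xQ ft]]] := lt_frac_maximal w0 (pv0.2 x) vx Ex.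
    exists z, l; split; [exact: l0|exact: xQ|].
    by move: ft; rewrite (integral_norm_mul (measurable_cube z l) mf mv pv0.1 vv).
  apply: (le_trans (integral_power_le mH dVU wE EH rH (ltW a0))).
  rewrite lee_fin; apply: (le_trans rC).
  by rewrite (_ : 1 - (1 - p^-1) = p^-1)%R//; lra.
have Ct0 : (0 < C / t)%R by exact: divr_gt0.
have F0 : 0 <= mass leb F [set: LT] by exact: (mass_ge0 _ _ dF).
have [Foo|Foo] := eqVneq (mass leb F [set: LT]) +oo.
  rewrite Foo poweRyr ?gt_eqF ?invr_gt0// gt0_muley ?leey// lte_fin.
have FK : mass leb F [set: LT] = (fine (mass leb F [set: LT]))%:E.
  by rewrite fineK// ge0_fin_numE// ltey.
move: F0 main; rewrite FK; move: (fine _) => K; rewrite lee_fin le_eqVlt.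
move=> /predU1P[<-|K0] main; last by rewrite poweR_EFin -EFinM; exact: main.
rewrite poweR_EFin powR0 ?gt_eqF ?invr_gt0// mule0.
apply/lee_addgt0Pr => eps eps0; rewrite add0e.
have y0 : (0 < eps / (C / t))%R by exact: divr_gt0.
apply: (le_trans (main ((eps / (C / t)) `^ p)%R _ _)).
- exact: powR_gt0.
- by rewrite lee_fin powR_ge0.
rewrite lee_fin -powRrM mulfV ?gt_eqF// powRr1 ?(ltW y0)//.
by rewrite mulrC divfK// gt_eqF.
Qed.

Lemma mixed_on_gridsS (b U V : LT -> R) (C C' : R) : (C <= C')%R -> density U ->
  mixed_on_grids b U V C -> mixed_on_grids b U V C'.
Proof.
move=> CC dU mixed L A g L0 dg; apply: (le_trans (mixed L A g L0 dg)).
apply: lee_wpmul2r; last by rewrite lee_fin.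
exact: (mass_ge0 _ _ (densityM dg dU)).
Qed.

Lemma all_grids_A1_cst : all_grids_A1 (fun _ : LT => 1%R : R) 1%R.
Proof.
move=> L A L0; apply: aeW => x k.
rewrite mass_cst//; first by rewrite mulr1.
exact: (dyadic_grid A L0).1.
Qed.

Lemma finite_lifts_A1 (U : LT -> R) C : (0 < unit_volume R n)%R -> (0 < C)%R ->
  pos_density U -> all_grids_A1 U C -> finite_lifts (fun _ : LT => 1%R) U.
Proof.
move=> w0 C0 pU UA1 F L A k x L0 dF Foo.
have E1 : (fun y => F y / U y * 1)%R = (fun y => F y / U y)%R.
  by apply/funext => y; rewrite mulr1.
have E2 : (fun y => F y / U y * U y)%R = F.
  by apply/funext => y; rewrite divfK// gt_eqF ?(pU.2 y).
rewrite E1; apply: (grid_A1_mul_fin (dyadic_grid A L0) (dyadic_volume w0 A L0) k x C0 pU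
  (UA1 L A L0) (density_div dF pU)).
by rewrite E2.
Qed.

Lemma finite_lifts_refl (U : LT -> R) : pos_density U -> finite_lifts U U.
Proof.
move=> pU F L A k x L0 dF Foo.
have -> : (fun y => F y / U y * U y)%R = F.
  by apply/funext => y; rewrite divfK// gt_eqF ?(pU.2 y).
apply: le_lt_trans Foo.
exact: (le_mass_set leb ((dyadic_grid A L0).1 k x) measurableT dF (@subsetT _ _)).
Qed.

Lemma all_grids_A1_root (w : LT -> R) C s : (0 < unit_volume R n)%R -> (0 < C)%R ->
  (1 <= s)%R -> pos_density w -> all_grids_A1 (fun x => w x `^ s)%R C ->
  all_grids_A1 w (1 + C).
Proof.
move=> w0 C0 s1 pw wA1 L A L0.
exact: (grid_A1_root (dyadic_grid A L0) (dyadic_volume w0 A L0) C0 s1 pw (wA1 L A L0)).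
Qed.

Lemma conj_ratioE (p q : R) : (1 <= p)%R -> conj_ratio q p = (q * (1 - p^-1))%R.
Proof.
move=> p1; have p0 : (p != 0)%R by rewrite gt_eqF// (lt_le_trans ltr01).
have E : (hoelder_conjugate p%:E)^-1 = (1 - p^-1)%:E.
  have := @hoelder_conjugate_eq1 R p%:E (ltNyr p); rewrite eqe => /(_ p0).
  rewrite inver (negbTE p0); case: (_^-1)%E => [r| |]//.
  by rewrite -EFinD => -[<-]; rewrite addrAC subrr add0r.
by rewrite /conj_ratio E.
Qed.

End WeakType.

(** * The two pairs of hypotheses *)

Section TwoCases.
Context (R : realType) (n : nat).
Local Notation Rn := 'rV[R]_n.
Local Notation LT := (lebesgue_type R n).
Local Notation leb := (@lebesgue_Rn R n).

Lemma powR_split (v p q : R) : (0 < v)%R -> q != 0%R ->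
  ((v `^ (q / p)) `^ q^-1 * v `^ (1 - p^-1) = v)%R.
Proof.
move=> v0 q0; rewrite -powRrM -powRD; last by rewrite (gt_eqF v0) implybT.
by rewrite mulrAC mulfV// mul1r addrC subrK powRr1// ltW.
Qed.

Lemma target_exponent_gt0 (gamma p q : R) : (0 < gamma < n%:R)%R ->
  (1 <= p < n%:R / gamma)%R -> (q^-1 = p^-1 - gamma / n%:R)%R -> (0 < q)%R.
Proof.
move=> /andP[g0 gn] /andP[p1 pn] hq; have p0 : (0 < p)%R := lt_le_trans ltr01 p1.
rewrite -invr_gt0 hq subr_gt0 -invf_div ltf_pV2 ?posrE// divr_gt0//.
exact: lt_trans gn.
Qed.

Section Data.
Variables (gamma p q : R) (u v : Rn -> \bar R) (u0 v0 : LT -> R).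
Hypothesis volume_gt0 : (0 < unit_volume R n)%R.
Hypotheses (hgamma : (0 < gamma < n%:R)%R) (hp : (1 <= p < n%:R / gamma)%R).
Hypothesis hq : (q^-1 = p^-1 - gamma / n%:R)%R.
Hypotheses (mu : measurable_fun [set: LT] u) (mv : measurable_fun [set: LT] v).
Hypotheses (pu : pos_density u0) (pv : pos_density v0).
Hypotheses (uu : {ae leb, forall x, u x = (u0 x)%:E}).
Hypotheses (vv : {ae leb, forall x, v x = (v0 x)%:E}).

Let p_gt0 : (0 < p)%R. Proof. by case/andP: hp => p1 _; exact: lt_le_trans p1. Qed.

Let q_gt0 : (0 < q)%R. Proof. exact: target_exponent_gt0 hgamma hp hq. Qed.

Let qp_ge1 : (1 <= q / p)%R.
Proof.
rewrite ler_pdivlMr// mul1r -lef_pV2 ?posrE// hq gerBl.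
by case/andP: hgamma => g0 gn; rewrite divr_ge0// ltW// (lt_trans g0).
Qed.

Definition weak_type_bound := exists2 C : R, (0 < C)%R &
  forall (t : R) (f : Rn -> R), (0 < t)%R -> measurable_fun [set: LT] f ->
    (wmeasure (fun x => u x * v x `^ (q / p))
       [set x | t%:E < frac_maximal gamma (fun y => (f y)%:E * v y) x / v x]) `^ q^-1
    <= (C / t)%:E * (\int[leb]_x ((`|f x| `^ p)%:E * u x `^ (p / q) * v x)) `^ p^-1.

Lemma weak_type_A1_A1 : A1 u -> A1 (fun x => v x `^ (q / p)) -> weak_type_bound.
Proof.
move=> Au Av; have [Cu Cu1 uA1] := A1_all_grids volume_gt0 mu pu uu Au.
pose V (x : LT) : R := (v0 x `^ (q / p))%R.
have pV : pos_density V := pos_density_powR (q / p) pv.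
have mV : measurable_fun [set: LT] (fun x => v x `^ (q / p)).
  exact: (measurableT_comp (measurable_poweR (q / p)) mv).
have VV : {ae leb, forall x, v x `^ (q / p) = (V x)%:E}.
  by refine (ae_imp vv _) => x ->; rewrite poweR_EFin.
have [Cv Cv1 VA1] := A1_all_grids volume_gt0 mV pV VV Av.
have Cu0 : (0 < Cu)%R := lt_le_trans ltr01 Cu1.
have Cv0 : (0 < Cv)%R := lt_le_trans ltr01 Cv1.
have vA1 : all_grids_A1 v0 (1 + Cv) := all_grids_A1_root volume_gt0 Cv0 qp_ge1 pv VA1.
have := mixed_on_grids_A1 volume_gt0 pu pV Cu1 Cv0 uA1 VA1.
set C := weak_constant _ _ _ _ _ _ => mixed.
have C1 : (C <= Num.max 1 C :> R)%R by rewrite le_max lexx orbT.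
rewrite /weak_type_bound; apply: (@fractional_weak_type R n gamma p q u v u0 v0 (fun=> 1%R) v0 u0 V 1%R
  (1 + Cv)%R (Num.max 1 C)%R volume_gt0 hgamma hp hq mu mv pu pv _ pv pu pV uu vv).
- exact: pos_density1.
- by move=> x; rewrite mulrC.
- by move=> x; exact: (powR_split p (pv.2 x) (lt0r_neq0 q_gt0)).
- exact: ltr01.
- by rewrite addr_gt0.
- by rewrite lt_max ltr01.
- exact: all_grids_A1_cst.
- exact: vA1.
- exact: (mixed_on_gridsS C1 pu.1 mixed).
- exact: (finite_lifts_A1 volume_gt0 Cu0 pu uA1).
Qed.

Lemma weak_type_A1_Ainfty : A1 (fun x => u x * v x `^ (- conj_ratio q p)) ->
  Ainfty_weighted (fun x => u x * v x `^ (- conj_ratio q p)) (fun x => v x `^ q) ->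
  weak_type_bound.
Proof.
have [p1 _] := andP hp; rewrite (conj_ratioE q p1); set r := (q * _)%R.
set B := fun x => u x * _; move=> AB AW.
have mB : measurable_fun [set: LT] B.
  apply: (emeasurable_funM mu).
  exact: (measurableT_comp (measurable_poweR (- r)) mv).
have mW : measurable_fun [set: LT] (fun x => v x `^ q).
  exact: (measurableT_comp (measurable_poweR q) mv).
pose b (x : LT) : R := (u0 x * v0 x `^ (- r))%R.
pose V (x : LT) : R := (v0 x `^ q)%R.
have pb : pos_density b := pos_densityM pu (pos_density_powR (- r) pv).
have pV : pos_density V := pos_density_powR q pv.
have Bb : {ae leb, forall x, B x = (b x)%:E} := ae_mul_powR (- r) uu vv.
have WV : {ae leb, forall x, v x `^ q = (V x)%:E}.
  by refine (ae_imp vv _) => x ->; rewrite poweR_EFin.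
have [Cb Cb1 bA1] := A1_all_grids volume_gt0 mB pb Bb AB.
have Cb0 : (0 < Cb)%R := lt_le_trans ltr01 Cb1.
have [s [K [s0 K0 H]]] := Ainfty_all_grids volume_gt0 mB mW pb pV Bb WV bA1 AW.
have := mixed_on_grids_Ainfty volume_gt0 pb pV Cb0 s0 K0 bA1 H.
set C := weak_constant _ _ _ _ _ _ => mixed.
have C1 : (C <= Num.max 1 C :> R)%R by rewrite le_max lexx orbT.
rewrite /weak_type_bound; apply: (@fractional_weak_type R n gamma p q u v u0 v0 b (fun=> 1%R) b V Cb
  1%R (Num.max 1 C)%R volume_gt0 hgamma hp hq mu mv pu pv pb _ pb pV uu vv).
- exact: pos_density1.
- move=> x; rewrite /V /b mulrCA -powRD; last by rewrite (gt_eqF (pv.2 x)) implybT.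
  by rewrite /r mulrBr mulr1 opprB addrC subrK.
- move=> x; rewrite powR1 mulr1 /V -powRrM mulfV ?(lt0r_neq0 q_gt0)//.
  by rewrite powRr1// ltW ?(pv.2 x).
- exact: Cb0.
- exact: ltr01.
- by rewrite lt_max ltr01.
- exact: bA1.
- exact: all_grids_A1_cst.
- exact: (mixed_on_gridsS C1 pb.1 mixed).
- exact: (finite_lifts_refl pb).
Qed.

End Data.

Lemma weak_type_trivial (gamma p q : R) (u v : Rn -> \bar R) : q != 0%R ->
  unit_volume R n = 0%R -> weak_type_bound gamma p q u v.
Proof.
move=> q0 w0; exists 1%R => // t f t0 mf.
rewrite /wmeasure (integral_ae_null _ _ (lebesgue_trivial w0)).
rewrite poweR_EFin powR0 ?invr_eq0// mule_ge0 ?poweR_ge0//.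
by rewrite lee_fin divr_ge0// ltW.
Qed.

End TwoCases.

Theorem theorem1 (R : realType) (n : nat) (gamma p q : R)
    (hgamma : (0 < gamma < n%:R)%R) (hp : (1 <= p < n%:R / gamma)%R)
    (hq : (q^-1 = p^-1 - gamma / n%:R)%R)
    (u v : 'rV[R]_n -> \bar R) (hu : weight u) (hv : weight v)
    (huv : (A1 u /\ A1 (fun x => v x `^ (q / p))) \/
      (A1 (fun x => u x * v x `^ (- conj_ratio q p)) /\
       Ainfty_weighted (fun x => u x * v x `^ (- conj_ratio q p))
         (fun x => v x `^ q))) :
  exists2 C : R, (0 < C)%R &
    forall (t : R) (f : 'rV[R]_n -> R), (0 < t)%R ->
      measurable_fun [set: lebesgue_type R n] f ->
      (exists M : R, forall x, (`|f x| <= M)%R) ->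
      compact (closure [set x | f x != 0%R]) ->
      (wmeasure (fun x => u x * v x `^ (q / p))
         [set x | t%:E <
            frac_maximal gamma (fun y => (f y)%:E * v y) x / v x]) `^ q^-1
      <= (C / t)%:E *
         (\int[@lebesgue_Rn R n]_x
            ((`|f x| `^ p)%:E * u x `^ (p / q) * v x)) `^ p^-1.
Proof.
have q_gt0 := target_exponent_gt0 hgamma hp hq.
suff [C C0 H] : weak_type_bound gamma p q u v.
  by exists C => // t f t0 mf _ _; exact: H.
have [w0|w0] := eqVneq (unit_volume R n) 0%R.
  exact: (weak_type_trivial gamma p u v (lt0r_neq0 q_gt0) w0).
have {}w0 : (0 < unit_volume R n)%R by rewrite lt_neqAle eq_sym w0 unit_volume_ge0.
have [mu _ u_pos] := hu; have [mv _ v_pos] := hv.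
have [u0 pu uu] := pos_representative mu u_pos.
have [v0 pv vv] := pos_representative mv v_pos.
case: huv => -[H1 H2].
  exact: (weak_type_A1_A1 w0 hgamma hp hq mu mv pu pv uu vv H1 H2).
exact: (weak_type_A1_Ainfty w0 hgamma hp hq mu mv pu pv uu vv H1 H2).
Qed.
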